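(* Let $\mathcal{C}'\subset\mathbb{P}^2$ be a reduced curve and $L\subset\mathbb{P}^2$ a line not contained in $\mathcal{C}'$; set $\mathcal{C}=\mathcal{C}'\cup L$ and $\mathcal{C}''=\mathcal{C}'\cap L$. Let $d_2,d_3$ be integers with $|\mathcal{C}''|+\epsilon(\mathcal{C}',L)=d_2+1$. Then the following are equivalent: (1) $\mathcal{C}'$ is free with exponents $(d_2,d_3)$; (2) $\mathcal{C}$ is free with exponents $(d_2,d_3+1)$.
   Context: $S=\mathbb{C}[x,y,z]$ with standard grading. A reduced curve $\mathcal{C}\subset\mathbb{P}^2$ is given by a reduced homogeneous $f_{\mathcal{C}}\in S$. A derivation $\theta=\sum f_i\partial_i$ is homogeneous of degree $k$ if all $f_i$ are homogeneous of degree $k$. $D_0(\mathcal{C})=\{\theta\in\mathrm{Der}(S):\theta(f_{\mathcal{C}})=0\}$. $\mathcal{C}$ is free if $D_0(\mathcal{C})$ is a free $S$-module (necessarily of rank 2); its exponents are the degrees of a homogeneous basis of $D_0(\mathcal{C})$. $\mathcal{E}_{\mathcal{C}}$ is the sheafification of $D_0(\mathcal{C})$ (a rank 2 vector bundle on $\mathbb{P}^2$). $|\mathcal{C}''|$ is the number of distinct points of $\mathcal{C}'\cap L$. For a reduced curve $\mathcal{C}'$ and a line $L\not\subset\mathcal{C}'$, $\epsilon(\mathcal{C}',L)\in\mathbb{Z}$ is the integer defined by A. Dimca, which measures the failure of the singularities of $\mathcal{C}'\cup L$ on $L$ to be quasi-homogeneous (it is $0$ if all these singularities are quasi-homogeneous),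 and for which there is an exact sequence of vector bundles $0\to\mathcal{E}_{\mathcal{C}'}(-1)\xrightarrow{\alpha_L}\mathcal{E}_{\mathcal{C}'\cup L}\to\mathcal{O}_L(1-|\mathcal{C}'\cap L|-\epsilon(\mathcal{C}',L))\to0$, $\alpha_L$ being a linear form defining $L$. *)

(* Defs.v *)
From HB Require Import structures.
From mathcomp Require Import all_boot all_algebra.
From mathcomp Require Import complex Rstruct.
From mathcomp.multinomials Require Import mpoly.
Set Implicit Arguments. Unset Strict Implicit. Unset Printing Implicit Defensive.
Import GRing.Theory.
Local Open Scope ring_scope.

Definition CC : closedFieldType := (Rdefinitions.R)[i].

Definition S := {mpoly CC[3]}.

(* A vector of C^3 (affine representative of a point of P^2). *)
Definition vec3 := 'I_3 -> CC.
Definition nonzero_vec (v : vec3) : Prop := exists i, v i != 0.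
Definition proportional (v w : vec3) : Prop := exists c : CC, forall i, w i = c * v i.

(* A derivation theta = sum_i f_i d_i of S, given by its coefficients f_i. *)
Definition derivation := 'I_3 -> S.

Definition der_apply (th : derivation) (f : S) : S :=
  \sum_(i < 3) th i * mderiv i f.

Definition inD0 (f : S) (th : derivation) : Prop := der_apply th f = 0.

Definition homog_der (th : derivation) (k : int) : Prop :=
  exists n : nat, k = n%:Z /\ forall i, th i \is n.-homog.

Definition free_with_exponents (f : S) (a b : int) : Prop :=
  exists th1 th2 : derivation,
    [/\ inD0 f th1, inD0 f th2, homog_der th1 a, homog_der th2 b &
      forall th, inD0 f th ->
        (exists g1 g2 : S, forall i, th i = g1 * th1 i + g2 * th2 i) /\
        (forall g1 g2 h1 h2 : S,
            (forall i, g1 * th1 i + g2 * th2 i = h1 * th1 i + h2 * th2 i) ->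
            g1 = h1 /\ g2 = h2)].

Definition reduced_curve (f : S) : Prop :=
  [/\ (exists d : nat, (0 < d)%N /\ f \is d.-homog),
      f != 0 &
      forall g h : S, f = g * g * h -> exists c : CC, g = c%:MP].

Definition linear_form (a : S) : Prop := a != 0 /\ a \is 1.-homog.

Definition divides (g f : S) : Prop := exists h : S, f = g * h.

Definition enumerates_points (P : vec3 -> Prop) (n : nat) (pts : 'I_n -> vec3)
  : Prop :=
  [/\ forall k, nonzero_vec (pts k) /\ P (pts k),
      forall k l, proportional (pts k) (pts l) -> k = l &
      forall v, nonzero_vec v -> P v -> exists k, proportional (pts k) v].

Definition in_ideal (gens : seq S) (h : S) : Prop :=
  exists c : 'I_(size gens) -> S, h = \sum_(k < size gens) c k * gens`_k.

(* h lies in the ideal generated by gens in the local ring O_{P^2,v}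
   (gens, h homogeneous): u h is in the ideal for some u with u(v) <> 0. *)
Definition in_local_ideal (gens : seq S) (v : vec3) (h : S) : Prop :=
  exists u : S, u.@[v] != 0 /\ in_ideal gens (u * h).

(* dim_C O_{P^2,v} / (gens) = n.  Elements of O_{P^2,v} are quotients h/l^e
   with h homogeneous of degree e and l a linear form with l(v) <> 0, and
   h/l^e lies in the local ideal iff h is in_local_ideal. *)
Definition local_dim (gens : seq S) (v : vec3) (n : nat) : Prop :=
  (exists (e : nat) (hs : 'I_n -> S),
      (forall k, hs k \is e.-homog) /\
      forall c : 'I_n -> CC,
        in_local_ideal gens v (\sum_(k < n) c k *: hs k) -> forall k, c k = 0)
  /\
  (forall (e : nat) (hs : 'I_n.+1 -> S),
      (forall k, hs k \is e.-homog) ->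
      exists c : 'I_n.+1 -> CC, (exists k, c k != 0) /\
        in_local_ideal gens v (\sum_(k < n.+1) c k *: hs k)).

(* Partial derivatives of f w.r.t. the two affine coordinates of the chart
   {x_i <> 0}. *)
Definition chart_partials (f : S) (i : 'I_3) : seq S :=
  [seq mderiv j f | j <- enum 'I_3 & j != i].

(* Milnor number mu(C, p) of the curve f = 0 at the point v, computed in an
   affine chart x_i = 1 containing v: dim O_p / (g_x, g_y). *)
Definition milnor_number (f : S) (v : vec3) (m : nat) : Prop :=
  exists i : 'I_3, v i != 0 /\ local_dim (chart_partials f i) v m.

Definition tjurina_number (f : S) (v : vec3) (t : nat) : Prop :=
  exists i : 'I_3, v i != 0 /\ local_dim (f :: chart_partials f i) v t.

Definition dimca_epsilon (f' a : S) (eps : int) : Prop :=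
  exists (n : nat) (pts : 'I_n -> vec3) (muC tauC muC' tauC' : 'I_n -> nat),
    [/\ enumerates_points (fun v => f'.@[v] = 0 /\ a.@[v] = 0) pts,
        forall k, milnor_number (f' * a) (pts k) (muC k) /\
                  tjurina_number (f' * a) (pts k) (tauC k),
        forall k, milnor_number f' (pts k) (muC' k) /\
                  tjurina_number f' (pts k) (tauC' k) &
        eps = \sum_(k < n) (((muC k)%:Z - (tauC k)%:Z)
                            - ((muC' k)%:Z - (tauC' k)%:Z))].

Definition num_intersection_points (f' a : S) (n : nat) : Prop :=
  exists pts : 'I_n -> vec3,
    enumerates_points (fun v => f'.@[v] = 0 /\ a.@[v] = 0) pts.

(* Main.v *)
From HB Require Import structures.
Require Import Defs.
From mathcomp Require Import all_boot all_algebra.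
From mathcomp Require Import complex Rstruct.
From mathcomp.multinomials Require Import mpoly.
From mathcomp Require Import boolp ring zify.
Set Implicit Arguments. Unset Strict Implicit. Unset Printing Implicit Defensive.
Import GRing.Theory Num.Theory.
Local Open Scope ring_scope.

(* Let L be the line a = 0, with homogeneous coordinates (L0 : L1), and C : f' a = 0. For a
   derivation th let W(th) = L0 th(L1) - L1 th(L0), the part of th transverse to the Euler field
   along L; it depends only on th modulo the Euler field. Locally at a point p of L on the curve
   f' = 0, in coordinates with L = {y = 0} and g the equation of the curve, colon ideals and the
   comparison of dim O/(g_x, g + y g_y) with dim O/(g_x, y g_y) along the branches of g_x = 0 (by
   Puiseux's theorem) give
     (mu - tau)(C, p) - (mu - tau)(C', p) = k_p - 1,
   where k_p is the colength in O_L of the coefficients of d/dx in the derivations killing f' a,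
   that is, the least order at p of the restrictions W(th)|L for th in D_0(C). So the greatest
   common divisor w of these restrictions has degree |C''| + eps = d2 + 1.
   If th1, th2 is a basis of D_0(C), then w = gcd(W(th1)|L, W(th2)|L), and the degree of w forces
   one of the two restrictions to be w up to a constant. Subtracting a multiple of that derivation
   makes the other restriction vanish, so the other derivation is divisible by a modulo the Euler
   field, and dividing it by a gives a basis of D_0(C'). Conversely, if th1, th2 is a basis of
   D_0(C'), the syzygy of th1(a)|L and th2(a)|L gives the derivation with W = w; its degree forces
   one of the th_i(a)|L to divide the other, so after a change of basis one basis element preserves
   the line, and multiplying the other one by a gives a basis of D_0(C). *)

(** * Power series and Puiseux's theorem *)

(** The Milnor numbers in [dimca_epsilon] refer to a coordinate chart, while the local formula wants
    a chart in which L is an axis. Two dehomogenizations of a form differ by a unit factor, which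
    preserves the Tjurina ideal but in general not the Jacobian one. Changing the chart is therefore
    itself a comparison of intersection numbers along the branches of a partial derivative, and
    [arc_lemma] serves both purposes. No quotient ring is formed: ideals of the local ring are
    contracted to the polynomial ring, and colength is a relation witnessed by a basis. In general
    neither of D_0(C), D_0(C') contains the other. Both are reached from the tangent derivations,
    th(f) = c f, by subtracting a multiple of the Euler field, a correction that W does not see. The
    degree counts rest on explicit elements, f' times a constant vector corrected by the Euler
    field: one shows that w divides f'|L, so that every root of w is a point of C''; another, with W
    = -Z f' on L for the affine parameter Z of L, gives the missing bounds. The point at infinity of
    L is chosen off C', so that f'|L keeps its degree. *)

Section PowerSeries.
Variable F : fieldType.

Record ps := Ps { psc : nat -> F }.
HB.instance Definition _ := gen_eqMixin ps.
HB.instance Definition _ := gen_choiceMixin ps.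

Lemma psP (f g : ps) : (forall n, psc f n = psc g n) -> f = g.
Proof. by case: f => f; case: g => g /= h; congr Ps; apply/funext. Qed.

(** Agreement up to degree n is stable under sums and products, so each ring law for series reduces,
    coefficient by coefficient, to the same law for truncations. *)
Definition ps_agree n (p : {poly F}) (f : ps) :=
  forall i, (i <= n)%N -> p`_i = psc f i.
Definition ps_trunc n (f : ps) : {poly F} := \poly_(i < n) psc f i.

Lemma ps_trunc_agree n f : ps_agree n (ps_trunc n.+1 f) f.
Proof. by move=> i le_in; rewrite coef_poly ltnS le_in. Qed.

Definition ps_zero := Ps (fun=> 0).
Definition ps_one := Ps (fun n => (n == 0%N)%:R).
Definition ps_opp f := Ps (fun n => - psc f n).
Definition ps_add f g := Ps (fun n => psc f n + psc g n).
Definition ps_mul f g := Ps (fun n => \sum_(i < n.+1) psc f i * psc g (n - i)%N).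

Lemma ps_mulE n p q f g : ps_agree n p f -> ps_agree n q g ->
  ps_agree n (p * q) (ps_mul f g).
Proof.
move=> hp hq i le_in; rewrite coefM; apply: eq_bigr => j _ /=.
by rewrite hp ?hq //; move: (ltn_ord j); lia.
Qed.

Lemma ps_addE n p q f g : ps_agree n p f -> ps_agree n q g ->
  ps_agree n (p + q) (ps_add f g).
Proof. by move=> hp hq i le_in; rewrite coefD hp ?hq. Qed.

Lemma ps_oneE n : ps_agree n 1 ps_one.
Proof. by move=> i _; rewrite coef1. Qed.

Lemma ps_addA : associative ps_add.
Proof. by move=> f g h; apply: psP => n /=; rewrite addrA. Qed.
Lemma ps_addC : commutative ps_add.
Proof. by move=> f g; apply: psP => n /=; rewrite addrC. Qed.
Lemma ps_add0 : left_id ps_zero ps_add.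
Proof. by move=> f; apply: psP => n /=; rewrite add0r. Qed.
Lemma ps_addN : left_inverse ps_zero ps_opp ps_add.
Proof. by move=> f; apply: psP => n /=; rewrite addNr. Qed.

HB.instance Definition _ :=
  GRing.isZmodule.Build ps ps_addA ps_addC ps_add0 ps_addN.

Let tr := ps_trunc_agree.

Lemma ps_mulA : associative ps_mul.
Proof.
move=> f g h; apply: psP => n.
rewrite -(ps_mulE (tr f) (ps_mulE (tr g) (tr h)) (leqnn n)).
by rewrite -(ps_mulE (ps_mulE (tr f) (tr g)) (tr h) (leqnn n)) mulrA.
Qed.
Lemma ps_mulC : commutative ps_mul.
Proof.
move=> f g; apply: psP => n.
by rewrite -(ps_mulE (tr f) (tr g) (leqnn n)) mulrC (ps_mulE (tr g) (tr f)).
Qed.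
Lemma ps_mul1 : left_id ps_one ps_mul.
Proof.
move=> f; apply: psP => n.
by rewrite -(ps_mulE (@ps_oneE n) (tr f) (leqnn n)) mul1r tr.
Qed.
Lemma ps_mulDl : left_distributive ps_mul ps_add.
Proof.
move=> f g h; apply: psP => n.
rewrite -(ps_mulE (ps_addE (tr f) (tr g)) (tr h) (leqnn n)) mulrDl.
by rewrite (ps_addE (ps_mulE (tr f) (tr h)) (ps_mulE (tr g) (tr h))).
Qed.
Lemma ps_1neq0 : ps_one != ps_zero.
Proof. by apply/eqP => /(congr1 (fun f => psc f 0%N))/eqP; rewrite /= oner_eq0. Qed.

HB.instance Definition _ := GRing.Zmodule_isComNzRing.Build ps
  ps_mulA ps_mulC ps_mul1 ps_mulDl ps_1neq0.

Lemma pscD (f g : ps) n : psc (f + g) n = psc f n + psc g n. Proof. by []. Qed.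
Lemma pscN (f : ps) n : psc (- f) n = - psc f n. Proof. by []. Qed.
Lemma psc0 n : psc 0 n = 0. Proof. by []. Qed.
Lemma psc1 n : psc 1 n = (n == 0%N)%:R. Proof. by []. Qed.
Lemma pscM (f g : ps) n : psc (f * g) n = \sum_(i < n.+1) psc f i * psc g (n - i)%N.
Proof. by []. Qed.
Lemma pscM0 (f g : ps) : psc (f * g) 0 = psc f 0 * psc g 0.
Proof. by rewrite pscM big_ord1. Qed.

Lemma pscME n p q (f g : ps) : ps_agree n p f -> ps_agree n q g ->
  psc (f * g) n = (p * q)`_n.
Proof. by move=> hp hq; rewrite (ps_mulE hp hq). Qed.

Lemma psc_sum I (r : seq I) (P : pred I) (G : I -> ps) n :
  psc (\sum_(i <- r | P i) G i) n = \sum_(i <- r | P i) psc (G i) n.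
Proof. by elim/big_rec2: _ => // i x y _ <-. Qed.

Definition ps_poly (p : {poly F}) := Ps (fun n => p`_n).

Lemma ps_poly_agree n p : ps_agree n p (ps_poly p).
Proof. by []. Qed.
Lemma ps_poly_is_zmod : zmod_morphism ps_poly.
Proof. by move=> p q; apply: psP => n /=; rewrite coefB. Qed.
Lemma ps_poly_is_monoid : monoid_morphism ps_poly.
Proof.
split=> [|p q]; first by apply: psP => n /=; rewrite coef1.
by apply: psP => n /=; rewrite coefM.
Qed.
HB.instance Definition _ := GRing.isZmodMorphism.Build {poly F} ps ps_poly ps_poly_is_zmod.
HB.instance Definition _ := GRing.isMonoidMorphism.Build {poly F} ps ps_poly ps_poly_is_monoid.

Definition psC (c : F) : ps := ps_poly c%:P.
HB.instance Definition _ := GRing.RMorphism.copy psC (ps_poly \o polyC).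

Lemma psc_C c n : psc (psC c) n = if n == 0%N then c else 0.
Proof. by rewrite /= coefC. Qed.

Lemma psc0_is_zmod : zmod_morphism (psc^~ 0%N). Proof. by []. Qed.
Lemma psc0_is_monoid : monoid_morphism (psc^~ 0%N).
Proof. by split=> // f g; rewrite pscM0. Qed.
Definition psc0m (f : ps) := psc f 0.
HB.instance Definition _ := GRing.isZmodMorphism.Build ps F psc0m psc0_is_zmod.
HB.instance Definition _ := GRing.isMonoidMorphism.Build ps F psc0m psc0_is_monoid.

Definition ps_t : ps := ps_poly 'X.

Lemma psc_tXM n (f : ps) i : psc (ps_t ^+ n * f) i = if (i < n)%N then 0 else psc f (i - n).
Proof.
have -> : ps_t ^+ n = ps_poly 'X^n by rewrite rmorphXn.
rewrite (pscME (@ps_poly_agree i 'X^n) (tr f)) coefXnM.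
by case: ltnP => // le_ni; rewrite tr // leq_subr.
Qed.

Definition ps_shift n (f : ps) := Ps (fun i => psc f (i + n)%N).
Lemma ps_shiftK n (f : ps) : (forall i, (i < n)%N -> psc f i = 0) ->
  f = ps_t ^+ n * ps_shift n f.
Proof.
move=> h; apply: psP => i; rewrite psc_tXM; case: ltnP => [/h//|le_ni] /=.
by rewrite subnK.
Qed.

Definition has_ord (f : ps) o := (forall i, (i < o)%N -> psc f i = 0) /\ psc f o != 0.

Lemma has_ord_exists f : f != 0 -> exists o, has_ord f o.
Proof.
move=> fn0; have exn : exists n, psc f n != 0.
  apply: contrapT => h; move/eqP: fn0; apply; apply: psP => n; rewrite psc0.
  by apply/eqP/negPn/negP => h1; apply: h; exists n.
exists (ex_minn exn); case: ex_minnP => m hm hmin; split => // i lt_im.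
by apply/eqP/negPn/negP => /hmin; rewrite leqNgt lt_im.
Qed.

Lemma has_ord_neq0 f o : has_ord f o -> f != 0.
Proof. by case=> _; apply: contraNneq => ->. Qed.

Lemma has_ord_uniq f o o' : has_ord f o -> has_ord f o' -> o = o'.
Proof.
case=> h1 h2 [h1' h2']; case: (ltngtP o o') => // lt.
  by rewrite h1' ?eqxx in h2.
by rewrite h1 ?eqxx in h2'.
Qed.

Lemma has_ordM f g o o' : has_ord f o -> has_ord g o' -> has_ord (f * g) (o + o').
Proof.
move=> [hf hfo] [hg hgo]; rewrite (ps_shiftK hf) (ps_shiftK hg).
rewrite mulrACA -exprD; split=> [i lt_i|]; rewrite psc_tXM ?lt_i //.
by rewrite ltnn subnn pscM0 /= !add0n mulf_neq0.
Qed.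

Lemma ps_mul_eq0 (f g : ps) : f * g = 0 -> f = 0 \/ g = 0.
Proof.
have [->|/has_ord_exists[o ho]] := eqVneq f 0; first by left.
have [->|/has_ord_exists[o' ho']] := eqVneq g 0; first by right.
by move=> h; move: (has_ord_neq0 (has_ordM ho ho')); rewrite h eqxx.
Qed.

Lemma has_ordM_inv f g o o' : has_ord f o -> has_ord (f * g) (o + o') -> has_ord g o'.
Proof.
move=> hf hfg; have gn0 : g != 0.
  by apply/eqP => g0; move: (has_ord_neq0 hfg); rewrite g0 mulr0 eqxx.
have [o1 ho1] := has_ord_exists gn0.
by have /addnI <- := has_ord_uniq (has_ordM hf ho1) hfg.
Qed.

Lemma has_ordD f g o : has_ord f o -> (forall i, (i <= o)%N -> psc g i = 0) ->
  has_ord (f + g) o.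
Proof.
move=> [h1 h2] hg; split=> [i lt|]; rewrite pscD hg ?addr0 //; last exact: ltnW.
exact: h1.
Qed.

Definition ps_deriv (f : ps) := Ps (fun n => psc f n.+1 *+ n.+1).

Lemma ps_derivE n p f : ps_agree n.+1 p f -> ps_agree n p^`() (ps_deriv f).
Proof. by move=> hp i le_in; rewrite coef_deriv /= hp. Qed.
Lemma ps_derivD f g : ps_deriv (f + g) = (ps_deriv f) + (ps_deriv g).
Proof. by apply: psP => n; rewrite /= mulrnDl. Qed.
Lemma ps_derivM f g : ps_deriv (f * g) = (ps_deriv f) * g + f * (ps_deriv g).
Proof.
apply: psP => n; rewrite -(ps_derivE (ps_mulE (tr f) (tr g)) (leqnn n)) derivM.
have tr' h : ps_agree n (ps_trunc n.+2 h) h by move=> i le; rewrite tr // ltnW.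
by rewrite (ps_addE (ps_mulE (ps_derivE (tr f)) (tr' g)) (ps_mulE (tr' f) (ps_derivE (tr g)))).
Qed.
Lemma ps_derivC c : ps_deriv (psC c) = 0.
Proof. by apply: psP => n; rewrite /= coefC mul0rn. Qed.

Hypothesis char0 : forall n, n.+1%:R != 0 :> F.

Lemma has_ord_deriv f o : has_ord f o.+1 -> has_ord (ps_deriv f) o.
Proof.
move=> [h1 h2]; split=> [i lt|/=]; first by rewrite /= h1 ?mul0rn.
by rewrite -mulr_natr mulf_neq0.
Qed.
Lemma ps_deriv_eq0 f : (ps_deriv f) = 0 -> f = psC (psc f 0).
Proof.
move=> h; apply: psP => -[|n]; rewrite psc_C //=.
have /eqP := congr1 (psc^~ n) h.
by rewrite /= -mulr_natr mulf_eq0 (negPf (char0 _)) orbF => /eqP.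
Qed.

End PowerSeries.

(** * Hensel's lemma over power series *)

Section Hensel.
Variable F : fieldType.
Local Notation ps := (ps F).

(** The coefficient of t^n, as a polynomial in the main variable: a polynomial over series is read
    as a series of polynomials. *)
Definition slice n (P : {poly ps}) : {poly F} := \poly_(i < size P) psc P`_i n.

Lemma coef_slice n P i : (slice n P)`_i = psc P`_i n.
Proof. by rewrite coef_poly; case: ltnP => // le; rewrite nth_default. Qed.

Lemma slice_inj P Q : (forall n, slice n P = slice n Q) -> P = Q.
Proof. by move=> h; apply/polyP => i; apply: psP => n; rewrite -!coef_slice h. Qed.

Lemma sliceM n P Q : slice n (P * Q) = \sum_(k < n.+1) slice k P * slice (n - k) Q.
Proof.
apply/polyP => i; rewrite coef_slice coefM psc_sum coef_sum.
under [RHS]eq_bigr do rewrite coefM.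
rewrite [RHS]exchange_big; apply: eq_bigr => j _; rewrite pscM.
by apply: eq_bigr => k _; rewrite !coef_slice.
Qed.

Lemma slice0E P : slice 0 P = map_poly (@psc0m F) P.
Proof. by apply/polyP => i; rewrite [LHS]coef_slice (coef_map (@psc0m F)). Qed.

Lemma slice_monic n (P : {poly ps}) r : P \is monic -> size P = r.+1 -> (0 < n)%N ->
  (size (slice n P) <= r)%N.
Proof.
move=> mP sP n0; apply/leq_sizeP => j le_rj; rewrite coef_slice.
case: (ltngtP r j) => [lt|gt|<-].
- by rewrite nth_default // sP.
- by move: le_rj; rewrite leqNgt gt.
- have /monicP := mP; rewrite lead_coefE sP /= => ->.
  by rewrite psc1; case: n n0.
Qed.

(** Course-of-values recursion: each slice of a Hensel factor depends on all the earlier ones. *)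
Lemma dep_rec T (step : seq T -> T) : exists a : nat -> T,
  forall n, a n = step [seq a i | i <- iota 0 n].
Proof.
pose fix b n := if n is m.+1 then rcons (b m) (step (b m)) else [::].
have sb n : size (b n) = n by elim: n => //= n IH; rewrite size_rcons IH.
pose a n := step (b n).
have bE n : b n = [seq a i | i <- iota 0 n].
  elim: n => // n IH.
  by rewrite -[in RHS]addn1 iotaD map_cat add0n -IH -[RHS]/(b n ++ [:: a n]) cats1.
by exists a => n; rewrite -bE.
Qed.

(** The factors are found slice by slice. The n-th equation reads c_n = a_n B + A b_n, with c_n
    known from earlier slices; Bezout solves it, and reducing a_n modulo A keeps its degree below
    that of A. The bound on b_n then follows from that on c_n, since slices of positive index of a
    monic polynomial have smaller degree. *)
Lemma hensel (Q : {poly ps}) (A B : {poly F}) : Q \is monic ->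
  A \is monic -> B \is monic -> coprimep A B -> map_poly (@psc0m F) Q = A * B ->
  exists Q1 Q2, [/\ Q1 \is monic, Q2 \is monic, Q = Q1 * Q2, size Q1 = size A
                 & size Q2 = size B].
Proof.
move=> mQ mA mB /Bezout_eq1_coprimepP[[U V] /= UV] QAB.
have nA := monic_neq0 mA; have nB := monic_neq0 mB.
have sA : size A = (size A).-1.+1 by rewrite prednK // lt0n size_poly_eq0.
have sB : size B = (size B).-1.+1 by rewrite prednK // lt0n size_poly_eq0.
set dA := (size A).-1 in sA; set dB := (size B).-1 in sB.
have sQ : size Q = (dA + dB).+1.
  have <- : size (map_poly (@psc0m F) Q) = size Q.
    by apply: size_map_poly_id0; rewrite (monicP mQ) rmorph1 oner_neq0.
  by rewrite QAB size_Mmonic // sA sB; lia.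
pose step (s : seq ({poly F} * {poly F})) :=
  let n := size s in
  if n is 0 then (A, B) else
  let c := slice n Q - \sum_(1 <= k < n) (nth (0, 0) s k).1 * (nth (0, 0) s (n - k)%N).2 in
  let a := (c * V) %% A in (a, (c - a * B) %/ A).
have [ab abE] := dep_rec step.
have nab n k : (k < n)%N -> nth (0, 0) [seq ab i | i <- iota 0 n] k = ab k.
  by move=> lt; rewrite (nth_map 0%N) ?size_iota // nth_iota.
pose a n := (ab n).1; pose b n := (ab n).2.
have ab0 : ab 0%N = (A, B) by rewrite abE.
pose c n : {poly F} := slice n Q - \sum_(1 <= k < n) a k * b (n - k)%N.
have abS n : (0 < n)%N ->
    a n = (c n * V) %% A /\ b n = (c n - a n * B) %/ A.
  move=> n0; rewrite /a /b abE /step size_map size_iota; case: n n0 => // n _ /=.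
  suff -> : \sum_(1 <= k < n.+1) (nth (0, 0) [seq ab i | i <- iota 0 n.+1] k).1 *
     (nth (0, 0) [seq ab i | i <- iota 0 n.+1] (n.+1 - k)).2 =
     \sum_(1 <= k < n.+1) a k * b (n.+1 - k)%N by [].
  by apply: eq_big_nat => k /andP[k0 kn]; rewrite !nab //; lia.
have sa n : (0 < n)%N -> (size (a n) <= dA)%N.
  by move=> n0; rewrite (abS n n0).1 -ltnS -sA ltn_modpN0.
have main n : (0 < n)%N -> c n = a n * B + A * b n /\ ((size (b n) <= dB)%N).
  elim/ltn_ind: n => n IH n0.
  have sc : (size (c n) <= dA + dB)%N.
    rewrite /c; apply: leq_trans (size_polyD _ _) _; rewrite size_polyN geq_max.
    rewrite (slice_monic mQ sQ n0) /= big_seq.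
    apply: leq_trans (size_sum _ _ _) _; apply/bigmax_leqP_seq => k; rewrite mem_index_iota => /andP[k0 kn] _.
    apply: leq_trans (size_polyMleq _ _) _.
    have lt1 : (n - k < n)%N by lia.
    have lt2 : (0 < n - k)%N by lia.
    by have := sa _ k0; have [_] := IH _ lt1 lt2; rewrite -/(a k) -/(b _); lia.
  have [an bn] := abS n n0.
  have saB : (size (c n - a n * B)%R <= dA + dB)%N.
    apply: leq_trans (size_polyD _ _) _; rewrite size_polyN geq_max sc /=.
    by apply: leq_trans (size_polyMleq _ _) _; have := sa _ n0; rewrite sB; lia.
  have dvdA : A %| c n - a n * B.
    have -> : c n - a n * B = A * (c n * U + (c n * V) %/ A * B).
      have := divp_eq (c n * V) A; rewrite -an => h.
      have {1}-> : c n = c n * (U * A + V * B) by rewrite UV mulr1.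
      have -> : c n * (U * A + V * B) = c n * U * A + c n * V * B by ring.
      by rewrite [in LHS]h; ring.
    exact: dvdp_mulr.
  split.
    by rewrite bn [A * _]mulrC divpK // addrC subrK.
  by rewrite bn size_divp // leq_subLR.
have sliceE (sz : nat) (p : nat -> {poly F}) : (forall n, (size (p n) <= sz)%N) ->
    forall n, slice n (\poly_(i < sz) Ps (fun n => (p n)`_i)) = p n.
  move=> hs n; apply/polyP => i; rewrite coef_slice coef_poly.
  by case: ltnP => //= le; rewrite nth_default // (leq_trans (hs n)).
have mon (p : nat -> {poly F}) d : size (p 0%N) = d.+1 -> p 0%N \is monic ->
    (forall n, (0 < n)%N -> (size (p n) <= d)%N) ->
    let P := \poly_(i < d.+1) Ps (fun n => (p n)`_i) in P \is monic /\ size P = d.+1.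
  move=> s0 m0 sn P.
  have Pd : P`_d = 1.
    rewrite coef_poly ltnSn; apply: psP => -[|n] /=.
      by have /monicP := m0; rewrite lead_coefE s0.
    by rewrite nth_default // sn.
  have sP : size P = d.+1.
    apply/eqP; rewrite eqn_leq size_poly /= ltnNge; apply/negP => le.
    by move: Pd; rewrite nth_default // => /esym/eqP; rewrite oner_eq0.
  by split=> //; apply/monicP; rewrite lead_coefE sP.
have a0 : a 0%N = A by rewrite /a ab0.
have b0 : b 0%N = B by rewrite /b ab0.
have [sa0 sb0] : size (a 0%N) = dA.+1 /\ size (b 0%N) = dB.+1 by rewrite a0 b0.
have [ma0 mb0] : a 0%N \is monic /\ b 0%N \is monic by rewrite a0 b0.
have [mQ1 sQ1] := mon a dA sa0 ma0 sa.
have [mQ2 sQ2] := mon b dB sb0 mb0 (fun n n0 => (main n n0).2).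
exists (\poly_(i < dA.+1) Ps (fun n => (a n)`_i)), (\poly_(i < dB.+1) Ps (fun n => (b n)`_i)).
split=> //; rewrite ?sA ?sB //.
have slA := sliceE dA.+1 a; have slB := sliceE dB.+1 b.
have {}slA : forall n, slice n (\poly_(i < dA.+1) Ps (fun n => (a n)`_i)) = a n.
  by apply: slA => -[|m]; rewrite ?a0 ?sA // ltnW // ltnS sa.
have {}slB : forall n, slice n (\poly_(i < dB.+1) Ps (fun n => (b n)`_i)) = b n.
  by apply: slB => -[|m]; rewrite ?b0 ?sB // ltnW // ltnS (main m.+1 _).2.
apply: slice_inj => n; rewrite sliceM.
under eq_bigr do rewrite slA slB.
case: n => [|n]; first by rewrite big_ord1 a0 b0 slice0E.
rewrite big_ord_recl big_ord_recr /= subn0 subnn a0 b0.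
have := (main n.+1 isT).1; rewrite /c big_add1 /= big_mkord => /(canRL (subrK _)) ->.
by rewrite /bump /=; under [X in _ + (X + _)]eq_bigr do rewrite add1n; ring.
Qed.
End Hensel.

(** * Puiseux's theorem *)

Section Puiseux.
Variable F : closedFieldType.
Hypothesis char0 : forall n, n.+1%:R != 0 :> F.
Local Notation ps := (ps F).

Section Subst.
Variable N : nat.
Definition ps_subst (f : ps) : ps :=
  Ps (fun n => if (N.+1 %| n)%N then psc f (n %/ N.+1) else 0).

Lemma ps_substE n (p : {poly F}) f : ps_agree n p f ->
  ps_agree n (p \Po 'X^(N.+1)) (ps_subst f).
Proof.
move=> hp i le_in; rewrite coef_comp_poly_Xn //=; case: ifP => // dv.
by rewrite hp // (leq_trans (leq_div _ _)).
Qed.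

Lemma ps_subst_is_zmod : zmod_morphism ps_subst.
Proof. by move=> f g; apply: psP => n /=; case: ifP; rewrite ?subr0. Qed.
Lemma ps_subst_is_monoid : monoid_morphism ps_subst.
Proof.
split=> [|f g]; apply: psP => n.
  rewrite -[LHS](ps_substE (@ps_oneE F n) (leqnn n)).
  by rewrite -[1]/(polyC 1) comp_polyC coefC psc1; case: eqP.
have tr := @ps_trunc_agree F.
rewrite -[LHS](ps_substE (ps_mulE (tr n f) (tr n g)) (leqnn n)) comp_polyM.
by rewrite (pscME (ps_substE (tr n f)) (ps_substE (tr n g))).
Qed.
HB.instance Definition _ := GRing.isZmodMorphism.Build ps ps ps_subst ps_subst_is_zmod.
HB.instance Definition _ := GRing.isMonoidMorphism.Build ps ps ps_subst ps_subst_is_monoid.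

Lemma ps_substM f g : ps_subst (f * g) = ps_subst f * ps_subst g.
Proof. exact: rmorphM. Qed.
Lemma ps_substX f n : ps_subst (f ^+ n) = ps_subst f ^+ n.
Proof. exact: rmorphXn. Qed.

Lemma ps_subst_poly p : ps_subst (ps_poly p) = ps_poly (p \Po 'X^(N.+1)).
Proof.
by apply: psP => n; rewrite -(ps_substE (@ps_poly_agree F n p) (leqnn n)).
Qed.


Lemma has_ord_subst f o : has_ord f o -> has_ord (ps_subst f) (N.+1 * o).
Proof.
move=> [h1 h2]; split=> [i lt|] /=; last by rewrite dvdn_mulr // mulKn.
case: ifP => // /dvdnP[j jE]; rewrite jE mulnK // h1 //.
by move: lt; rewrite jE mulnC ltn_mul2l.
Qed.
End Subst.

Lemma ps_subst_comp N M f : ps_subst N (ps_subst M f) = ps_subst (N.+1 * M.+1).-1 f.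
Proof.
have [K KE] : exists K, (N.+1 * M.+1)%N = K.+1 by exists (N.+1 * M.+1).-1.
rewrite KE [K.+1.-1]/=; apply: psP => n /=; rewrite -KE.
case: ifP => [/dvdnP[j ->]|dv].
  rewrite mulnK // [(N.+1 * _)%N]mulnC dvdn_pmul2r //; case: ifP => // _.
  by rewrite divnMr.
by case: ifP => // h; rewrite (dvdn_trans _ h) ?dvdn_mulr // in dv.
Qed.

Definition splits (Q : {poly ps}) :=
  exists N (us : seq ps), map_poly (ps_subst N) Q = \prod_(u <- us) ('X - u%:P).

Lemma map_prodXsubC N (us : seq ps) :
  map_poly (ps_subst N) (\prod_(u <- us) ('X - u%:P)) =
  \prod_(u <- map (ps_subst N) us) ('X - u%:P).
Proof.
rewrite rmorph_prod big_map; apply: eq_bigr => u _.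
by rewrite rmorphB /= map_polyX map_polyC.
Qed.

Lemma map_ps_subst_comp N M (Q : {poly ps}) :
  map_poly (ps_subst N) (map_poly (ps_subst M) Q) = map_poly (ps_subst (N.+1 * M.+1).-1) Q.
Proof.
by apply/polyP => i; rewrite !(coef_map (ps_subst _)) /= ps_subst_comp.
Qed.

Lemma splitsM Q1 Q2 : splits Q1 -> splits Q2 -> splits (Q1 * Q2).
Proof.
move=> [N1 [us1 h1]] [N2 [us2 h2]].
exists (N2.+1 * N1.+1).-1, (map (ps_subst N2) us1 ++ map (ps_subst N1) us2).
have := map_ps_subst_comp N1 N2 Q2; rewrite [(N1.+1 * _)%N]mulnC => E2.
have E1 := map_ps_subst_comp N2 N1 Q1.
transitivity (map_poly (ps_subst N2) (map_poly (ps_subst N1) Q1) *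
              map_poly (ps_subst N1) (map_poly (ps_subst N2) Q2)).
  by rewrite E1 E2 -rmorphM.
by rewrite h1 h2 !map_prodXsubC big_cat.
Qed.

Lemma splits_subst N Q : splits (map_poly (ps_subst N) Q) -> splits Q.
Proof.
move=> [M [us h]]; exists (M.+1 * N.+1).-1, us.
by rewrite -map_ps_subst_comp.
Qed.

Lemma coef_prodXsubC_scale (s : ps) us i : (i <= size us)%N ->
  (\prod_(u <- map (fun u => s * u) us) ('X - u%:P))`_i =
  s ^+ (size us - i) * (\prod_(u <- us) ('X - u%:P))`_i.
Proof.
elim: us i => [|u us IH] i /=; first by rewrite !big_nil sub0n expr0 mul1r.
move=> le; rewrite !big_cons !mulrBl !coefB !coefXM !coefCM.
case: i le => [|i] le /=.
  by rewrite IH // !sub0r !subn0 exprS; ring.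
rewrite subSS IH // mulrBr; congr (_ - _).
case: (ltngtP i.+1 (size us).+1) le => // [lt _|[eq] _].
  by rewrite IH // -(@subnSK i (size us) lt) exprS; ring.
have sz (vs : seq ps) : (\prod_(u <- vs) ('X - u%:P))`_(size vs).+1 = 0.
  by rewrite nth_default // size_prod_XsubC.
by rewrite eq sz -(size_map (fun u => s * u)) sz !mulr0.
Qed.

(** The hypothesis says P(X) = s^r G(X/s), written on coefficients because s need not be invertible;
    the roots of P are s times those of G. *)
Lemma splits_scale (P G : {poly ps}) s r : size P = r.+1 -> size G = r.+1 ->
  G \is monic ->
  (forall i, (i <= r)%N -> P`_i = s ^+ (r - i) * G`_i) -> splits G -> splits P.
Proof.
move=> sP sG mG PG [N [us h]]; exists N, (map (fun u => ps_subst N s * u) us).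
have sus : size us = r.
  have : size (map_poly (ps_subst N) G) = r.+1.
    by rewrite -sG; apply: size_map_poly_id0; rewrite (monicP mG) rmorph1 oner_neq0.
  by rewrite h size_prod_XsubC => -[].
apply/polyP => i; rewrite (coef_map (ps_subst N)).
have [le|lt] := leqP i r; last first.
  rewrite !nth_default ?size_prod_XsubC ?size_map ?sus ?sP //.
  exact: (rmorph0 (ps_subst N)).
rewrite coef_prodXsubC_scale ?sus // -h (coef_map (ps_subst N)) PG //.
by rewrite /= ps_substM ps_substX.
Qed.

Lemma size_exp_XaddC (R : nzRingType) (c : R) n : size (('X + c%:P) ^+ n) = n.+1.
Proof. by have := size_exp_XsubC n (- c); rewrite polyCN opprK. Qed.

Lemma coef_XaddC_pred (R : comNzRingType) (c : R) n :
  (('X + c%:P) ^+ n.+1)`_n = c *+ n.+1.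
Proof.
elim: n => [|n IH]; first by rewrite expr1 coefD coefX coefC add0r.
rewrite exprSr mulrDr coefD coefMX coefMC /= IH.
have : ('X + c%:P) ^+ n.+1 \is monic by rewrite rpredX ?monicXaddC.
move/monicP; rewrite lead_coefE size_exp_XaddC.
by move=> ->; rewrite mul1r -mulrSr.
Qed.

Lemma comp_XaddC (Q : {poly ps}) r c : Q \is monic -> size Q = r.+2 ->
  let P := Q \Po ('X + c%:P) in
  [/\ P \is monic, size P = r.+2 & P`_r = Q`_r + c *+ r.+1].
Proof.
move=> mQ sQ P.
have big (i k : nat) : (i < k)%N -> (('X + c%:P) ^+ i)`_k = 0.
  by move=> lt; rewrite nth_default // -[c]opprK polyCN size_exp_XsubC.
have top i : (('X + c%:P) ^+ i)`_i = 1.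
  have /monicP : ('X + c%:P) ^+ i \is monic by rewrite rpredX ?monicXaddC.
  by rewrite lead_coefE size_exp_XaddC.
have Qt : Q`_r.+1 = 1 by have /monicP := mQ; rewrite lead_coefE sQ.
have Pk k : (r < k)%N -> P`_k = (('X + c%:P) ^+ r.+1)`_k.
  move=> lt; rewrite coef_comp_poly sQ big_ord_recr /= Qt mul1r big1 ?add0r // => i _.
  by rewrite big ?mulr0 // (leq_trans (ltn_ord i)).
have Pt : P`_r.+1 = 1 by rewrite Pk // top.
have sP : size P = r.+2.
  apply/eqP; rewrite eqn_leq; apply/andP; split.
    by apply/leq_sizeP => j lt; rewrite Pk ?big // ltnW.
  rewrite ltnNge; apply/negP => le.
  by move: Pt; rewrite nth_default // => /esym/eqP; rewrite oner_eq0.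
split=> //; first by apply/monicP; rewrite lead_coefE sP.
rewrite coef_comp_poly sQ !big_ord_recr /= Qt mul1r big1 => [|i _]; last first.
  by rewrite big ?mulr0.
by rewrite add0r top mulr1 coef_XaddC_pred.
Qed.

Lemma splits_comp (Q : {poly ps}) c : splits (Q \Po ('X + c%:P)) -> splits Q.
Proof.
move=> [N [us h]]; exists N, (map (fun u => u + ps_subst N c) us).
have -> : Q = (Q \Po ('X + c%:P)) \Po ('X - c%:P).
  rewrite -comp_polyA comp_polyD comp_polyX comp_polyC subrK.
  by rewrite comp_polyXr.
rewrite map_comp_poly h rmorphB /= map_polyX map_polyC /= rmorph_prod big_map.
apply: eq_bigr => u _; rewrite rmorphB /= comp_polyX comp_polyC polyCD /=; ring.
Qed.

(** Newton's algorithm, by induction on the degree: translate to kill the subleading coefficient,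
    ramify and rescale along the smallest slope of the Newton polygon. The residual polynomial then
    has at least two distinct roots, and Hensel's lemma splits off one of them with its
    multiplicity. *)
Theorem puiseux (Q : {poly ps}) : Q \is monic -> splits Q.
Proof.
have [m] := ubnP (size Q); elim: m Q => // m IHm Q le_m mQ.
have [r sQ] : exists r, size Q = r.+1.
  by exists (size Q).-1; rewrite prednK // lt0n size_poly_eq0 monic_neq0.
case: r sQ => [|r] sQ.
  exists 0%N, [::]; rewrite big_nil.
  have /eqP/size_poly1P[c _ Qc] := sQ; have /monicP := mQ.
  by rewrite Qc lead_coefC => ->; rewrite rmorph1.
(* Tschirnhaus translation; the division by r+1 is the use of characteristic 0. *)
pose c := - (psC (r.+1%:R^-1) * Q`_r).
apply: (@splits_comp _ c); have [mP sP] := comp_XaddC c mQ sQ.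
set P := Q \Po _ in mP sP *; have -> : Q`_r + c *+ r.+1 = 0.
  rewrite /c mulNrn -(mulr_natl (_ * _)) mulrA.
  have -> : r.+1%:R * psC (r.+1%:R^-1) = 1 :> ps.
    by rewrite -(rmorph_nat (@psC F)) -rmorphM divff // rmorph1.
  by rewrite mul1r subrr.
move=> Pr0; clearbody P; clear c; move: le_m; rewrite sQ -sP; clear sQ mQ Q => le_m.
have Pt : P`_r.+1 = 1 by have /monicP := mP; rewrite lead_coefE sP.
have [P0|] := pselect (forall i, (i <= r)%N -> P`_i = 0).
  exists 0%N, (nseq r.+1 0); rewrite big_nseq iter_mulr_1 subr0.
  have -> : P = 'X^(r.+1).
    apply/polyP => i; rewrite coefXn; case: (ltngtP i r.+1) => [lt|gt|->] //.
      by rewrite P0.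
    by rewrite nth_default ?sP.
  by rewrite map_polyXn.
move=> /existsNP[i1 /not_implyP[le_i1 /eqP Pi1]].
have [o ordP] : exists o : nat -> nat, forall i, P`_i != 0 -> has_ord P`_i (o i).
  have [|o ho] := @choice nat nat (fun i k => P`_i != 0 -> has_ord P`_i k); last by exists o.
  move=> i; have [->|/has_ord_exists[k hk]] := eqVneq P`_i 0; first by exists 0%N.
  by exists k.
(* Every r+1-i with i <= r divides (r+1)!, so after ramification of this index all slopes
   ord(P_i)/(r+1-i) become integers. *)
pose K := (r.+1)`!; pose N := K.-1.
have NK : N.+1 = K by rewrite prednK // fact_gt0.
pose slope i := (o i * (K %/ (r.+1 - i)))%N.
have slopeE i : (i <= r)%N -> (slope i * (r.+1 - i) = N.+1 * o i)%N.
  move=> le; rewrite NK -mulnA divnK 1?mulnC //.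
  by apply: dvdn_fact; rewrite subn_gt0 ltnS le leq_subr.
have exl : exists v, [exists i : 'I_r.+1, (P`_i != 0) && (slope i == v)].
  by exists (slope i1); apply/existsP; exists (inord i1); rewrite inordK ?ltnS // Pi1 eqxx.
have [l /existsP[i0 /andP[Pi0 /eqP li0]] lmin] := ex_minnP exl.
have {}lmin i : (i <= r)%N -> P`_i != 0 -> (l <= slope i)%N.
  move=> le Pi; apply: lmin; apply/existsP; exists (inord i).
  by rewrite inordK ?ltnS // Pi eqxx.
apply: (@splits_subst N); set P' := map_poly _ P.
have P'E i : P'`_i = ps_subst N P`_i by rewrite (coef_map (ps_subst N)).
have ordP' i : P`_i != 0 -> has_ord P'`_i (N.+1 * o i).
  by move=> h; rewrite P'E; apply/has_ord_subst/ordP.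
(* G(X) = P'(t^l X) / t^(l(r+1)). Minimality of the slope l makes it integral, and the coefficient
   of index i0, where l is attained, has nonzero constant term. *)
pose G := \poly_(i < r.+2) ps_shift (l * (r.+1 - i)) P'`_i.
have GE i : (i <= r.+1)%N -> G`_i = ps_shift (l * (r.+1 - i)) P'`_i.
  by move=> le; rewrite [LHS]coef_poly ltnS le.
have sP' : size P' = r.+2.
  by rewrite -sP; apply: size_map_poly_id0; rewrite (monicP mP) rmorph1 oner_neq0.
have P'G i : (i <= r.+1)%N -> P'`_i = (ps_t F ^+ l) ^+ (r.+1 - i) * G`_i.
  move=> le; rewrite GE // -exprM; apply: ps_shiftK => j lt.
  have [Pi|/[dup] Pi /ordP'[h _]] := eqVneq P`_i 0.
    by rewrite P'E Pi (rmorph0 (ps_subst N)).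
  apply: h; have [i_r|lt_i] : i = r.+1 \/ (i <= r)%N by lia.
    by move: lt; rewrite i_r subnn muln0.
  by rewrite -slopeE // (leq_trans lt) // leq_mul2r lmin // orbT.
have Gt : G`_r.+1 = 1.
  by have := P'G _ (leqnn r.+1); rewrite subnn expr0 mul1r P'E Pt (rmorph1 (ps_subst N)).
have sG : size G = r.+2.
  apply/eqP; rewrite eqn_leq size_poly /= ltnNge; apply/negP => le.
  by move: Gt; rewrite nth_default // => /esym/eqP; rewrite oner_eq0.
have mG : G \is monic by apply/monicP; rewrite lead_coefE sG.
apply: (splits_scale sP' sG mG P'G).
have Gr : G`_r = 0.
  rewrite GE // P'E Pr0 (rmorph0 (ps_subst N)).
  by apply: psP => n.
have le_i0 : (i0 <= r)%N by rewrite -ltnS.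
have Gi0 : psc G`_i0 0 != 0.
  rewrite GE ?leqW //= add0n -li0 slopeE //.
  by have [] := ordP' _ Pi0.
pose g := map_poly (@psc0m F) G.
have gE i : g`_i = psc G`_i 0 by rewrite (coef_map (@psc0m F)).
have mg : g \is monic by apply: monic_map.
have sg : size g = r.+2.
  by rewrite -sG; apply: size_map_poly_id0; rewrite (monicP mG) rmorph1 oner_neq0.
have /closed_rootP[al root_al] : size g != 1%N by rewrite sg.
have [k [q /implyP]] := multiplicity_XsubC g al.
rewrite monic_neq0 // => /(_ isT) nroot gq.
have mA : ('X - al%:P) ^+ k \is monic by rewrite rpredX ?monicXsubC.
have mq : q \is monic by rewrite -(monicMr _ mA) -gq.
have k0 : (0 < k)%N.
  by rewrite lt0n; apply: contraNneq nroot => k0; move: root_al; rewrite gq k0 mulr1.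
have sgq : (size q + k = r.+2)%N.
  by rewrite -sg gq size_Mmonic ?monic_neq0 // size_exp_XsubC addnS.
(* If al were the only root, g would be (X - al)^(r+1). Its coefficient of degree r vanishes by the
   translation, so al = 0, against the nonzero coefficient of index i0 <= r. *)
have sq2 : (1 < size q)%N.
  rewrite ltnNge; apply/negP => le1.
  have q1 : q = 1.
    have := size1_polyC le1 => qc; move: mq => /monicP.
    by rewrite qc lead_coefC => ->.
  have kE : k = r.+1 by move: sgq; rewrite q1 size_poly1 => -[].
  have := gE r; rewrite Gr gq q1 mul1r kE -[_ - _]/('X + (- al%:P)) -polyCN coef_XaddC_pred.
  move/eqP; rewrite -mulr_natr mulf_eq0 (negPf (char0 _)) orbF oppr_eq0 => /eqP al0.
  move: Gi0; rewrite -gE gq q1 mul1r kE al0 subr0 coefXn.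
  by rewrite ltn_eqF ?eqxx // ltnS.
have gAB : map_poly (@psc0m F) G = ('X - al%:P) ^+ k * q by rewrite mulrC -gq.
have cop : coprimep (('X - al%:P) ^+ k) q.
  by rewrite coprimep_expl // coprimep_sym coprimep_XsubC.
have [Q1 [Q2 [mQ1 mQ2 -> sQ1 sQ2]]] := hensel mG mA mq cop gAB.
apply: splitsM; apply: IHm => //.
  by rewrite sQ1 size_exp_XsubC; clear - sgq sq2 le_m sP; lia.
rewrite sQ2; move: le_m; rewrite sP -sgq ltnS; apply: leq_trans.
by rewrite -[X in (X < _)%N]addn0 ltn_add2l.
Qed.

End Puiseux.

(** * Colength of ideals in the local ring of the plane *)

Section Codim.
Variables (F : fieldType) (R : comNzRingType) (k : {rmorphism F -> R}).
Implicit Types (P Q : R -> Prop) (h : nat -> R) (c : nat -> F) (n : nat).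

Definition comb n c h : R := \sum_(i < n) k (c i) * h i.

Definition submod P := [/\ P 0, forall x y, P x -> P y -> P (x + y)
  & forall a x, P x -> P (k a * x)].
Definition indep P n h := forall c, P (comb n c h) -> forall i, (i < n)%N -> c i = 0.
Definition spans P n h := forall x, exists c, P (x - comb n c h).
(** The dimension of R/P over F, through a basis modulo P. Families are indexed by all natural
    numbers and only their first n terms count, so lengths change without casts. *)
Definition codim P n := exists h, indep P n h /\ spans P n h.

Lemma submodN P x : submod P -> P x -> P (- x).
Proof. by case=> _ _ hZ /(hZ (-1)); rewrite rmorphN1 mulN1r. Qed.
Lemma submodB P x y : submod P -> P x -> P y -> P (x - y).
Proof. by move=> sP hx hy; case: (sP) => _ hD _; apply: hD => //; apply: submodN. Qed.
Lemma submod_sum P (I : Type) (r : seq I) (f : I -> R) :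
  submod P -> (forall i, P (f i)) -> P (\sum_(i <- r) f i).
Proof. by case=> h0 hD _ hf; elim/big_rec: _ => // i x _; apply: hD. Qed.

(** Otherwise the matrix of h in terms of h' has more rows than columns, and a nonzero vector of its
    left kernel is a forbidden relation. *)
Lemma indep_le P n m h h' : submod P -> indep P n h -> spans P m h' -> (n <= m)%N.
Proof.
move=> sP ind sp; have [a ha] := choice (fun i => sp (h i)).
rewrite leqNgt; apply/negP => lt_mn.
pose A := \matrix_(i < n, j < m) a i j.
have : (0 < \rank (kermx A))%N.
  by rewrite mxrank_ker subn_gt0 (leq_ltn_trans (rank_leq_col _)).
rewrite lt0n mxrank_eq0 => /rowV0Pn[v /sub_kermxP vA v0].
pose c i := if insub i is Some j then v 0 j else 0.
have cE (i : 'I_n) : c i = v 0 i by rewrite /c valK.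
case/eqP: v0; apply/rowP => j; rewrite mxE -cE; apply: ind => //.
have z : \sum_(i < n) k (c i) * comb m (a i) h' = 0.
  under eq_bigr do rewrite /comb big_distrr /=.
  rewrite exchange_big /= big1 // => l _.
  have /rowP/(_ l) := vA; rewrite !mxE => vAl.
  under eq_bigr do rewrite mulrA -rmorphM.
  rewrite -big_distrl -rmorph_sum /=.
  have -> : \sum_(i < n) c i * a i l = 0; last by rewrite rmorph0 mul0r.
  by rewrite -[RHS]vAl; apply: eq_bigr => i _; rewrite mxE cE.
rewrite /comb -[X in P X]subr0 -[X in P (_ - X)]z -sumrB.
apply: submod_sum => // i; rewrite -mulrBr; case: sP => _ _; exact.
Qed.

Lemma codim_uniq P n m : submod P -> codim P n -> codim P m -> n = m.
Proof.
move=> sP [h [ih sh]] [h' [ih' sh']]; apply/eqP; rewrite eqn_leq.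
by rewrite (indep_le sP ih sh') (indep_le sP ih' sh).
Qed.

Lemma comb_rcons n c h x :
  comb n.+1 c (fun i => if i == n then x else h i) = comb n c h + k (c n) * x.
Proof.
rewrite /comb big_ord_recr /= eqxx; congr (_ + _); apply: eq_bigr => i _.
by rewrite ltn_eqF.
Qed.

Lemma combZ n a c h : comb n (fun i => a * c i) h = k a * comb n c h.
Proof. by rewrite /comb big_distrr /=; apply: eq_bigr => i _; rewrite rmorphM mulrA. Qed.

Lemma comb_solve P n c h x : submod P -> P (comb n c h + k (c n) * x) -> c n != 0 ->
  exists c', P (x - comb n c' h).
Proof.
move=> [_ _ hZ] Pc cn; exists (fun i => - (c n)^-1 * c i).
rewrite combZ rmorphN mulNr opprK addrC.
by rewrite -{1}[x]mul1r -(rmorph1 k) -(mulVf cn) rmorphM -mulrA -mulrDr; apply: hZ.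
Qed.

(** An independent family of maximal length spans: appending any element creates a relation that can
    be solved for it. *)
Lemma codim_exists P N : submod P -> (forall n h, indep P n h -> (n <= N)%N) ->
  exists2 n, (n <= N)%N & codim P n.
Proof.
move=> sP bnd.
have ex0 : exists n, `[< exists h, indep P n h >].
  by exists 0%N; apply/asboolP; exists (fun=> 0) => c _ i.
have bnd' n : `[< exists h, indep P n h >] -> (n <= N)%N.
  by move=> /asboolP[h /bnd].
have [n /asboolP[h ih] nmax] := ex_maxnP ex0 bnd'.
exists n; first exact: bnd ih.
exists h; split=> // x; apply: contrapT => nx.
suff : (n.+1 <= n)%N by rewrite ltnn.
apply: nmax; apply/asboolP; exists (fun i => if i == n then x else h i).
move=> c; rewrite comb_rcons => Pc.
have cn0 : c n = 0.
  apply: contrapT => /eqP cn; apply: nx.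
  exact: comb_solve sP Pc cn.
move: Pc; rewrite cn0 rmorph0 mul0r addr0 => Pc i.
by rewrite ltnS leq_eqVlt => /predU1P[->//|]; apply: ih.
Qed.


Lemma codim_le P Q n : submod P -> submod Q -> (forall x, P x -> Q x) -> codim P n ->
  exists2 m, (m <= n)%N & codim Q m.
Proof.
move=> sP sQ PQ [h [ih sh]]; apply: codim_exists => // m g ig.
by apply: (indep_le sP _ sh) => c /PQ; apply: ig.
Qed.

Section LinearMap.
Variable T : R -> R.
Hypotheses (TD : forall x y, T (x + y) = T x + T y)
  (TZ : forall a x, T (k a * x) = k a * T x).

Lemma lin_comb n c h : T (comb n c h) = comb n c (T \o h).
Proof.
have T0 : T 0 = 0 by apply: (@addrI _ (T 0)); rewrite -TD !addr0.
rewrite /comb; elim/big_rec2: _ => // i x y _ <-.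
by rewrite TD TZ.
Qed.

Lemma codim_preim P n : submod P -> codim P n ->
  exists2 m, (m <= n)%N & codim (P \o T) m.
Proof.
move=> sP [h [ih sh]]; apply: codim_exists => [|m g ig].
  have T0 : T 0 = 0 by apply: (@addrI _ (T 0)); rewrite -TD !addr0.
  case: sP => h0 hD hZ; split=> [|x y|a x] /=; rewrite ?T0 ?TD ?TZ //.
    exact: hD.
  exact: hZ.
apply: (indep_le sP (h := T \o g) _ sh) => c.
by rewrite -lin_comb; apply: ig.
Qed.

(** Additivity along 0 -> R/T^-1(P) -> R/P -> R/Q -> 0, where the first map is induced by T and has
    image Q/P. *)
Lemma codim_ext P Q n1 n2 : submod P -> submod Q -> (forall x, P x -> Q x) ->
  (forall x, Q (T x)) -> (forall x, Q x -> exists y, P (x - T y)) ->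
  codim Q n1 -> codim (P \o T) n2 -> codim P (n1 + n2).
Proof.
move=> sP sQ PQ QT spQ [a [ia sa]] [b [ib sb]].
pose h i := if (i < n1)%N then a i else T (b (i - n1)%N).
have combE c : comb (n1 + n2) c h =
    comb n1 c a + T (comb n2 (fun i => c (n1 + i)%N) b).
  rewrite lin_comb /comb big_split_ord /=; congr (_ + _); apply: eq_bigr => i _.
    by rewrite /h ltn_ord.
  by rewrite /h ltnNge leq_addr /= addKn.
exists h; split=> [c|x].
  rewrite combE => Pc.
  have c1 : forall i, (i < n1)%N -> c i = 0.
    apply: ia; rewrite -[comb _ _ _](addrK (T (comb n2 (fun i => c (n1 + i)%N) b))).
    by apply: submodB => //; apply: PQ.
  have c2 : forall i, (i < n2)%N -> c (n1 + i)%N = 0.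
    apply: (ib (fun i => c (n1 + i)%N)) => /=; move: Pc.
    rewrite [comb n1 _ _]big1 ?add0r // => i _.
    by rewrite c1 // rmorph0 mul0r.
  move=> i lt; case: (ltnP i n1) => [/c1//|le].
  by rewrite -(subnKC le) c2 // ltn_subLR.
have [c1 /spQ[y Py]] := sa x; have [c2 /= Pc2] := sb y.
exists (fun i => if (i < n1)%N then c1 i else c2 (i - n1)%N).
rewrite combE.
have -> : comb n1 (fun i => if (i < n1)%N then c1 i else c2 (i - n1)%N) a = comb n1 c1 a.
  by apply: eq_bigr => i _; rewrite ltn_ord.
have -> : comb n2 (fun i => if (n1 + i < n1)%N then c1 (n1 + i)%N else c2 (n1 + i - n1)%N) b = comb n2 c2 b.
  by apply: eq_bigr => i _; rewrite ltnNge leq_addr /= addKn.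
have TB : T (y - comb n2 c2 b) = T y - T (comb n2 c2 b).
  by rewrite TD -[- comb _ _ _]mulN1r -(rmorphN1 k) TZ rmorphN1 mulN1r.
have -> : x - (comb n1 c1 a + T (comb n2 c2 b)) =
  (x - comb n1 c1 a - T y) + T (y - comb n2 c2 b) by rewrite TB; ring.
by case: (sP) => _ hD _; apply: hD.
Qed.
End LinearMap.

Lemma codim_setT : codim (fun _ => True) 0.
Proof. by exists (fun=> 0); split=> // x; exists (fun=> 0). Qed.

Lemma codim_eq P Q n : (forall x, P x <-> Q x) -> codim P n -> codim Q n.
Proof. by move=> h; have -> : P = Q by apply/funext => x; apply/propext. Qed.

Lemma codim_iso (T T' : R -> R) P n :
  (forall x y, T (x + y) = T x + T y) -> (forall a x, T (k a * x) = k a * T x) ->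
  (forall x, T (T' x) = x) -> submod P -> codim (P \o T) n -> codim P n.
Proof.
move=> TD TZ TK sP cn; rewrite -[n]add0n.
apply: (codim_ext TD TZ sP (Q := fun=> True)) => //.
- by move=> x _; exists (T' x); rewrite TK subrr; case: sP.
- exact: codim_setT.
Qed.

Section LocalIdeals.
Variable ev : {rmorphism R -> F}.
Hypothesis evk : forall a, ev (k a) = a.

Definition idl (gs : seq R) (x : R) :=
  exists c : nat -> R, x = \sum_(i < size gs) c i * gs`_i.
(* The contraction to R of the ideal generated by gs in the local ring at the kernel of ev. *)
Definition locI gs x := exists2 u, ev u != 0 & idl gs (u * x).

Lemma idl0 gs : idl gs 0.
Proof. by exists (fun=> 0); rewrite big1 // => i _; rewrite mul0r. Qed.
Lemma idlD gs x y : idl gs x -> idl gs y -> idl gs (x + y).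
Proof.
move=> [c ->] [d ->]; exists (fun i => c i + d i); rewrite -big_split /=.
by apply: eq_bigr => i _; rewrite mulrDl.
Qed.
Lemma idlM gs a x : idl gs x -> idl gs (a * x).
Proof.
move=> [c ->]; exists (fun i => a * c i); rewrite big_distrr /=.
by apply: eq_bigr => i _; rewrite mulrA.
Qed.

Lemma loc_idl gs x : idl gs x -> locI gs x.
Proof. by move=> h; exists 1; rewrite ?rmorph1 ?oner_neq0 // mul1r. Qed.
Lemma loc0 gs : locI gs 0. Proof. exact/loc_idl/idl0. Qed.
Lemma locD gs x y : locI gs x -> locI gs y -> locI gs (x + y).
Proof.
move=> [u u0 ux] [v v0 vy]; exists (u * v); first by rewrite rmorphM mulf_neq0.
rewrite mulrDr; apply: idlD; last by rewrite -mulrA; apply: idlM.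
by rewrite [u * v]mulrC -mulrA; apply: idlM.
Qed.
Lemma locM gs a x : locI gs x -> locI gs (a * x).
Proof. by move=> [u u0 ux]; exists u => //; rewrite mulrCA; apply: idlM. Qed.
Lemma locMl gs a x : locI gs x -> locI gs (x * a).
Proof. by rewrite mulrC; apply: locM. Qed.
Lemma locN gs x : locI gs x -> locI gs (- x).
Proof. by rewrite -mulN1r; apply: locM. Qed.
Lemma locB gs x y : locI gs x -> locI gs y -> locI gs (x - y).
Proof. by move=> hx hy; apply: locD => //; apply: locN. Qed.
Lemma loc_submod gs : submod (locI gs).
Proof. split; [exact: loc0|exact: locD|move=> a x; exact: locM]. Qed.
Lemma loc_unit gs u x : ev u != 0 -> locI gs (u * x) -> locI gs x.
Proof.
by move=> u0 [v v0 h]; exists (v * u); rewrite ?rmorphM ?mulf_neq0 // -mulrA.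
Qed.
Lemma loc_sum gs (I : Type) (r : seq I) (f : I -> R) :
  (forall i, locI gs (f i)) -> locI gs (\sum_(i <- r) f i).
Proof. by move=> h; elim/big_rec: _ => [|i x _]; [apply: loc0|apply: locD]. Qed.
Lemma loc_gen gs i : locI gs gs`_i.
Proof.
have [lt|le] := ltnP i (size gs); last by rewrite nth_default //; apply: loc0.
apply: loc_idl; exists (fun j => (j == i)%:R).
rewrite (bigD1 (Ordinal lt)) //= eqxx mul1r big1 ?addr0 // => j.
by rewrite -val_eqE /= => /negPf ->; rewrite mul0r.
Qed.
Lemma loc_gen0 a gs : locI (a :: gs) a. Proof. exact: (loc_gen (a :: gs) 0). Qed.
Lemma loc_gen1 a b gs : locI (a :: b :: gs) b.
Proof. exact: (loc_gen (a :: b :: gs) 1). Qed.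
Lemma loc_gen2 a b e gs : locI (a :: b :: e :: gs) e.
Proof. exact: (loc_gen (a :: b :: e :: gs) 2). Qed.
Lemma loc_sub gs hs x : (forall i, (i < size gs)%N -> locI hs gs`_i) -> locI gs x -> locI hs x.
Proof.
move=> h [u u0 [c uE]]; apply: (loc_unit u0); rewrite uE.
by apply: loc_sum => i; apply/locM/h.
Qed.
Lemma loc_ext gs hs : (forall i, (i < size gs)%N -> locI hs gs`_i) ->
  (forall i, (i < size hs)%N -> locI gs hs`_i) -> forall x, locI gs x <-> locI hs x.
Proof. by move=> h1 h2 x; split; apply: loc_sub. Qed.

Lemma loc_cons e gs x : locI (e :: gs) x <-> exists2 u, ev u != 0 & exists c : R, idl gs (u * x - c * e).
Proof.
split=> [[u u0 [c uE]]|[u u0 [c [d uE]]]]; exists u => //.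
  exists (c 0%N), (fun i => c i.+1); rewrite uE big_ord_recl /= addrC addKr.
  by apply: eq_bigr.
exists (fun i => if i is j.+1 then d j else c).
by rewrite big_ord_recl /= -[LHS](subrK (c * e)) uE addrC.
Qed.

Lemma loc_consS e gs x : locI gs x -> locI (e :: gs) x.
Proof. by apply: loc_sub => i _; apply: (loc_gen (e :: gs) i.+1). Qed.

(** The last clause, cancellation of elements that are units at the point, says that P is contracted
    from the local ring. *)
Definition loc_ideal P := [/\ submod P, forall a x, P x -> P (a * x)
  & forall u x, ev u != 0 -> P (u * x) -> P x].

Lemma locI_ideal gs : loc_ideal (locI gs).
Proof. by split; [apply: loc_submod|move=> a x; apply: locM|move=> u x; apply: loc_unit]. Qed.

(** By counting, 1, e, ..., e^n satisfy a relation modulo P; once the lowest power that occurs is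
    factored out, the cofactor is a unit at the point. *)
Lemma codim_nil P n e : loc_ideal P -> codim P n -> ev e = 0 -> P (e ^+ n).
Proof.
move=> [sP PM PU] [h [ih sh]] e0; apply: contrapT => ne.
suff ie : indep P n.+1 (fun i => e ^+ i).
  by have := indep_le sP ie sh; rewrite ltnn.
move=> c Pc i; elim/ltn_ind: i => i IH le_in.
apply: contrapT => /eqP ci; apply: ne.
rewrite -(subnK (le_in : (i <= n)%N)) exprD; apply: PM.
pose u := \sum_(j < n.+1 | (i <= j)%N) k (c j) * e ^+ (j - i).
apply: (PU u).
  rewrite rmorph_sum (bigD1 (Ordinal le_in)) //= subnn expr0 mulr1 evk.
  rewrite big1 ?addr0 // => j /andP[le]; rewrite -val_eqE /= => ne.
  rewrite rmorphM rmorphXn e0 expr0n.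
  by case: eqP => [|_]; [move/eqP; rewrite subn_eq0 => h'; case/eqP: ne; apply/eqP; rewrite eqn_leq h' le|rewrite mulr0].
suff <- : comb n.+1 c (fun i => e ^+ i) = u * e ^+ i by [].
rewrite /comb (bigID (fun j : 'I_n.+1 => (i <= j)%N)) /= addrC big1 ?add0r => [|j]; last first.
  by rewrite -ltnNge => lt; rewrite IH ?rmorph0 ?mul0r // (ltn_trans lt).
by rewrite big_distrl /=; apply: eq_bigr => j le; rewrite -mulrA -exprD subnK.
Qed.

Definition fin gs := exists K, forall e, ev e = 0 -> locI gs (e ^+ K).


(** Geometric series in the nilpotent 1 - u/ev(u): modulo an ideal of this kind, units at the point
    are already invertible in R, so denominators can be cleared. *)
Lemma fin_inv gs u : fin gs -> ev u != 0 -> exists v, locI gs (u * v - 1).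
Proof.
move=> [K hK] u0; pose e := 1 - k (ev u)^-1 * u.
have /hK h : ev e = 0 by rewrite rmorphB rmorph1 rmorphM evk mulVf // subrr.
exists (k (ev u)^-1 * \sum_(i < K) e ^+ i).
have -> : u * (k (ev u)^-1 * \sum_(i < K) e ^+ i) - 1 = - e ^+ K; last exact: locN.
have := subrX1 e K; rewrite {1}/e => E.
have -> : e ^+ K = 1 + (e - 1) * \sum_(i < K) e ^+ i by rewrite -subrX1 addrC subrK.
rewrite /e; ring.
Qed.

Lemma colon_ideal gs e : loc_ideal (fun x => locI gs (e * x)).
Proof.
split=> [|a x|u x u0]; last 1 first.
- by rewrite mulrCA; apply: loc_unit.
- split=> [|x y hx hy|a x hx]; first by rewrite mulr0; apply: loc0.
    by rewrite mulrDr; apply: locD.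
  by rewrite mulrCA; apply: locM.
- by rewrite mulrCA; apply: locM.
Qed.

(** The exact sequence 0 -> R/(I:e) -> R/I -> R/(I,e) -> 0, where I is the contracted ideal of
    [gs]. *)
Lemma colon_codim gs e n1 n2 :
  codim (locI (e :: gs)) n1 -> codim (fun x => locI gs (e * x)) n2 ->
  codim (locI gs) (n1 + n2).
Proof.
move=> c1 c2.
(* Up to a unit t^n1 is a multiple of e modulo I, and e t^n2 lies in I, hence so does t^(n1+n2). *)
have fgs : fin gs.
  exists (n1 + n2)%N => t t0.
  have /loc_cons[u u0 [c [d uE]]] := codim_nil (locI_ideal (e :: gs)) c1 t0.
  have h2 := codim_nil (colon_ideal gs e) c2 t0.
  apply: (loc_unit u0).
  have -> : u * t ^+ (n1 + n2) = t ^+ n2 * (u * t ^+ n1 - c * e) + c * (e * t ^+ n2).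
    by rewrite exprD; ring.
  apply: locD; apply: locM => //; apply: loc_idl.
  by exists d.
apply: (@codim_ext ( *%R e) _ _ (locI gs) (locI (e :: gs))) => //.
- by move=> x y; rewrite mulrDr.
- by move=> a x; rewrite mulrCA.
- exact: loc_submod.
- exact: loc_submod.
- exact: loc_consS.
- by move=> x; rewrite mulrC; apply/locM/(loc_gen (e :: gs) 0).
move=> x /loc_cons[u u0 [c hc]]; have [v huv] := fin_inv fgs u0.
exists (v * c).
have -> : x - e * (v * c) = v * (u * x - c * e) - (u * v - 1) * x by ring.
by apply: locB; [apply/locM/loc_idl|apply: locMl].
Qed.

Lemma colon_codimP gs e n : codim (locI gs) n ->
  exists n1 n2, [/\ codim (locI (e :: gs)) n1, codim (fun x => locI gs (e * x)) n2
                 & n = (n1 + n2)%N].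
Proof.
move=> cn; have [n1 _ c1] := codim_le (loc_submod gs) (loc_submod (e :: gs)) (@loc_consS e gs) cn.
have eD x y : e * (x + y) = e * x + e * y by rewrite mulrDr.
have eZ a x : e * (k a * x) = k a * (e * x) by rewrite mulrCA.
have [n2 _ c2] := codim_preim eD eZ (loc_submod gs) cn.
exists n1, n2; split=> //.
exact: codim_uniq (loc_submod gs) cn (colon_codim c1 c2).
Qed.

End LocalIdeals.
End Codim.

(** * Polynomials in two variables near the origin *)

Section Evaluation.
Variable F : fieldType.
Local Notation Pl := {poly {poly F}}.

Definition pk : F -> Pl := fun a => a%:P%:P.
HB.instance Definition _ := GRing.RMorphism.copy pk (polyC \o polyC).

Section Ev2.
Variables (A : comNzRingType) (kA : {rmorphism F -> A}) (a b : A).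
(* Substitution of a for the outer variable and of b for the inner one. *)
Definition ev2 (p : Pl) : A := (map_poly (horner_eval b \o map_poly kA) p).[a].
HB.instance Definition _ := GRing.RMorphism.copy ev2
  (horner_eval a \o map_poly (horner_eval b \o map_poly kA)).

Lemma ev2C c : ev2 c%:P = (map_poly kA c).[b].
Proof. by rewrite /ev2 map_polyC hornerC. Qed.
Lemma ev2k c : ev2 (pk c) = kA c.
Proof. by rewrite ev2C map_polyC hornerC. Qed.
Lemma ev2X : ev2 'X = a.
Proof. by rewrite /ev2 map_polyX hornerX. Qed.
Lemma ev2Y : ev2 'X%:P = b.
Proof. by rewrite ev2C map_polyX hornerX. Qed.
End Ev2.

Lemma pl_ext (A : nzRingType) (f g : {rmorphism Pl -> A}) :
  (forall c, f (pk c) = g (pk c)) -> f 'X = g 'X -> f 'X%:P = g 'X%:P -> f =1 g.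
Proof.
move=> hk hX hY; elim/poly_ind => [|p c IH]; first by rewrite !rmorph0.
rewrite !rmorphD !rmorphM /= IH hX; congr (_ + _).
elim/poly_ind: c => [|q c IHq]; first by rewrite !rmorph0.
by rewrite !(rmorphD polyC) !(rmorphM polyC) !rmorphD !rmorphM /= IHq hY hk.
Qed.

Lemma ev2_comp (A B : comNzRingType) (kA : {rmorphism F -> A}) (kB : {rmorphism F -> B})
    (f : {rmorphism A -> B}) a b :
  (forall c, f (kA c) = kB c) ->
  forall p, f (ev2 kA a b p) = ev2 kB (f a) (f b) p.
Proof.
move=> fk p; have := @pl_ext B (f \o ev2 kA a b) (ev2 kB (f a) (f b)).
apply; move=> *; rewrite /= ?ev2k ?ev2X ?ev2Y //.
Qed.

Definition ev0 : Pl -> F := ev2 idfun 0 0.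
HB.instance Definition _ := GRing.RMorphism.copy ev0 (ev2 idfun 0 0).

End Evaluation.
(* Fixing the structures of pk and ev0 keeps unification from unfolding them. *)
Definition pkm (F : fieldType) : {rmorphism F -> {poly {poly F}}} := @pk F.
Definition ev0m (F : fieldType) : {rmorphism {poly {poly F}} -> F} := @ev0 F.
Notation codimP := (codim (pkm _)).
Notation locP := (locI (ev0m _)).

Lemma ev0E (F : fieldType) (p : {poly {poly F}}) : ev0m F p = p`_0`_0.
Proof.
rewrite /= /ev0 /ev2 horner_coef0 coef_map /= /horner_eval horner_coef0.
by rewrite coef_map.
Qed.
Lemma ev0k (F : fieldType) c : ev0m F (pkm F c) = c. Proof. exact: ev2k. Qed.

Section PlaneIdeals.
Variable F : fieldType.
Local Notation Pl := {poly {poly F}}.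
Implicit Types (p q s x : Pl).

Lemma locP_submod gs : submod (pkm F) (locP gs).
Proof. exact: loc_submod. Qed.

Lemma idl2P a b x : idl [:: a; b] x <-> exists al be : Pl, x = al * a + be * b.
Proof.
split=> [[c ->]|[al [be ->]]]; first by exists (c 0%N), (c 1%N); rewrite !big_ord_recl big_ord0 addr0.
by exists (fun i => if i == 0%N then al else be); rewrite !big_ord_recl big_ord0 addr0.
Qed.
Lemma idl3P a b d x : idl [:: a; b; d] x <->
  exists al be de : Pl, x = al * a + be * b + de * d.
Proof.
split=> [[c ->]|[al [be [de ->]]]].
  by exists (c 0%N), (c 1%N), (c 2%N); rewrite !big_ord_recl big_ord0 addr0 addrA.
exists (fun i => if i == 0%N then al else if i == 1%N then be else de).
by rewrite !big_ord_recl big_ord0 addr0 addrA.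
Qed.


Section Automorphism.
Variables s s' : {rmorphism Pl -> Pl}.
Hypotheses (sk : forall c, s (pkm F c) = pkm F c) (ss' : cancel s' s) (s's : cancel s s').
Hypothesis evs : forall p, ev0m F (s p) = ev0m F p.

Lemma loc_aut gs x : locP (map s gs) (s x) <-> locP gs x.
Proof.
have sumE (c : nat -> Pl) : s (\sum_(i < size gs) c i * gs`_i) =
    \sum_(i < size (map s gs)) s (c i) * (map s gs)`_i.
  rewrite rmorph_sum size_map; apply: eq_bigr => i _.
  by rewrite rmorphM (nth_map 0).
split=> [[u u0 [c uE]]|[u u0 [c uE]]].
  exists (s' u); first by rewrite -evs ss'.
  exists (s' \o c); apply: (can_inj s's); rewrite rmorphM ss' uE sumE.
  by apply: eq_bigr => i _; rewrite /= ss'.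
by exists (s u); rewrite ?evs //; exists (s \o c); rewrite -rmorphM uE sumE.
Qed.

Lemma codim_aut gs n : codimP (locP (map s gs)) n <-> codimP (locP gs) n.
Proof.
have E : locP (map s gs) \o s = locP gs.
  by apply/funext => x; apply/propext; apply: loc_aut.
have sD x y : s (x + y) = s x + s y by rewrite rmorphD.
have sZ a x : s (pkm F a * x) = pkm F a * s x by rewrite rmorphM sk.
have back m : codimP (locP gs) m -> codimP (locP (map s gs)) m.
  by move=> h; apply: (codim_iso sD sZ ss' (locP_submod _)); rewrite E.
split=> [h|]; last exact: back.
have [m _] := codim_preim sD sZ (locP_submod _) h.
rewrite E => hm; suff -> : n = m by [].
exact: codim_uniq (locP_submod _) h (back _ hm).
Qed.
End Automorphism.

End PlaneIdeals.

(** * Ramification of the inner variable *)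

Section BaseChange.
Variable F : fieldType.
Variable N : nat.
Local Notation Pl := {poly {poly F}}.

(** The coordinate along t^i of F[t] as a free module over F[t^(N+1)] with basis 1, t, ..., t^N. *)
Definition ucmp i (p : {poly F}) : {poly F} := \poly_(j < size p) p`_(N.+1 * j + i).
Lemma coef_ucmp i p j : (ucmp i p)`_j = p`_(N.+1 * j + i).
Proof.
rewrite coef_poly; case: ltnP => // le; rewrite nth_default //.
by rewrite (leq_trans le) // mulSn -addnA leq_addr.
Qed.
Lemma ucmp_is_zmod i : zmod_morphism (ucmp i).
Proof. by move=> p q; apply/polyP => j; rewrite !(coefB, coef_ucmp). Qed.
HB.instance Definition _ i := GRing.isZmodMorphism.Build {poly F} {poly F} (ucmp i) (ucmp_is_zmod i).

Lemma ucmpM i r p : (i <= N)%N -> ucmp i ((r \Po 'X^(N.+1)) * p) = r * ucmp i p.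
Proof.
move=> le_iN; elim/poly_ind: r p => [|r c IH] p; first by rewrite comp_poly0 !mul0r raddf0.
rewrite comp_polyD comp_polyM comp_polyX comp_polyC mulrDl raddfD /=.
rewrite -mulrA IH mulrDl; congr (_ + _).
  rewrite -mulrA; congr (_ * _); apply/polyP => j.
  rewrite coefXM !coef_ucmp coefXnM; case: j => [|j] /=; first by rewrite muln0 add0n ltnS le_iN.
  by rewrite mulnS -addnA ltnNge leq_addr /= addKn.
by apply/polyP => j; rewrite coefCM !coef_ucmp coefCM.
Qed.

Lemma ucmp_sum p : p = \sum_(i < N.+1) 'X^i * (ucmp i p \Po 'X^(N.+1)).
Proof.
apply/polyP => j; rewrite coef_sum.
have lt : (j %% N.+1 < N.+1)%N by rewrite ltn_mod.
rewrite (bigD1 (Ordinal lt)) //= coefXnM ltnNge leq_mod /= coef_comp_poly_Xn //.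
have -> : (j - j %% N.+1)%N = (j %/ N.+1 * N.+1)%N by rewrite {1}(divn_eq j N.+1) addnK.
rewrite dvdn_mull // mulnK // coef_ucmp [(N.+1 * _)%N]mulnC -divn_eq.
rewrite big1 ?addr0 // => i; rewrite -val_eqE /= => ne.
rewrite coefXnM; case: ltnP => // le; rewrite coef_comp_poly_Xn //.
case: ifP => // dv; case/eqP: ne.
rewrite -(subnK le) -modnDml (eqP dv) add0n modn_small //.
Qed.

Definition btau : Pl -> Pl := map_poly (comp_poly 'X^(N.+1)).
HB.instance Definition _ := GRing.RMorphism.copy btau (map_poly (comp_poly 'X^(N.+1))).
Definition cmp i : Pl -> Pl := map_poly (ucmp i).
HB.instance Definition _ i := GRing.isZmodMorphism.Build Pl Pl (cmp i) (raddfB (map_poly (ucmp i))).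

Lemma coef_cmp i p j : (cmp i p)`_j = ucmp i p`_j.
Proof. by rewrite /cmp (coef_map (ucmp i)). Qed.
Lemma cmpB i x y : cmp i (x - y) = cmp i x - cmp i y.
Proof. exact: raddfB. Qed.
Lemma coef_btau p j : (btau p)`_j = p`_j \Po 'X^(N.+1).
Proof. by rewrite /btau coef_map. Qed.

Lemma btauM x y : btau (x * y) = btau x * btau y.
Proof. exact: rmorphM. Qed.
Lemma btau_k a : btau (pkm F a) = pkm F a.
Proof. by apply/polyP => j; rewrite coef_btau /= /pk coefC; case: eqP; rewrite ?comp_polyC ?comp_poly0. Qed.

Lemma cmpM i r p : (i <= N)%N -> cmp i (btau r * p) = r * cmp i p.
Proof.
move=> le; apply/polyP => j; rewrite coef_cmp !coefM raddf_sum; apply: eq_bigr => l _.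
by rewrite /= coef_btau ucmpM // coef_cmp.
Qed.

Lemma cmp_sum p : p = \sum_(i < N.+1) 'X%:P ^+ i * btau (cmp i p).
Proof.
apply/polyP => j; rewrite coef_sum {1}[p`_j]ucmp_sum; apply: eq_bigr => i _.
by rewrite -polyC_exp coefCM coef_btau coef_cmp.
Qed.

Lemma cmp_idl gs i x : (i <= N)%N -> idl (map btau gs) x -> idl gs (cmp i x).
Proof.
move=> le [c ->]; rewrite raddf_sum size_map; exists (cmp i \o c).
by apply: eq_bigr => j _ /=; rewrite (nth_map 0) // mulrC cmpM // mulrC.
Qed.

Lemma ev0_cmp i x : ev0m F (cmp i x) = x`_0`_i.
Proof. by rewrite ev0E coef_cmp coef_ucmp muln0. Qed.

Lemma ev0_btau x : ev0m F (btau x) = ev0m F x.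
Proof.
by rewrite !ev0E coef_btau coef_comp_poly_Xn // dvdn0 div0n.
Qed.

(** Since the ring is free over the image of [btau], membership can be tested on components. A
    denominator u need not come from that image; the determinant of multiplication by u takes its
    place. *)
Lemma loc_btau gs x : locP (map btau gs) x <-> forall i, (i <= N)%N -> locP gs (cmp i x).
Proof.
split=> [[u u0 hu] i le|h].
  pose M := \matrix_(i < N.+1, l < N.+1) cmp i (u * 'X%:P ^+ l).
  have Mx (j : 'I_N.+1) : \sum_l M j l * cmp l x = cmp j (u * x).
    rewrite {2}[x]cmp_sum big_distrr raddf_sum; apply: eq_bigr => l _.
    by rewrite /= mulrA [RHS](congr1 _ (mulrC _ _)) cmpM ?mxE -1?ltnS // mulrC.
  (* At the origin M is triangular, with the value of u on the whole diagonal. *)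
  apply: (@loc_unit _ _ _ _ (\det M)).
    rewrite -det_map_mx det_trig; last first.
      apply/is_trig_mxP => a b lt; rewrite !mxE ev0_cmp -polyC_exp coefMC.
      by rewrite coefMXn lt.
    rewrite prodf_seq_neq0; apply/allP => a _ /=; rewrite !mxE ev0_cmp -polyC_exp coefMC.
    by rewrite coefMXn ltnn subnn -ev0E.
  pose i' : 'I_N.+1 := Ordinal (le : (i < N.+1)%N).
  (* Cramer's rule recovers the components of x from those of u x. *)
  have -> : \det M * cmp i x = \sum_j \adj M i' j * cmp j (u * x).
    have := mul_adj_mx M => /matrixP E.
    under eq_bigr do rewrite -Mx big_distrr /=.
    rewrite exchange_big /= (bigD1 i') //= [X in _ + X]big1 ?addr0 => [|l ne].
      under eq_bigr do rewrite mulrA.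
      by rewrite -big_distrl /=; have := E i' i'; rewrite !mxE eqxx => ->.
    under eq_bigr do rewrite mulrA.
    rewrite -big_distrl /=; have := E i' l; rewrite !mxE eq_sym (negPf ne) => ->.
    by rewrite mul0r.
  by apply: loc_sum => j; apply/locM/loc_idl/cmp_idl => //; rewrite -ltnS.
rewrite [x]cmp_sum; apply: loc_sum => i; apply: locM.
have [|u u0 [c uE]] := h i; first by rewrite -ltnS.
exists (btau u); first by rewrite ev0_btau.
exists (btau \o c); rewrite -rmorphM uE rmorph_sum size_map; apply: eq_bigr => j _.
by rewrite rmorphM (nth_map 0).
Qed.

Lemma cmp_btau i r : (i <= N)%N -> cmp i (btau r) = if i == 0%N then r else 0.
Proof.
move=> le; rewrite -[btau r]mulr1 cmpM //; have -> : cmp i 1 = (i == 0%N)%:R; last first.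
  by case: eqP; rewrite ?mulr1 ?mulr0.
apply/polyP => j; rewrite coef_cmp; apply/polyP => l; rewrite coef_ucmp coef1.
case: j => [|j] /=; last first.
  by rewrite coef0; case: (i == 0%N); rewrite ?mulr1n ?mulr0n ?coef1 ?coef0.
rewrite coef1 addn_eq0 muln_eq0 /=.
by case: (i == 0%N); rewrite ?andbT ?andbF ?mulr1n ?mulr0n ?coef1 ?coef0 ?coef1.
Qed.

(** Filtration by the number of components required to lie in the ideal; each of its N+1 steps
    contributes one copy of the original quotient. *)
Lemma codim_btau gs n : codimP (locP gs) n -> codimP (locP (map btau gs)) (N.+1 * n).
Proof.
move=> cn.
pose Q j x := forall i, (i < j)%N -> locP gs (cmp i x).
have subQ j : submod (pkm F) (Q j).
  split=> [i _|x y hx hy i lt|a x hx i lt]; first by rewrite raddf0; apply: loc0.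
    by rewrite raddfD; apply: locD; [apply: hx|apply: hy].
  suff -> : cmp i (pkm F a * x) = pkm F a * cmp i x by apply/locM/hx.
  apply/polyP => l; rewrite coef_cmp !coefCM coef_cmp; apply/polyP => l'.
  by rewrite coef_ucmp !coefCM coef_ucmp.
have step j : (j <= N.+1)%N -> codimP (Q j) (j * n).
  elim: j => [|j IH] lt.
    by rewrite mul0n; apply: codim_eq (codim_setT _) => x; split=> // _ i.
  rewrite mulSn addnC.
  pose T r : Pl := 'X%:P ^+ j * btau r.
  have cmpT i r : (i < j.+1)%N -> cmp i (T r) = if i == j then r else 0.
    move=> lti; have lei : (i <= N)%N by rewrite -ltnS (leq_trans lti).
    rewrite /T mulrC cmpM //; have -> : cmp i ('X%:P ^+ j) = (i == j)%:R; last first.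
      by case: eqP; rewrite ?mulr1 ?mulr0.
    apply/polyP => l; rewrite coef_cmp -polyC_exp; apply/polyP => l'; rewrite coef_ucmp coefC.
    case: l => [|l] /=; last first.
      by rewrite coef0; case: eqP => _; rewrite ?coef0 // mulr1n coef1 coef0.
    rewrite coefXn.
    have -> : (N.+1 * l' + i == j)%N = (i == j) && (l' == 0%N).
      apply/eqP/andP => [E|[/eqP-> /eqP->]]; last by rewrite muln0.
      by case: l' E => [|l'] E; [rewrite -E muln0 eqxx|move: lt lti; rewrite -E mulnS; lia].
    by case: (i == j) => /=; rewrite ?mulr1n ?mulr0n !coefE //; case: l'.
  apply: (@codim_ext _ _ _ T _ _ (Q j.+1) (Q j)) => //.
  - by move=> x y; rewrite /T rmorphD mulrDr.
  - by move=> a x; rewrite /T btauM mulrCA btau_k.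
  - by move=> x hx i lti; apply: hx; apply: ltnW.
  - move=> x i lti; rewrite cmpT; last exact: ltnW.
    by rewrite ltn_eqF //; apply: loc0.
  - move=> x hx; exists (cmp j x) => i; rewrite ltnS leq_eqVlt => /predU1P[->|lti].
      by rewrite cmpB (cmpT _ _ (leqnn _)) eqxx subrr; apply: loc0.
    have lti' : (i < j.+1)%N by apply: ltnW.
    by rewrite cmpB (cmpT _ _ lti') ltn_eqF // subr0; apply: hx.
  - by apply: IH; apply: ltnW.
  apply: codim_eq cn => x; split=> [hx i lti|/(_ j)] /=.
    by rewrite cmpT //; case: eqP => // _; apply: loc0.
  by rewrite cmpT // eqxx; apply.
have := step _ (leqnn N.+1); apply: codim_eq => x.
by rewrite loc_btau; split=> h i lt; apply: h.
Qed.

Lemma codim_btau_inv gs n : codimP (locP (map btau gs)) n -> exists2 m, codimP (locP gs) m & n = (N.+1 * m)%N.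
Proof.
move=> cn.
have bD x y : btau (x + y) = btau x + btau y by rewrite rmorphD.
have bZ a x : btau (pkm F a * x) = pkm F a * btau x.
  by rewrite btauM btau_k.
have [m _] := codim_preim bD bZ (locP_submod _) cn.
have -> : locP (map btau gs) \o btau = locP gs.
  apply/funext => x; apply/propext; rewrite /= loc_btau.
  split=> [/(_ 0%N (leq0n _))|h i le]; first by rewrite cmp_btau.
  by rewrite cmp_btau //; case: eqP => // _; apply: loc0.
move=> cm; exists m => //; apply: codim_uniq cn (codim_btau cm); exact: locP_submod.
Qed.

End BaseChange.

(** * Intersection numbers with products of smooth branches *)

Section LinearFactors.
Variable F : fieldType.
Local Notation Pl := {poly {poly F}}.
Implicit Types (p q s x : Pl) (w : {poly F}).

Lemma ev0_horner p w : w`_0 = 0 -> ev0m F p = p.[w]`_0.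
Proof.
rewrite -horner_coef0 ev0E -!horner_coef0 => w0.
elim/poly_ind: p => [|p c IH]; first by rewrite !horner0.
by rewrite !hornerE /= w0 !mulr0 add0r.
Qed.

Lemma ev0X : ev0m F 'X = 0. Proof. exact: ev2X. Qed.
Lemma ev0Y : ev0m F 'X%:P = 0. Proof. exact: ev2Y. Qed.
Lemma ev0C w : ev0m F w%:P = w`_0. Proof. by rewrite ev0E coefC. Qed.

Lemma dvdXnP o (p : {poly F}) : reflect (forall i, (i < o)%N -> p`_i = 0) ('X^o %| p).
Proof.
apply: (iffP idP) => [/dvdpP[r ->] i lt|h]; first by rewrite coefMXn lt.
apply/dvdpP; exists (drop_poly o p); rewrite -[LHS](poly_take_drop o).
suff -> : take_poly o p = 0 by rewrite add0r.
by apply/polyP => i; rewrite coef_take_poly coef0; case: ifP => // /h.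
Qed.

Lemma dvdXn_unit o (a b : {poly F}) : a`_0 != 0 -> 'X^o %| a * b -> 'X^o %| b.
Proof.
move=> a0; rewrite Gauss_dvdpr // coprimep_expl // coprimep_sym coprimepX.
by rewrite rootE horner_coef0.
Qed.

Lemma horner_root_factor p w : p.[w] = 0 -> exists r, p = r * ('X - w%:P).
Proof. by move=> h; apply/factor_theorem; rewrite rootE h. Qed.

(** Setting X = w leaves the local ring of F[Y] at 0, where s becomes Y^o times a unit. *)
Lemma loc_linear w s o : w`_0 = 0 -> (forall i, (i < o)%N -> s.[w]`_i = 0) -> s.[w]`_o != 0 ->
  forall x, locP [:: 'X - w%:P; s] x <-> 'X^o %| x.[w].
Proof.
move=> w0 /dvdXnP so so' x; split=> [[u u0 /idl2P[al [be]]]|].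
  move/(congr1 (horner_eval w)); rewrite /horner_eval !hornerE subrr mulr0 add0r => E.
  apply: (@dvdXn_unit _ u.[w]); first by rewrite -ev0_horner.
  by rewrite E dvdp_mull.
case/dvdpP => y xE; have /dvdpP[v sE] := so.
have v0 : v`_0 != 0 by move: so'; rewrite sE coefMXn ltnn subnn.
have [|r rE] := @horner_root_factor (v%:P * x - y%:P * s) w.
  by rewrite !hornerE xE sE; ring.
exists v%:P; first by rewrite ev0C.
by apply/idl2P; exists r, y%:P; rewrite -rE subrK.
Qed.

Lemma codim_linear w s o : w`_0 = 0 -> (forall i, (i < o)%N -> s.[w]`_i = 0) -> s.[w]`_o != 0 ->
  codimP (locP [:: 'X - w%:P; s]) o.
Proof.
move=> w0 so so'; apply: (@codim_eq _ _ _ (fun x => 'X^o %| x.[w])).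
  by move=> x; rewrite (loc_linear w0 so so').
have combE c : (comb (pkm F) o c (fun i => ('X^i)%:P)).[w] = \poly_(i < o) c i.
  rewrite /comb horner_sum poly_def; apply: eq_bigr => i _.
  by rewrite /= /pk !hornerE /= mul_polyC.
exists (fun i => ('X^i)%:P); split=> [c|x].
  by rewrite combE => /dvdXnP h i lt; have := h _ lt; rewrite coef_poly lt.
exists (fun i => x.[w]`_i); apply/dvdXnP => i lt.
by rewrite hornerD hornerN combE coefB coef_poly lt subrr.
Qed.

(* The second components are the orders of s along the branches. *)
Lemma codim_prod (us : seq ({poly F} * nat)) s :
  (forall u, u \in us -> (u.1)`_0 = 0 ->
     (forall i, (i < u.2)%N -> s.[u.1]`_i = 0) /\ s.[u.1]`_(u.2) != 0) ->
  codimP (locP [:: \prod_(u <- us) ('X - (u.1)%:P); s])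
         (\sum_(u <- us | (u.1)`_0 == 0) u.2).
Proof.
elim: us => [|[w o] us IH] hs.
  rewrite !big_nil; apply: codim_eq (codim_setT _) => x; split=> // _.
  by apply: loc_idl; apply/idl2P; exists x, 0; rewrite mul0r addr0 mulr1.
have {}IH : codimP (locP [:: \prod_(u <- us) ('X - (u.1)%:P); s])
         (\sum_(u <- us | (u.1)`_0 == 0) u.2).
  by apply: IH => u hu; apply: hs; rewrite inE hu orbT.
rewrite !big_cons /=; set P := \prod_(u <- us) _ in IH *.
have e0 : ev0m F ('X - w%:P) = - w`_0.
  by rewrite rmorphB ev0X ev0C sub0r.
case: eqP => [w0|/eqP w0]; last first.
  apply: codim_eq IH; apply: loc_ext => -[|[|i]] //= _.
  - apply: (@loc_unit _ _ _ _ ('X - w%:P)); first by rewrite e0 oppr_eq0.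
    exact: loc_gen0.
  - exact: loc_gen1.
  - by apply: locM; apply: loc_gen0.
  - exact: loc_gen1.
have [so so'] := hs (w, o) (mem_head _ _) w0.
(* One branch is split off: adding its equation gives (X - w, s), and the colon ideal by it is (P,
   s) because s is not zero on the branch. *)
apply: (colon_codim (@ev0k F) (e := 'X - w%:P)).
  apply: codim_eq (codim_linear w0 so so'); apply: loc_ext => -[|[|[|i]]] //= _.
  - exact: loc_gen0.
  - exact: loc_gen2.
  - exact: loc_gen0.
  - by apply: locMl; apply: loc_gen0.
  - exact: loc_gen1.
apply: codim_eq IH => x; split=> [[u u0 /idl2P[al [be uE]]]|[u u0 /idl2P[al [be uE]]]].
  exists u => //; apply/idl2P; exists al, (be * ('X - w%:P)).
  by rewrite mulrCA uE; ring.
exists u => //; apply/idl2P.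
have [|r beE] := @horner_root_factor be w.
  have bsE : be * s = ('X - w%:P) * (u * x - al * P).
    by rewrite mulrBr mulrCA uE; ring.
  have : be.[w] * s.[w] = 0 by rewrite -hornerM bsE hornerM hornerXsubC subrr mul0r.
  move/eqP; rewrite mulf_eq0 => /orP[/eqP//|/eqP sw0].
  by move: so'; rewrite sw0 coef0 eqxx.
exists al, r; apply: (mulfI (negbT (polyXsubC_eq0 w))); rewrite mulrCA uE beE; ring.
Qed.

(** Y^n lies in the ideal of q' and s, so changing q' by a multiple of Y^K with K > n stays inside
    it. Conversely Y^n lies in the ideal of q and s, because u + al e Y^(K-n) is still a unit at the
    origin. *)
Lemma codim_perturb q q' s e K n : codimP (locP [:: q'; s]) n -> (n < K)%N ->
  q = q' + 'X%:P ^+ K * e -> codimP (locP [:: q; s]) n.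
Proof.
move=> cn lt qE; have Y0 := ev0Y.
have Yn := codim_nil (@ev0k F) (locI_ideal (pkm F) (ev0m F) _) cn Y0.
have YK gs : locP gs ('X%:P ^+ n) -> locP gs ('X%:P ^+ K * e).
  by move=> h; apply: locMl; rewrite -(subnK (ltnW lt)) exprD; apply: locM.
apply: codim_eq cn; apply: loc_ext => -[|[|i]] //= _.
- have [u u0 /idl2P[al [be uE]]] := Yn.
  have -> : q' = q - 'X%:P ^+ K * e by rewrite qE addrK.
  apply: locB; first exact: loc_gen0.
  apply: YK; apply: (@loc_unit _ _ _ _ (u + al * e * 'X%:P ^+ (K - n))).
    rewrite rmorphD rmorphM rmorphXn Y0 expr0n subn_eq0 leqNgt lt mulr0 addr0 //.
  apply: loc_idl; apply/idl2P; exists al, be.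
  have YE : 'X%:P ^+ K = 'X%:P ^+ (K - n) * 'X%:P ^+ n :> Pl by rewrite -exprD subnK // ltnW.
  by rewrite mulrDl uE qE YE; ring.
- exact: loc_gen1.
- rewrite qE; apply: locD; last exact: YK.
  exact: loc_gen0.
- exact: loc_gen1.
Qed.

End LinearFactors.

(** * Nagata's normalization *)

Section Nagata.
Variable F : fieldType.
Local Notation Pl := {poly {poly F}}.

(* Nagata's substitution makes a nonzero polynomial monic in the outer variable, up to a constant. *)
Definition nag (d : {poly F}) : Pl -> Pl := ev2 (pkm F) 'X ('X%:P + map_poly polyC d).
HB.instance Definition _ d := GRing.RMorphism.copy (nag d) (ev2 (pkm F) 'X ('X%:P + map_poly polyC d)).
Definition nagm d : {rmorphism Pl -> Pl} := nag d.

Lemma nagX d : nagm d 'X = 'X. Proof. exact: ev2X. Qed.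
Lemma nagY d : nagm d 'X%:P = 'X%:P + map_poly polyC d. Proof. exact: ev2Y. Qed.
Lemma nagk d c : nagm d (pkm F c) = pkm F c. Proof. exact: ev2k. Qed.
Lemma nag_outer d (p : {poly F}) : nagm d (map_poly polyC p) = map_poly polyC p.
Proof.
elim/poly_ind: p => [|p c IH]; first by rewrite !rmorph0.
rewrite !rmorphD !rmorphM /= map_polyX map_polyC /= in IH *.
by rewrite -/(nagm d _) IH; congr (_ * _ + _); [exact: nagX|exact: nagk].
Qed.

Lemma nagK d : cancel (nagm d) (nagm (- d)).
Proof.
move=> p; have := @pl_ext _ _ (nagm (- d) \o nagm d) idfun; apply.
- by move=> c /=; rewrite -!/(nagm _ _) !nagk.
- by rewrite /= -!/(nagm _ _) !nagX.
- rewrite /= -!/(nagm _ _) nagY rmorphD nagY nag_outer rmorphN /=.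
  by rewrite addrNK.
Qed.

Lemma ev0_nag m p : ev0m F (nagm 'X^(m.+1) p) = ev0m F p.
Proof.
have := @pl_ext _ _ (ev0m F \o nagm 'X^(m.+1)) (ev0m F); apply.
- by move=> c /=; rewrite -[nag _ _]/(nagm _ _) nagk.
- by rewrite /= -[nag _ _]/(nagm _ _) nagX.
- rewrite /= -[nag _ _]/(nagm _ _) nagY map_polyXn -[ev0 _]/(ev0m F _) rmorphD rmorphXn.
  by rewrite ev0X expr0n addr0.
Qed.

Lemma nagC (b : {poly F}) m :
  nagm 'X^m b%:P = map_poly polyC b \Po ('X^m + 'X%:P).
Proof.
rewrite [LHS]ev2C /comp_poly -map_poly_comp map_polyXn addrC.
by congr horner; apply: eq_map_poly.
Qed.

(** With the exponent m+1 above the X-degree, X^j Y^l gets leading degree j + (m+1) l, and these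
    numbers are distinct. The top one comes from the largest l and, for it, the largest j, which is
    [js]. *)
Lemma lead_nag (p : Pl) : p != 0 ->
  exists m c, c != 0 /\ lead_coef (nagm 'X^(m.+1) p) = c%:P.
Proof.
move=> p0; pose m := size p; exists m.
pose q : Pl := 'X^(m.+1) + 'X%:P.
have sq : size q = m.+2 by rewrite size_polyDl ?size_polyXn // size_polyC polyX_eq0.
have lq : lead_coef q = 1.
  by rewrite lead_coefDl ?lead_coefXn // size_polyXn size_polyC polyX_eq0.
pose D := (\max_(j < size p) size (p`_j)%R)%N.
have Dle j : (size (p`_j)%R <= D)%N.
  have [lt|le] := ltnP j (size p); last by rewrite nth_default ?size_poly0.
  exact: (leq_bigmax (Ordinal lt)).
have D0 : (0 < D)%N.
  by apply: leq_trans (Dle (size p).-1); rewrite lt0n size_poly_eq0 -lead_coefE lead_coef_eq0.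
have exj : exists j, (j < size p)%N && (size (p`_j)%R == D).
  have sp0 : (0 < #|'I_(size p)|)%N by rewrite card_ord lt0n size_poly_eq0.
  have [j Dj] := eq_bigmax (fun j : 'I_(size p) => size (p`_j)%R) sp0.
  by exists j; rewrite ltn_ord -Dj eqxx.
have bndj j : (j < size p)%N && (size (p`_j)%R == D) -> (j <= size p)%N.
  by case/andP => /ltnW.
have [js /andP[lt_js /eqP Djs] jmax] := ex_maxnP exj bndj.
pose T j : Pl := map_poly polyC p`_j \Po q.
have nagE : nagm 'X^(m.+1) p = \sum_(j < size p) T j * 'X^j.
  rewrite -[in LHS](coefK p) poly_def rmorph_sum; apply: eq_bigr => j _.
  by rewrite -mul_polyC rmorphM rmorphXn nagX nagC.
pose ns := (js + m.+1 * D.-1)%N.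
have szT j i : (j < size p)%N -> j != js -> (ns <= i)%N -> (T j * 'X^j)`_i = 0.
  move=> ltj ne le; rewrite coefMXn; case: ltnP => // le_ji.
  have [b0|b0] := eqVneq p`_j 0; first by rewrite /T b0 rmorph0 comp_poly0 coef0.
  rewrite nth_default // -ltnS [X in (X < _)%N](_ : _ = ((size (p`_j)%R).-1 * m.+1).+1).
    have := Dle j; rewrite leq_eqVlt => /predU1P[eD|ltD].
      have le_js : (j <= js)%N by apply: jmax; rewrite ltj eD eqxx.
      move: le le_ji; rewrite /ns eD mulnC; have : (j < js)%N by rewrite ltn_neqAle ne.
      lia.
    have : (m.+1 * (size (p`_j)%R).-1 + m.+1 <= m.+1 * D.-1)%N.
      rewrite addnC -mulnS leq_mul2l /= prednK ?size_poly_gt0 //.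
      by rewrite -ltnS prednK.
    move: le le_ji; rewrite /ns [((_).-1 * _)%N]mulnC; rewrite -/m in ltj; lia.
  have := size_comp_poly (map_poly polyC p`_j) q; rewrite -/(T j) sq.
  rewrite size_map_poly_id0; last by rewrite polyC_eq0 lead_coef_eq0.
  move=> <-; rewrite prednK // size_poly_gt0 comp_poly_eq0 ?sq //.
  by rewrite map_poly_eq0_id0 // polyC_eq0 lead_coef_eq0.
have c0 : lead_coef p`_js != 0.
  by rewrite lead_coef_eq0 -size_poly_gt0 Djs.
have sizT : size (T js) = (m.+1 * D.-1).+1.
  have := size_comp_poly (map_poly polyC p`_js) q; rewrite -/(T js) sq.
  rewrite size_map_poly_id0; last by rewrite polyC_eq0.
  rewrite Djs mulnC => <-; rewrite prednK // size_poly_gt0 comp_poly_eq0 ?sq //.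
  by rewrite map_poly_eq0_id0 ?polyC_eq0 // -lead_coef_eq0.
have leadT : lead_coef (T js) = (lead_coef p`_js)%:P.
  rewrite lead_coef_comp ?sq // lq expr1n mulr1 lead_coef_map_id0 ?rmorph0 //.
  by rewrite polyC_eq0.
have top : (nagm 'X^(m.+1) p)`_ns = (lead_coef p`_js)%:P.
  rewrite nagE coef_sum (bigD1 (Ordinal lt_js)) //= big1 ?addr0 => [|j ne].
    by rewrite coefMXn ltnNge leq_addr /= addKn -leadT lead_coefE sizT.
  by apply: szT => //.
exists (lead_coef p`_js); split=> //.
suff snag : size (nagm 'X^(m.+1) p) = ns.+1 by rewrite lead_coefE snag.
apply/eqP; rewrite eqn_leq; apply/andP; split; last first.
  rewrite ltnNge; apply/negP => le; move: top; rewrite nth_default // => /esym/eqP.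
  by rewrite polyC_eq0 (negPf c0).
apply/leq_sizeP => i lt; rewrite nagE coef_sum big1 // => j _.
have [->|ne] := eqVneq (j : nat) js; last by rewrite szT // ltnW.
rewrite coefMXn; case: ltnP => // le; rewrite nth_default // sizT.
by move: lt; rewrite /ns; lia.
Qed.
End Nagata.

(** * Comparison of intersection numbers along arcs *)

Section Arcs.
Variable F : closedFieldType.
Hypothesis char0 : forall n, n.+1%:R != 0 :> F.
Local Notation Pl := {poly {poly F}}.
Local Notation ps := (ps F).

Definition psCm : {rmorphism F -> ps} := @psC F.
Definition aev (x y : ps) : {rmorphism Pl -> ps} := ev2 psCm x y.

Lemma aevX x y : aev x y 'X = x. Proof. exact: ev2X. Qed.
Lemma aevY x y : aev x y 'X%:P = y. Proof. exact: ev2Y. Qed.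
Lemma aevk x y c : aev x y (pkm F c) = psC c. Proof. exact: ev2k. Qed.

Lemma aev0 x y p : psc x 0 = 0 -> psc y 0 = 0 -> psc (aev x y p) 0 = ev0m F p.
Proof.
move=> x0 y0; have E c : psc0m (psCm c) = idfun c by rewrite /psc0m /= coefC.
have := @ev2_comp F ps F psCm idfun (@psc0m F) x y E p.
by rewrite /= [psc0m x]x0 [psc0m y]y0.
Qed.

Lemma aev_btau N u p : aev u (ps_t F ^+ N.+1) p = (map_poly (@ps_poly F) (btau N p)).[u].
Proof.
have := @pl_ext F _ (aev u (ps_t F ^+ N.+1))
  (horner_eval u \o (map_poly (@ps_poly F) \o btau N)); apply.
- move=> c; rewrite aevk [RHS]/= -[pk c]/(pkm F c) btau_k /= /pk map_polyC /=.
  by rewrite /horner_eval hornerC.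
- by rewrite aevX [RHS]/= /btau map_polyX map_polyX /horner_eval hornerX.
- rewrite aevY [RHS]/= /btau map_polyC /= map_polyC /= comp_polyX.
  by rewrite /horner_eval hornerC rmorphXn.
Qed.

Lemma aev_nag x y m p : aev x y (nagm 'X^m p) = aev x (y + x ^+ m) p.
Proof.
have := @pl_ext F _ (aev x y \o nagm 'X^m) (aev x (y + x ^+ m)); apply.
- by move=> c; rewrite aevk /= -[nag _ _]/(nagm _ _) nagk -[ev2 _ _ _ _]/(aev _ _ _) aevk.
- by rewrite aevX /= -[nag _ _]/(nagm _ _) nagX -[ev2 _ _ _ _]/(aev _ _ _) aevX.
- rewrite aevY /= -[nag _ _]/(nagm _ _) nagY -[ev2 _ _ _ _]/(aev _ _ _).
  by rewrite rmorphD aevY map_polyXn rmorphXn aevX.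
Qed.

Lemma prod_cong (us : seq (ps * ps)) K :
  (forall u, u \in us -> exists e, u.1 = u.2 + ps_t F ^+ K * e) ->
  exists E : {poly ps}, \prod_(u <- us) ('X - (u.1)%:P) =
     \prod_(u <- us) ('X - (u.2)%:P) + (ps_t F ^+ K) *: E.
Proof.
elim: us => [|u us IH] h.
  by exists 0; rewrite !big_nil scaler0 addr0.
have [|E EE] := IH; first by move=> v hv; apply: h; rewrite inE hv orbT.
have [e eE] := h u (mem_head _ _); rewrite !big_cons EE eE.
exists (('X - (u.2 + ps_t F ^+ K * e)%:P) * E - e *: \prod_(v <- us) ('X - (v.2)%:P)).
rewrite -!mul_polyC polyCD polyCM; ring.
Qed.

Lemma horner_cong (P : {poly ps}) a b K e : a = b + ps_t F ^+ K * e ->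
  exists e', P.[a] = P.[b] + ps_t F ^+ K * e'.
Proof.
move=> ->; elim/poly_ind: P => [|P c [e' IH]].
  by exists 0; rewrite !horner0 mulr0 addr0.
rewrite !hornerE IH; exists (P.[b] * e + e' * (b + ps_t F ^+ K * e)); ring.
Qed.

(** After the ramification Y = t^(N+1) the curve q = 0 is a union of graphs of power series, and the
    colength is the sum of the orders of s1 along those through the origin. The series are truncated
    far enough for [codim_prod] to apply to polynomials and for [codim_perturb] to return to q. *)
Lemma arc_monic (q s1 s2 : Pl) n : q \is monic -> codimP (locP [:: q; s1]) n ->
  (forall x y, psc x 0 = 0 -> psc y 0 = 0 -> aev x y q = 0 ->
     forall o, has_ord (aev x y s1) o -> has_ord (aev x y s2) o) ->
  codimP (locP [:: q; s2]) n.
Proof.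
move=> mq cn harc.
have [|N [us usE]] := puiseux char0 (Q := map_poly (@ps_poly F) q); first exact: monic_map.
pose tM := ps_t F ^+ N.+1.
have tM0 : psc tM 0 = 0.
  by rewrite /tM exprS pscM0 /= coefX mul0r.
have btE : map_poly (@ps_poly F) (btau N q) = \prod_(u <- us) ('X - u%:P).
  rewrite -usE; apply/polyP => i.
  rewrite (coef_map (@ps_poly F) (btau N q)) (coef_map (ps_subst N)).
  by rewrite (coef_map (@ps_poly F)) /= coef_btau ps_subst_poly.
have arcq u : u \in us -> aev u tM q = 0.
  by move=> hu; rewrite aev_btau btE (big_rem u) //= hornerM hornerXsubC subrr mul0r.
have [o oP] : exists o : ps -> nat, forall u, u \in us -> psc u 0 = 0 ->
    has_ord (aev u tM s1) (o u).
  have [|o ho] := @choice ps nat (fun u o => u \in us -> psc u 0 = 0 -> has_ord (aev u tM s1) o); last by exists o.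
  move=> u; have [hu|] := boolP (u \in us); last by exists 0%N.
  have [u0|] := eqVneq (psc u 0) 0; last by move=> ne; exists 0%N => _ /eqP; rewrite (negPf ne).
  suff /has_ord_exists[m hm] : aev u tM s1 != 0 by exists m.
  (* If s1 vanished on the branch, so would w Y^n with w a unit at the origin, although Y pulls back
     to t^(N+1). *)
  have [w w0 /idl2P[al [be wE]]] := codim_nil (@ev0k F) (locI_ideal (pkm F) (ev0m F) _) cn (ev0Y F).
  apply: contraNneq w0 => s10.
  have /eqP := congr1 (aev u tM) wE; rewrite rmorphD !rmorphM s10 mulr0 arcq // mulr0 addr0.
  rewrite rmorphXn aevY => /eqP /ps_mul_eq0 [h|h].
    by rewrite -(aev0 _ u0 tM0) h.
  exfalso; have : has_ord (tM ^+ n) (N.+1 * n).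
    rewrite /tM -exprM; split=> [i lt|]; rewrite -[_ ^+ _]mulr1 psc_tXM ?lt //.
    by rewrite ltnn subnn psc1 oner_neq0.
  by move/has_ord_neq0; rewrite h eqxx.
have oP2 u (hu : u \in us) (u0 : psc u 0 = 0) : has_ord (aev u tM s2) (o u).
  exact: harc u0 tM0 (arcq _ hu) _ (oP _ hu u0).
pose Lam := (\sum_(u <- us | psc u 0%N == 0%R) o u)%N.
have o_le u : u \in us -> psc u 0 = 0 -> (o u <= Lam)%N.
  by move=> hu /eqP u0; rewrite /Lam (big_rem u) //= u0 leq_addr.
(* Precision Lam + 1 exceeds the order of s1 and of s2 on each branch through the origin, and also
   the total colength Lam. *)
pose K := Lam.+1.
pose tr (u : ps) := ps_trunc K u.
have trE (u : ps) : exists e, ps_poly (tr u) = u + ps_t F ^+ K * e.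
  exists (ps_shift K (ps_poly (tr u) - u)).
  rewrite -ps_shiftK; first by rewrite addrC subrK.
  by move=> i lt; rewrite pscD pscN /= coef_poly lt subrr.
have tr0 (u : ps) : (tr u)`_0 = psc u 0 by rewrite coef_poly.
pose q' := \prod_(u <- [seq (tr u, o u) | u <- us]) ('X - (u.1)%:P).
have cod s : (forall u, u \in us -> psc u 0 = 0 -> has_ord (aev u tM s) (o u)) ->
    codimP (locP [:: q'; btau N s]) Lam.
  move=> hs; have -> : Lam = (\sum_(u <- [seq (tr u, o u) | u <- us] | ((u.1)`_0 == 0)%R) u.2)%N.
    by rewrite big_map; apply: eq_bigl => u /=; rewrite tr0.
  apply: codim_prod => _ /mapP[u hu ->] /=; rewrite tr0 => u0.
  have [e hE] := trE u.
  have [e' hE'] := horner_cong (map_poly (@ps_poly F) (btau N s)) hE.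
  have : has_ord (ps_poly (btau N s).[tr u]) (o u).
    rewrite -horner_map /= hE' -aev_btau; apply: has_ordD; first exact: hs.
    by move=> i le; rewrite psc_tXM ltnS (leq_trans le) // o_le.
  by case.
have [e eE] : exists e, btau N q = q' + 'X%:P ^+ K * e.
  pose d : Pl := btau N q - q'; suff dK i : 'X^K %| d`_i.
    exists (map_poly (drop_poly K) d); rewrite -[LHS](subrK q') -/d addrC; congr (_ + _).
    apply/polyP => i; rewrite -polyC_exp coefCM coef_map_id0 ?drop_poly0l //; last first.
      by apply/polyP => j; rewrite coef_drop_poly !coef0.
    rewrite mulrC -[LHS](poly_take_drop K) [take_poly _ _](_ : _ = 0) ?add0r //.
    apply/polyP => j; rewrite coef_take_poly coef0; case: ifP => // lt.
    exact: (dvdXnP _ _ (dK i)).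
  apply/dvdXnP => j lt.
  have [|E EE] := prod_cong (us := [seq (ps_poly (tr u), u) | u <- us]) (K := K).
    by move=> _ /mapP[u hu ->] /=; apply: trE.
  have mq' : map_poly (@ps_poly F) q' = \prod_(u <- [seq (ps_poly (tr u), u) | u <- us]) ('X - (u.1)%:P).
    rewrite rmorph_prod !big_map; apply: eq_bigr => u _.
    by rewrite rmorphB /= map_polyX map_polyC.
  have dE : map_poly (@ps_poly F) d = - (ps_t F ^+ K *: E).
    rewrite rmorphB /= mq' EE btE [in X in _ - (X + _)]big_map; ring.
  have := congr1 (fun P : {poly ps} => psc P`_i j) dE.
  by rewrite (coef_map (@ps_poly F)) coefN coefZ pscN psc_tXM lt oppr0.
have cod1 : codimP (locP [:: btau N q; btau N s1]) Lam by apply: codim_perturb (cod _ oP) _ eE.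
have cod2 : codimP (locP [:: btau N q; btau N s2]) Lam by apply: codim_perturb (cod _ oP2) _ eE.
(* Ramification multiplies colengths by N+1, so both colengths before it are Lam/(N+1). *)
have E1 : Lam = (N.+1 * n)%N.
  by apply: codim_uniq (locP_submod _) cod1 (codim_btau N cn).
have [m cm E2] := codim_btau_inv (gs := [:: q; s2]) cod2.
suff -> : n = m by [].
by apply/eqP; rewrite -(eqn_pmul2l (ltn0Sn N)) -E1 E2.
Qed.

(** The condition on arcs is carried over by Nagata's automorphism, which fixes the origin and makes
    q monic up to a constant. *)
Theorem arc_lemma (q s1 s2 : Pl) n : q != 0 -> codimP (locP [:: q; s1]) n ->
  (forall x y, psc x 0 = 0 -> psc y 0 = 0 -> aev x y q = 0 ->
     forall o, has_ord (aev x y s1) o -> has_ord (aev x y s2) o) ->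
  codimP (locP [:: q; s2]) n.
Proof.
move=> q0 cn harc; have [m [c [c0 lc]]] := lead_nag q0.
pose sg := nagm ('X^(m.+1) : {poly F}).
have sgK := nagK ('X^(m.+1) : {poly F}).
have sgK' : cancel (nagm (- 'X^(m.+1) : {poly F})) sg.
  by have := nagK (- 'X^(m.+1) : {poly F}); rewrite opprK.
have aut s k := @codim_aut F _ _ (@nagk F _) sgK' sgK (@ev0_nag F m) [:: q; s] k.
apply/aut; move/aut: cn => /=; rewrite -/sg => cn.
pose q1 := pkm F c^-1 * sg q.
have q1E s : forall x, locP [:: sg q; s] x <-> locP [:: q1; s] x.
  apply: loc_ext => -[|[|i]] //= _; try exact: loc_gen1.
    apply: (@loc_unit _ _ _ _ (pkm F c^-1)); last exact: loc_gen0.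
    by rewrite ev0k invr_eq0.
  by apply: locM; apply: loc_gen0.
apply: (@codim_eq _ _ _ (locP [:: q1; sg s2])); first by move=> x; rewrite q1E.
have mq1 : q1 \is monic.
  apply/monicP; rewrite /q1 [pkm F _]/(pk _) lead_coefM lead_coefC lc -polyCM mulVf //.
have cn1 : codimP (locP [:: q1; sg s1]) n by apply: codim_eq cn; apply: q1E.
apply: (arc_monic mq1 cn1) => x y x0 y0 h o.
rewrite !aev_nag; apply: harc => //.
  by rewrite pscD y0 exprS pscM0 x0 mul0r addr0.
have : aev x y (pkm F c * q1) = 0 by rewrite rmorphM h mulr0.
by rewrite /q1 mulrA -rmorphM divff // rmorph1 mul1r aev_nag.
Qed.
End Arcs.

(** * Milnor and Tjurina numbers of a germ and of its union with a line *)

Section PlaneCurves.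
Variable F : closedFieldType.
Hypothesis char0 : forall n, n.+1%:R != 0 :> F.
Local Notation Pl := {poly {poly F}}.
Local Notation ps := (ps F).
Local Notation Y := ('X%:P : Pl).

Definition dX (p : Pl) : Pl := p^`().
Definition dY (p : Pl) : Pl := map_poly deriv p.

Lemma dXD p q : dX (p + q) = dX p + dX q. Proof. exact: derivD. Qed.
Lemma dXM p q : dX (p * q) = dX p * q + p * dX q. Proof. exact: derivM. Qed.
Lemma dXX : dX 'X = 1. Proof. exact: derivX. Qed.
Lemma dXC c : dX c%:P = 0. Proof. exact: derivC. Qed.
Lemma coef_dY p i : (dY p)`_i = (p`_i)^`().
Proof. by rewrite coef_map_id0 ?deriv0. Qed.
Lemma dYD p q : dY (p + q) = dY p + dY q.
Proof. by apply/polyP => i; rewrite !(coefD, coef_dY) derivD. Qed.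
Lemma dYM p q : dY (p * q) = dY p * q + p * dY q.
Proof.
apply/polyP => i; rewrite coefD !coefM coef_dY coefM raddf_sum -big_split.
by apply: eq_bigr => j _; rewrite /= !coef_dY derivM.
Qed.
Lemma dYX : dY 'X = 0.
Proof. by apply/polyP => i; rewrite coef_dY coefX coef0; case: (i == 1%N); rewrite ?derivC ?deriv0. Qed.
Lemma dYC c : dY c%:P = (c^`())%:P.
Proof. by rewrite /dY map_polyC. Qed.

Lemma chain_rule x y p :
  ps_deriv (aev x y p) = aev x y (dX p) * ps_deriv x + aev x y (dY p) * ps_deriv y.
Proof.
elim/poly_ind: p => [|p c IH].
  by rewrite /dX /dY deriv0 map_poly0 !rmorph0 -(rmorph0 (@psC F)) ps_derivC rmorph0; ring.
rewrite dXD dYD dXM dYM dXX dYX dXC dYC !rmorphD !rmorphM !(rmorph0, rmorph1) aevX.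
rewrite ps_derivD ps_derivM IH.
suff -> : ps_deriv (aev x y c%:P) = aev x y (c^`())%:P * ps_deriv y by ring.
elim/poly_ind: c {p IH} => [|p c IH].
  by rewrite deriv0 rmorph0 -(rmorph0 (@psC F)) ps_derivC !rmorph0 mul0r.
rewrite derivD derivM derivX derivC !polyCD !polyCM polyC0 !rmorphD !rmorphM.
rewrite !(rmorph0, rmorph1) aevY -[c%:P%:P]/(pkm F c) aevk.
rewrite !(ps_derivD, ps_derivM, ps_derivC) IH; ring.
Qed.

(** Restriction to the line y = 0. *)
Definition rY : {rmorphism Pl -> {poly F}} := map_poly (horner_eval (0 : F)).
Lemma coef_rY p i : (rY p)`_i = p`_i`_0.
Proof. by rewrite (coef_map (horner_eval (0 : F))) /= /horner_eval horner_coef0. Qed.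
Lemma rY_Y : rY Y = 0.
Proof. by rewrite /= map_polyC /= /horner_eval hornerX. Qed.
Lemma ev0_rY p : ev0m F p = (rY p)`_0.
Proof. by rewrite ev0E coef_rY. Qed.
Lemma rY_outer (v : {poly F}) : rY (map_poly polyC v) = v.
Proof. by apply/polyP => i; rewrite coef_rY coef_map /= coefC. Qed.
Lemma rY_eq0 p : rY p = 0 -> exists r, p = Y * r.
Proof.
move=> h; exists (map_poly (drop_poly 1) p); apply/polyP => i.
rewrite coefCM coef_map_id0 ?drop_poly0l //; last by apply/polyP => j; rewrite coef_drop_poly !coef0.
apply/polyP => j; rewrite coefXM coef_drop_poly; case: j => [|j] /=; last by rewrite addn1.
by rewrite -coef_rY h coef0.
Qed.
Lemma rY_dX p : rY (dX p) = (rY p)^`().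
Proof. by apply/polyP => i; rewrite coef_rY !coef_deriv coefMn coef_rY. Qed.
Lemma Y_reg p q : Y * p = Y * q -> p = q.
Proof. by apply: mulfI; rewrite polyC_eq0 polyX_eq0. Qed.
Lemma dX_Y p : dX (Y * p) = Y * dX p.
Proof. by rewrite dXM dXC mul0r add0r. Qed.
Lemma dY_Y p : dY (Y * p) = p + Y * dY p.
Proof. by rewrite dYM dYC derivX polyC1 mul1r. Qed.
Lemma dvd_Y (b s : Pl) r : rY s != 0 -> b * s = Y * r -> exists b', b = Y * b'.
Proof.
move=> s0 h; apply: rY_eq0; apply/eqP; have /eqP := congr1 rY h.
by rewrite !rmorphM rY_Y mul0r mulf_eq0 (negPf s0) orbF.
Qed.

Lemma loc_Y s i : 'X^i %| rY s -> (rY s)`_i != 0 ->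
  forall x, locP [:: Y; s] x <-> 'X^i %| rY x.
Proof.
move=> so so' x; split=> [[u u0 /idl2P[al [be]]]|].
  move/(congr1 rY); rewrite !(rmorphD, rmorphM) rY_Y mulr0 add0r => E.
  apply: (@dvdXn_unit _ _ (rY u)); first by rewrite -ev0_rY.
  by rewrite E dvdp_mull.
case/dvdpP => y xE; have /dvdpP[v sE] := so.
have v0 : v`_0 != 0 by move: so'; rewrite sE coefMXn ltnn subnn.
have [|r rE] := @rY_eq0 (map_poly polyC v * x - map_poly polyC y * s).
  by rewrite rmorphB !rmorphM !rY_outer xE sE; ring.
exists (map_poly polyC v); first by rewrite ev0_rY rY_outer.
by apply/idl2P; exists r, (map_poly polyC y); rewrite [r * _]mulrC -rE subrK.
Qed.

Lemma codim_rY i : codimP (fun x => 'X^i %| rY x) i.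
Proof.
have combE c : rY (comb (pkm F) i c (fun j => 'X^j)) = \poly_(j < i) c j.
  rewrite /comb rmorph_sum poly_def; apply: eq_bigr => j _.
  rewrite rmorphM rmorphXn -mul_polyC; congr (_ * _ ^+ _).
    by rewrite -[RHS]rY_outer map_polyC.
  by rewrite -[RHS]rY_outer map_polyX.
exists (fun i => 'X^i); split=> [c|x].
  by rewrite combE => /dvdXnP h j lt; have := h _ lt; rewrite coef_poly lt.
exists (fun j => (rY x)`_j); apply/dvdXnP => j lt.
by rewrite rmorphB combE coefB [X in _ - X]coef_poly lt subrr.
Qed.

Lemma codim_Y s i : 'X^i %| rY s -> (rY s)`_i != 0 -> codimP (locP [:: Y; s]) i.
Proof.
by move=> so so'; apply: codim_eq (codim_rY i) => x; rewrite (loc_Y so so').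
Qed.

(* Along a branch of dX g = 0 the derivative of g is dY g times that of y, so g vanishes there to
   higher order than dY g. *)
Lemma mu_chart g (c d : F) n : ev0m F g = 0 -> c != 0 ->
  codimP (locP [:: dX g; dY g]) n ->
  codimP (locP [:: dX g; pkm F d * g - (pkm F c + Y) * dY g]) n.
Proof.
move=> g0 c0 cn.
have evs2 : ev0m F (pkm F d * g - (pkm F c + Y) * dY g) = - (c * ev0m F (dY g)).
  by rewrite rmorphB !rmorphM rmorphD !ev0k ev0Y g0; ring.
(* If g_x = 0, then g depends on y only, and finite colength forces g_y to be nonzero at the origin;
   both ideals are then the whole local ring. *)
have [gX0|gX0] := eqVneq (dX g) 0.
  have gYu : ev0m F (dY g) != 0.
    apply/eqP => gY0.
    have gE : g = (g`_0)%:P.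
      apply/polyP => -[|i]; rewrite coefC //=; have := coef_deriv g i.
      rewrite -/(dX g) gX0 coef0 => /esym/eqP; rewrite -mulr_natr mulf_eq0 => /orP[/eqP//|].
      by rewrite -polyC_natr polyC_eq0 (negPf (char0 _)).
    have rgY : rY (dY g) = 0.
      rewrite gE dYC; apply/polyP => -[|i]; last by rewrite coef_rY coefC /= !coef0.
      by rewrite -ev0_rY -dYC -gE gY0 coef0.
    have [u u0 /idl2P[al [be]]] := codim_nil (@ev0k F) (locI_ideal (pkm F) (ev0m F) _) cn (ev0X F).
    rewrite gX0 mulr0 add0r => /(congr1 rY); rewrite !rmorphM rmorphXn rgY mulr0 => /eqP.
    rewrite mulf_eq0 => /orP[/eqP h|]; first by move: u0; rewrite ev0_rY h coef0 eqxx.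
    by rewrite -[X in rY X](map_polyX polyC) rY_outer expf_eq0 polyX_eq0 andbF.
  have all1 s : ev0m F s != 0 -> forall x, locP [:: dX g; s] x <-> True.
    move=> hs x; split=> // _; apply: (loc_unit hs); apply: locMl; exact: loc_gen1.
  apply: codim_eq cn => x; rewrite !all1 // evs2 oppr_eq0 mulf_neq0 //.
apply: (arc_lemma char0 gX0 cn) => x y x0 y0 arc o ho.
have cr := chain_rule x y g; rewrite arc mul0r add0r in cr.
have G0 : psc (aev x y g) 0 = 0 by rewrite aev0.
have main : forall i, (i <= o)%N -> psc (aev x y g) i = 0.
  have [->//|/has_ord_exists[[|o1] hG]] := eqVneq (aev x y g) 0.
    by have [_] := hG; rewrite G0 eqxx.
  suff lt : (o < o1.+1)%N by case: hG => h _ i le; apply: h; apply: leq_ltn_trans lt.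
  have [yz|/has_ord_exists[[|oy] hy]] := eqVneq y 0.
  - move: cr; rewrite yz -(rmorph0 (@psC F)) ps_derivC mulr0 => /(ps_deriv_eq0 char0).
    rewrite rmorph0 -yz G0 rmorph0 => Gz; by have := has_ord_neq0 hG; rewrite Gz eqxx.
  - by have [_] := hy; rewrite y0 eqxx.
  have := has_ordM ho (has_ord_deriv char0 hy); rewrite -cr => h.
  by have := has_ord_uniq h (has_ord_deriv char0 hG); lia.
have hs : has_ord (- psC c * aev x y (dY g)) o.
  rewrite -[o]add0n; apply: has_ordM => //; split=> //.
  by rewrite pscN psc_C oppr_eq0.
have -> : aev x y (pkm F d * g - (pkm F c + Y) * dY g) =
  - psC c * aev x y (dY g) + (psC d * aev x y g - y * aev x y (dY g)).
  by rewrite rmorphB !rmorphM rmorphD !aevk aevY; ring.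
apply: has_ordD => // i le; rewrite pscD pscN.
have -> : psc (psC d * aev x y g) i = 0.
  by rewrite pscM big1 // => j _; rewrite main ?mulr0 // (leq_trans (leq_subr _ _)).
have [->|/has_ord_exists[[|oy] hy]] := eqVneq y 0; first by rewrite mul0r subr0.
  by have [_] := hy; rewrite y0 eqxx.
have [h _] := has_ordM hy ho; rewrite h ?subr0 //; lia.
Qed.

(** On a branch of g_x = 0 one has g' = y' g_y, hence (y g)' = y' (g + y g_y) and y g' = y' (y g_y).
    In characteristic 0 both left sides have order ord(y) + ord(g) - 1. On branches where g vanishes
    the two functions coincide. *)
Lemma mu_line g n : ev0m F g = 0 -> dX g != 0 ->
  codimP (locP [:: dX g; g + Y * dY g]) n -> codimP (locP [:: dX g; Y * dY g]) n.
Proof.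
move=> g0 gX0 cn; apply: (arc_lemma char0 gX0 cn) => x y x0 y0 arc o.
have cr := chain_rule x y g; rewrite arc mul0r add0r in cr.
have G0 : psc (aev x y g) 0 = 0 by rewrite aev0.
rewrite rmorphD rmorphM aevY => ho.
have [Gz|/has_ord_exists[[|o1] hG]] := eqVneq (aev x y g) 0.
- by move: ho; rewrite Gz add0r.
- by have [_] := hG; rewrite G0 eqxx.
have [yz|/has_ord_exists[[|oy] hy]] := eqVneq y 0.
- move: cr; rewrite yz -(rmorph0 (@psC F)) ps_derivC mulr0 => /(ps_deriv_eq0 char0).
  rewrite rmorph0 -yz G0 rmorph0 => Gz; by have := has_ord_neq0 hG; rewrite Gz eqxx.
- by have [_] := hy; rewrite y0 eqxx.
have hy' := has_ord_deriv char0 hy.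
have hyG : has_ord (ps_deriv (y * aev x y g)) (oy + o1.+1).
  by apply: (has_ord_deriv char0); rewrite -addSn; apply: has_ordM.
have hyo : has_ord (ps_deriv y * (aev x y g + y * aev x y (dY g))) (oy + o1.+1).
  suff <- : ps_deriv (y * aev x y g) = ps_deriv y * (aev x y g + y * aev x y (dY g)) by [].
  by rewrite ps_derivM cr; ring.
have -> : o = o1.+1 by apply: has_ord_uniq ho (has_ordM_inv hy' hyo).
apply: (has_ordM_inv hy'); rewrite -addSnnS.
have -> : ps_deriv y * (y * aev x y (dY g)) = y * ps_deriv (aev x y g) by rewrite cr; ring.
by apply: has_ordM => //; apply: has_ord_deriv.
Qed.
End PlaneCurves.

Section LocalFormula.
Variable F : closedFieldType.
Hypothesis char0 : forall n, n.+1%:R != 0 :> F.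
Local Notation Pl := {poly {poly F}}.
Local Notation Y := ('X%:P : Pl).
Variables (g : Pl) (i : nat).
Hypotheses (g0 : ev0m F g = 0) (gi : 'X^i %| rY F g) (gi' : (rY F g)`_i != 0).

Let rg0 : rY F g != 0.
Proof. by apply: contraNneq gi' => ->; rewrite coef0. Qed.
Let i_gt0 : (0 < i)%N.
Proof. by rewrite lt0n; apply: contraNneq gi' => ->; rewrite -ev0_rY g0. Qed.
Let gXi : 'X^(i.-1) %| rY F (dX g).
Proof.
apply/dvdXnP => j lt; rewrite rY_dX coef_deriv.
by move/dvdXnP: gi => -> ; rewrite ?mul0rn //; move: i_gt0 lt; lia.
Qed.
Let gXi' : (rY F (dX g))`_(i.-1) != 0.
Proof. by rewrite rY_dX coef_deriv prednK // -mulr_natr mulf_neq0 // -(prednK i_gt0). Qed.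
Let rgX0 : rY F (dX g) != 0.
Proof. by apply: contraNneq gXi' => ->; rewrite coef0. Qed.

Let Yred s gs : (forall j, (j < size gs)%N -> locP [:: Y; s] gs`_j) ->
  locP (Y :: gs) s -> forall x, locP (Y :: gs) x <-> locP [:: Y; s] x.
Proof.
move=> h1 h2; apply: loc_ext => [[|j]|[|[|j]]] //=.
- by move=> _; apply: loc_gen0.
- by move=> lt; apply: h1.
- by move=> _; apply: loc_gen0.
Qed.

(** Two colon steps by y. The first has quotient of colength i and leaves (g_x, g + y g_y),
    exchanged by [mu_line] for (g_x, y g_y); the second has quotient of colength i - 1, the order of
    g_x on the line, and leaves (g_x, g_y). *)
Lemma mu_line_formula muC muC' :
  codimP (locP [:: dX (Y * g); dY (Y * g)]) muC ->
  codimP (locP [:: dX g; dY g]) muC' -> (muC + 1 = i + i + muC')%N.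
Proof.
rewrite dX_Y dY_Y => cC cC'.
have [n1 [n2 [c1 c2 ->]]] := colon_codimP (@ev0k F) Y cC.
have -> : n1 = i.
  apply: codim_uniq (locP_submod _) c1 _; apply: codim_eq (codim_Y gi gi') => x.
  apply: iff_sym; apply: Yred x.
    move=> [|[|j]] //= _; first by apply: locMl; apply: loc_gen0.
    by apply: locD; [apply: loc_gen1|apply: locMl; apply: loc_gen0].
  rewrite -[X in locI _ _ X](addrK (Y * dY g)).
  by apply: locB; [apply: loc_gen2|apply: locMl; apply: loc_gen0].
have {}c2 : codimP (locP [:: dX g; g + Y * dY g]) n2.
  apply: codim_eq c2 => x; split=> [[u u0 /idl2P[al [be uE]]]|[u u0 /idl2P[al [be uE]]]].
    exists u => //; apply/idl2P.
    have [|be' beE] := @dvd_Y F be g (u * x - al * dX g - be * dY g) rg0.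
      by rewrite !mulrBr mulrCA uE; ring.
    by exists al, be'; apply: Y_reg; rewrite mulrCA uE beE; ring.
  by exists u => //; apply/idl2P; exists al, (Y * be); rewrite mulrCA uE; ring.
have gX0 : dX g != 0 by apply: contraNneq rgX0 => ->; rewrite rmorph0.
have {}c2 := mu_line char0 g0 gX0 c2.
have [m1 [m2 [d1 d2 ->]]] := colon_codimP (@ev0k F) Y c2.
have -> : m1 = i.-1.
  apply: codim_uniq (locP_submod _) d1 _; apply: codim_eq (codim_Y gXi gXi') => x.
  apply: iff_sym; apply: Yred x.
    move=> [|[|j]] //= _; first exact: loc_gen1.
    by apply: locMl; apply: loc_gen0.
  exact: loc_gen1.
have -> : m2 = muC'.
  apply: codim_uniq (locP_submod _) _ cC'.
  apply: codim_eq d2 => x; split=> [[u u0 /idl2P[al [be uE]]]|[u u0 /idl2P[al [be uE]]]].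
    exists u => //; apply/idl2P.
    have [|al' alE] := @dvd_Y F al (dX g) (u * x - be * dY g) rgX0.
      by rewrite !mulrBr mulrCA uE; ring.
    by exists al', be; apply: Y_reg; rewrite mulrCA uE alE; ring.
  by exists u => //; apply/idl2P; exists (Y * al), be; rewrite mulrCA uE; ring.
by move: i_gt0; lia.
Qed.

(* The ideal of the coefficients of dX in the derivations tangent to the curve and to the line,
   enlarged by the equation of the line. *)
Definition tangent_coef (x : Pl) := locP [:: g; Y * dX g; Y * dY g] (dX g * x).

(** A colon step by y gives tauC = i + dim O/(g, g_x, y g_y). The ideal (g, y g_x, y g_y) has
    colength i + tauC' by a colon step by y; a colon step by g_x splits the same number into dim
    O/(g, g_x, y g_y) and the colength of [tangent_coef]. *)
Lemma tau_line_formula tauC tauC' :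
  codimP (locP [:: Y * g; dX (Y * g); dY (Y * g)]) tauC ->
  codimP (locP [:: g; dX g; dY g]) tauC' ->
  exists2 k, codimP tangent_coef k & (k + tauC = i + i + tauC')%N.
Proof.
rewrite dX_Y dY_Y => cC cC'.
have [n1 [n3 [c1 c3 ->]]] := colon_codimP (@ev0k F) Y cC.
have -> : n1 = i.
  apply: codim_uniq (locP_submod _) c1 _; apply: codim_eq (codim_Y gi gi') => x.
  apply: iff_sym; apply: Yred x.
    move=> [|[|[|j]]] //= _; try by apply: locMl; apply: loc_gen0.
    by apply: locD; [apply: loc_gen1|apply: locMl; apply: loc_gen0].
  rewrite -[X in locI _ _ X](addrK (Y * dY g)).
  apply: locB; last by apply: locMl; apply: loc_gen0.
  by apply: loc_consS; apply: loc_gen2.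
have {}c3 : codimP (locP [:: g; dX g; Y * dY g]) n3.
  apply: codim_eq c3 => x; split=> [[u u0 /idl3P[al [be [ga uE]]]]|[u u0 /idl3P[al [be [ga uE]]]]].
    exists u => //; apply/idl3P.
    have [|ga' gaE] := @dvd_Y F ga g (u * x - al * g - be * dX g - ga * dY g) rg0.
      by rewrite !mulrBr mulrCA uE; ring.
    by exists (al + ga'), be, ga'; apply: Y_reg; rewrite mulrCA uE gaE; ring.
  exists u => //; apply/idl3P; exists (al - ga), be, (Y * ga); rewrite mulrCA uE; ring.
have c2 : codimP (locP [:: g; Y * dX g; Y * dY g]) (i + tauC').
  apply: (colon_codim (@ev0k F) (e := Y)).
    apply: codim_eq (codim_Y gi gi') => x; apply: iff_sym; apply: Yred x.
      by move=> [|[|[|j]]] //= _; [apply: loc_gen1|apply: locMl; apply: loc_gen0..].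
    exact: loc_gen1.
  apply: codim_eq cC' => x; split=> [[u u0 /idl3P[al [be [ga uE]]]]|[u u0 /idl3P[al [be [ga uE]]]]].
    by exists u => //; apply/idl3P; exists (Y * al), be, ga; rewrite mulrCA uE; ring.
  exists u => //; apply/idl3P.
  have [|al' alE] := @dvd_Y F al g (u * x - be * dX g - ga * dY g) rg0.
    by rewrite !mulrBr mulrCA uE; ring.
  by exists al', be, ga; apply: Y_reg; rewrite mulrCA uE alE; ring.
have [m1 [k [d1 d2 E]]] := colon_codimP (@ev0k F) (dX g) c2.
exists k => //; suff -> : n3 = m1 by move: E; lia.
apply: codim_uniq (locP_submod _) c3 _; apply: codim_eq d1; apply: loc_ext.
  move=> [|[|[|[|j]]]] //= _; [exact: loc_gen1|exact: loc_gen0| |exact: loc_gen2].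
  by apply: locM; apply: loc_gen1.
move=> [|[|[|j]]] //= _; [exact: loc_gen1|exact: loc_gen0|].
by apply: loc_consS; apply: loc_gen2.
Qed.

End LocalFormula.

(** * Homogeneous forms and affine charts *)

Section HomogeneousForms.
Variable F : fieldType.
Local Notation S := {mpoly F[3]}.

Lemma mpoly_gen_ind (P : S -> Prop) : (forall c, P c%:MP) -> (forall i, P 'X_i) ->
  (forall p q, P p -> P q -> P (p + q)) -> (forall p q, P p -> P q -> P (p * q)) ->
  forall p, P p.
Proof.
move=> hC hX hD hM p; rewrite [p]mpolyE.
have P1 : P 1 by rewrite -mpolyC1; apply: hC.
have P0 : P 0 by rewrite -mpolyC0; apply: hC.
have hXn i n : P ('X_i ^+ n).
  by elim: n => [|n IH]; rewrite ?expr0 // exprS; apply: hM.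
apply: (big_ind P) => [//|p1 q1|m _]; first exact: hD.
rewrite -mul_mpolyC mpolyXE_id; apply: (hM) => //.
by apply: (big_ind P) => [//|p1 q1|i _]; [apply: hM|apply: hXn].
Qed.

Section Eval.
Variables (A : comNzRingType) (kA : {rmorphism F -> A}).
Definition gev (x : 'I_3 -> A) : {rmorphism S -> A} := mmap kA x.
Lemma gevC x c : gev x c%:MP = kA c. Proof. exact: mmapC. Qed.
Lemma gevX x i : gev x 'X_i = x i. Proof. by rewrite /= mmapX mmap1U. Qed.

Lemma gev_ext (f : {rmorphism S -> A}) x : (forall c, f c%:MP = kA c) ->
  (forall i, f 'X_i = x i) -> forall p, f p = gev x p.
Proof.
move=> hC hX; elim/mpoly_gen_ind => [c|i|p q hp hq|p q hp hq].
- by rewrite hC gevC.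
- by rewrite hX gevX.
- by rewrite !rmorphD hp hq.
- by rewrite !rmorphM hp hq.
Qed.

Lemma gev_homog x (c : A) d p : p \is d.-homog -> gev (fun i => c * x i) p = c ^+ d * gev x p.
Proof.
move=> /dhomogP hp; rewrite /= /mmap big_distrr /= !big_seq; apply: eq_bigr => m hm.
rewrite mulrCA; congr (_ * _).
have dm : mdeg m = d := hp _ hm; rewrite /mmap1 -dm mdegE -prodrXr -big_split /=.
by apply: eq_bigr => i _; rewrite exprMn.
Qed.

Lemma gev_cong (I : A) x y : (forall i, exists r, x i = y i + I * r) ->
  forall p, exists r, gev x p = gev y p + I * r.
Proof.
move=> h; elim/mpoly_gen_ind => [c|i|p q [r hp] [s hq]|p q [r hp] [s hq]].
- by exists 0; rewrite !gevC mulr0 addr0.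
- by rewrite !gevX.
- by exists (r + s); rewrite !rmorphD hp hq; ring.
- by exists (r * gev y q + gev y p * s + I * r * s); rewrite !rmorphM hp hq; ring.
Qed.

Lemma eq_gev x y : x =1 y -> gev x =1 gev y.
Proof. by move=> h p; apply: gev_ext => *; rewrite ?gevC ?gevX. Qed.
End Eval.

Lemma gev_comp (A B : comNzRingType) (kA : {rmorphism F -> A}) (kB : {rmorphism F -> B})
    (f : {rmorphism A -> B}) x p :
  (forall c, f (kA c) = kB c) -> f (gev kA x p) = gev kB (f \o x) p.
Proof.
move=> fk; apply: (@gev_ext B kB (f \o gev kA x)) => [c|i] /=.
  by rewrite -[mmap _ _ _]/(gev kA x _) gevC.
by rewrite -[mmap _ _ _]/(gev kA x _) gevX.
Qed.

Definition mC : {rmorphism F -> S} := @mpolyC 3 F.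
Lemma gev_id p : gev mC (fun i => 'X_i) p = p.
Proof. by have := @gev_ext S mC idfun (fun i => 'X_i) _ _ p => <-. Qed.

Lemma meval_gev v p : p.@[v] = gev idfun v p.
Proof. by []. Qed.

Lemma mderiv_homog d i (p : S) : p \is d.+1.-homog -> mderiv i p \is d.-homog.
Proof.
move=> /dhomogP hp; apply/dhomogP => m; rewrite mcoeff_msupp mcoeff_mderiv => ne.
have : (m + U_(i))%MM \in msupp p.
  by rewrite mcoeff_msupp; apply: contraNneq ne => ->; rewrite mul0rn.
move/hp; rewrite -[X in X = _]/(mdeg (m + U_(i))) mdegD mdeg1 addn1 => -[] dm.
exact: dm.
Qed.

Lemma euler d (p : S) : p \is d.-homog -> \sum_(i < 3) 'X_i * mderiv i p = d%:R * p.
Proof.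
move=> /dhomogP hp; rewrite {1}[p]mpolyE.
under eq_bigr => i _ do rewrite linear_sum mulr_sumr /=.
rewrite exchange_big [X in _ = _ * X]mpolyE /= mulr_sumr !big_seq; apply: eq_bigr => m hm.
have E (i : 'I_3) : 'X_i * mderiv i (p@_m *: 'X_[m]) = (m i)%:R * (p@_m *: 'X_[m]).
  rewrite mderivZ mderivX -!scalerAr; congr (_ *: _).
  case: (m i =P 0%N) => [->|/eqP mi]; first by rewrite scale0r mul0r.
  rewrite -mpolyXD addmC submK; last first.
    by apply/mnm_lepP => j; rewrite mnm1E; case: eqP => // <-; rewrite lt0n.
  by rewrite scaler_nat mulr_natl.
under eq_bigr do rewrite E.
have dm : mdeg m = d := hp _ hm.
by rewrite -big_distrl -natr_sum -mdegE dm.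
Qed.

Lemma homog_linear (a : S) : a \is 1.-homog -> a = \sum_(i < 3) a@_(U_(i))%MM *: 'X_i.
Proof.
move=> /dhomogP ha; apply/mpolyP => m.
have [hm|hm] := boolP (mdeg m == 1%N).
  have /eqP := hm; move/eqP/mdeg1P => [i /eqP->].
  rewrite linear_sum /= (bigD1 i) //= mcoeffZ mcoeffX eqxx mulr1 big1 ?addr0 // => j ne.
  rewrite mcoeffZ mcoeffX; case: eqP => [E|]; rewrite ?mulr0 //.
  by have := congr1 (fun m : 'X_{1..3} => m i) E; rewrite !mnm1E eqxx (negPf ne).
rewrite linear_sum /= big1 => [|j _].
  by apply/eqP; rewrite mcoeff_eq0; apply: contra hm => /ha ->.
rewrite mcoeffZ mcoeffX; case: eqP => [E|]; rewrite ?mulr0 //.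
by move: hm; rewrite -E mdeg1 eqxx.
Qed.

Lemma linear_homog (w : 'I_3 -> F) : \sum_(i < 3) w i *: 'X_i \is 1.-homog.
Proof.
apply: rpred_sum => i _; apply: rpredZ; apply/dhomogP => m.
by rewrite msuppX inE => /eqP ->; exact: mdeg1.
Qed.
End HomogeneousForms.

(** * Affine charts adapted to a basis *)

Section Charts.
Variable F : fieldType.
Local Notation S := {mpoly F[3]}.
Local Notation Pl := {poly {poly F}}.

Definition o0 : 'I_3 := ord0.
Definition o1 : 'I_3 := Ordinal (isT : (1 < 3)%N).
Definition o2 : 'I_3 := Ordinal (isT : (2 < 3)%N).
Lemma sum3 (V : nmodType) (f : 'I_3 -> V) : \sum_(i < 3) f i = f o0 + f o1 + f o2.
Proof.
rewrite !big_ord_recl big_ord0 addr0 addrA.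
by congr (f _ + f _ + f _); apply: val_inj.
Qed.
Lemma ord3P (P : 'I_3 -> Prop) : P o0 -> P o1 -> P o2 -> forall i, P i.
Proof.
move=> h0 h1 h2 [[|[|[|i]]] lt] //.
- by rewrite (_ : Ordinal lt = o0) //; apply: val_inj.
- by rewrite (_ : Ordinal lt = o1) //; apply: val_inj.
- by rewrite (_ : Ordinal lt = o2) //; apply: val_inj.
Qed.
Definition y3 (A : nmodType) (a b c : A) : 'I_3 -> A := fun k => [:: a; b; c]`_k.

Lemma y30 (A : nmodType) (a b c : A) : y3 a b c o0 = a. Proof. by []. Qed.
Lemma y31 (A : nmodType) (a b c : A) : y3 a b c o1 = b. Proof. by []. Qed.
Lemma y32 (A : nmodType) (a b c : A) : y3 a b c o2 = c. Proof. by []. Qed.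

Variable B : 'M[F]_3.
Hypothesis uB : B \in unitmx.

(* The coordinates with respect to the basis formed by the rows of B. *)
Definition Lf (k : 'I_3) : S := \sum_(j < 3) invmx B j k *: 'X_j.

Lemma Lf_homog k : Lf k \is 1.-homog. Proof. exact: linear_homog. Qed.

Definition chg (A : comNzRingType) (kA : {rmorphism F -> A}) (y : 'I_3 -> A) :
  {rmorphism S -> A} := gev kA (fun j => \sum_(k < 3) kA (B k j) * y k).

Lemma chgZ (A : comNzRingType) (kA : {rmorphism F -> A}) y c p :
  chg kA y (c *: p) = kA c * chg kA y p.
Proof. by rewrite -mul_mpolyC rmorphM /= -[mmap _ _ _]/(gev _ _ _) gevC. Qed.

Lemma chg_L (A : comNzRingType) (kA : {rmorphism F -> A}) y k : chg kA y (Lf k) = y k.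
Proof.
rewrite rmorph_sum /=.
under eq_bigr do rewrite -[mmap _ _ _]/(chg kA y _) chgZ /chg gevX big_distrr /=.
rewrite exchange_big /= (bigD1 k) //= [X in _ + X]big1 ?addr0 => [|l ne].
  under eq_bigr do rewrite mulrA -rmorphM mulrC [invmx _ _ _ * _]mulrC.
  rewrite -big_distrr -rmorph_sum /=; have /matrixP/(_ k k) := mulmxV uB.
  by rewrite !mxE eqxx => ->; rewrite rmorph1 mulr1.
under eq_bigr do rewrite mulrA -rmorphM mulrC [invmx _ _ _ * _]mulrC.
rewrite -big_distrr -rmorph_sum /=; have /matrixP/(_ l k) := mulmxV uB.
by rewrite !mxE (negPf ne) => ->; rewrite rmorph0 mulr0.
Qed.

Lemma X_L j : 'X_j = \sum_(k < 3) B k j *: Lf k.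
Proof.
rewrite /Lf; under eq_bigr do rewrite scaler_sumr.
rewrite exchange_big /= (bigD1 j) //= [X in _ + X]big1 ?addr0 => [|l ne].
  under eq_bigr do rewrite scalerA mulrC.
  rewrite -scaler_suml; have /matrixP/(_ j j) := mulVmx uB.
  by rewrite !mxE eqxx => ->; rewrite scale1r.
under eq_bigr do rewrite scalerA mulrC.
rewrite -scaler_suml; have /matrixP/(_ l j) := mulVmx uB.
by rewrite !mxE (negPf ne) => ->; rewrite scale0r.
Qed.

Lemma Lf_neq0 k : Lf k != 0.
Proof.
apply/eqP => h; have := @chg_L F idfun (fun=> 1) k.
by rewrite h rmorph0 => /esym/eqP; rewrite oner_eq0.
Qed.

Definition kfrac : {rmorphism F -> {fraction S}} := (@FracField.tofrac S \o @mpolyC 3 F).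
Local Notation "x %:Fr" := (@FracField.tofrac S x) (at level 2).

Lemma Xfrac j : ('X_j)%:Fr = kfrac (B o0 j) * (Lf o0)%:Fr + kfrac (B o1 j) * (Lf o1)%:Fr
  + kfrac (B o2 j) * (Lf o2)%:Fr.
Proof. by rewrite X_L sum3 !rmorphD -!mul_mpolyC !rmorphM. Qed.

Lemma frac_scale d (p : S) : p \is d.-homog ->
  gev kfrac (fun j => ('X_j)%:Fr / (Lf o0)%:Fr) p = p%:Fr / (Lf o0)%:Fr ^+ d.
Proof.
move=> hp.
rewrite (@eq_gev _ _ _ _ (fun j => (Lf o0)%:Fr^-1 * ('X_j)%:Fr)) => [|j]; last exact: mulrC.
rewrite (gev_homog _ _ _ hp) mulrC exprVn; congr (_ / _).
by rewrite -{2}[p]gev_id (@gev_comp F S _ (@mC F) kfrac (@FracField.tofrac S)).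
Qed.

(** Dehomogenization in the chart where the first form of the dual basis is 1, with the first row of
    B as origin. *)
Definition phi : {rmorphism S -> Pl} := chg (pkm F) (y3 1 'X 'X%:P).
Definition row_pt (k : 'I_3) : 'I_3 -> F := fun j => B k j.

Lemma phi_L0 : phi (Lf o0) = 1. Proof. exact: chg_L. Qed.
Lemma phi_L1 : phi (Lf o1) = 'X. Proof. exact: chg_L. Qed.
Lemma phi_L2 : phi (Lf o2) = 'X%:P. Proof. exact: chg_L. Qed.
Lemma phiC c : phi c%:MP = pkm F c. Proof. exact: gevC. Qed.

Lemma ev_phi p : ev0m F (phi p) = p.@[row_pt o0].
Proof.
rewrite meval_gev (@gev_comp F _ _ (pkm F) idfun (ev0m F)); last exact: ev0k.
apply: eq_gev => j; rewrite /comp rmorph_sum sum3 !rmorphM !ev0k.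
by rewrite ?y30 y31 y32 ?rmorph1 ev0X ev0Y mulr1 !mulr0 !addr0.
Qed.

(** In the fraction field a form p of degree d is L0^d times phi(p) evaluated at (L1/L0, L2/L0). *)
Lemma phi_inj d (p : S) : p \is d.-homog -> phi p = 0 -> p = 0.
Proof.
move=> hp h0.
have L0 : (Lf o0)%:Fr != 0 by rewrite tofrac_eq0 Lf_neq0.
pose Psi : {rmorphism Pl -> {fraction S}} :=
  ev2 kfrac ((Lf o1)%:Fr / (Lf o0)%:Fr) ((Lf o2)%:Fr / (Lf o0)%:Fr).
have : Psi (phi p) = p%:Fr / (Lf o0)%:Fr ^+ d.
  rewrite -frac_scale // (@gev_comp F _ _ (pkm F) kfrac Psi); last by move=> c; apply: ev2k.
  apply: eq_gev => j; rewrite /comp Xfrac !mulrDl mulfK // -!mulrA.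
  have PsiZ c x : Psi (pkm F c * x) = kfrac c * Psi x.
    by rewrite rmorphM; congr (_ * _); apply: ev2k.
  rewrite rmorph_sum sum3 !PsiZ y30 y31 y32 rmorph1 mulr1.
  by congr (_ + _ * _ + _ * _); [apply: ev2X|apply: ev2Y].
rewrite h0 rmorph0 => /esym/eqP; rewrite mulf_eq0 invr_eq0 expf_eq0 (negPf L0) andbF orbF.
by rewrite tofrac_eq0 => /eqP.
Qed.

(** Homogenization, by padding with powers of L0. All large degrees are provided because several
    polynomials must be lifted to a common degree. *)
Lemma lift_phi (r : Pl) : exists e0, forall e, (e0 <= e)%N ->
  exists2 H : S, H \is e.-homog & phi H = r.
Proof.
pose liftable (r : Pl) := exists e0, forall e, (e0 <= e)%N ->
  exists2 H : S, H \is e.-homog & phi H = r.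
have hL e : Lf o0 ^+ e \is e.-homog.
  by rewrite -[X in X.-homog]mul1n; apply: dhomogMn; apply: Lf_homog.
have lD x y : liftable x -> liftable y -> liftable (x + y).
  move=> [e1 h1] [e2 h2]; exists (maxn e1 e2) => e; rewrite geq_max => /andP[/h1[H1 hH1 <-] /h2[H2 hH2 <-]].
  by exists (H1 + H2); [apply: rpredD|rewrite rmorphD].
have lM x y : liftable x -> liftable y -> liftable (x * y).
  move=> [e1 h1] [e2 h2]; exists (e1 + e2)%N => e le.
  have [H1 hH1 <-] := h1 _ (leqnn _).
  have [|H2 hH2 <-] := h2 (e - e1)%N; first by rewrite leq_subRL ?(leq_trans (leq_addr _ _) le).
  exists (H1 * H2); last by rewrite rmorphM.
  by rewrite -(subnKC (leq_trans (leq_addr e2 e1) le)); apply: dhomogM.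
have lL k : liftable (phi (Lf k)).
  exists 1%N => -[//|e] _; exists (Lf o0 ^+ e * Lf k).
    by rewrite -[e.+1]addn1; apply: dhomogM => //; apply: Lf_homog.
  by rewrite rmorphM rmorphXn phi_L0 expr1n mul1r.
have lC c : liftable (pkm F c).
  exists 0%N => e _; exists (c *: Lf o0 ^+ e); first exact: rpredZ.
  by rewrite -mul_mpolyC rmorphM rmorphXn phi_L0 phiC expr1n mulr1.
change (liftable r); elim/poly_ind: r => [|p c IH].
  by rewrite -(rmorph0 (pkm F)); apply: (lC).
apply: (lD); first by apply: (lM) => //; rewrite -phi_L1; apply: (lL).
elim/poly_ind: c => [|q c IHq]; first by rewrite polyC0 -(rmorph0 (pkm F)); apply: (lC).
rewrite polyCD polyCM; apply: (lD); last exact: lC.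
by apply: (lM) => //; rewrite -phi_L2; apply: (lL).
Qed.
End Charts.

(** * Local dimensions of homogeneous ideals read in a chart *)

Section LocalDimension.
Variable F : fieldType.
Local Notation S := {mpoly F[3]}.
Local Notation Pl := {poly {poly F}}.
Implicit Types (v : 'I_3 -> F) (gens : seq S).

Definition evS v : {rmorphism S -> F} := gev idfun v.
Definition sloc v gens := locI (evS v) gens.
Definition sdim gens v n :=
  (exists (e : nat) (hs : 'I_n -> S), (forall k, hs k \is e.-homog) /\
     forall c : 'I_n -> F, sloc v gens (\sum_(k < n) c k *: hs k) -> forall k, c k = 0) /\
  (forall (e : nat) (hs : 'I_n.+1 -> S), (forall k, hs k \is e.-homog) ->
     exists c : 'I_n.+1 -> F, (exists k, c k != 0) /\
       sloc v gens (\sum_(k < n.+1) c k *: hs k)).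

Lemma sdim_eq gens gens' v n : (forall h, sloc v gens h <-> sloc v gens' h) ->
  sdim gens v n -> sdim gens' v n.
Proof.
move=> h; rewrite /sdim; have -> : sloc v gens' = sloc v gens; last by [].
by apply/funext => x; apply/propext; rewrite h.
Qed.

Definition homogs gens := forall k, (k < size gens)%N -> exists d, gens`_k \is d.-homog.

Definition fam n (hs : 'I_n -> S) (i : nat) : S := if insub i is Some k then hs k else 0.
Lemma famE n (hs : 'I_n -> S) (k : 'I_n) : fam hs k = hs k.
Proof. by rewrite /fam valK. Qed.

Variable B : 'M[F]_3.
Hypothesis uB : B \in unitmx.
Local Notation v := (row_pt B o0).
Local Notation phi := (phi B).

Lemma phiZ c h : phi (c *: h) = pkm F c * phi h.
Proof. by rewrite -mul_mpolyC rmorphM phiC. Qed.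

Lemma Lf_exp_homog e : Lf B o0 ^+ e \is e.-homog.
Proof. by rewrite -[X in X.-homog]mul1n; apply: dhomogMn; apply: Lf_homog. Qed.

(** To go back from the chart, all cofactors are homogenized so that the relation becomes one
    between forms of a single degree, where [phi_inj] applies. *)
Lemma sloc_phi gens h d : homogs gens -> h \is d.-homog ->
  sloc v gens h <-> locP (map phi gens) (phi h).
Proof.
move=> hg hh; split=> [[u u0 [c uE]]|[u u0 [c uE]]].
  exists (phi u); first by rewrite ev_phi.
  exists (phi \o c); rewrite -rmorphM uE rmorph_sum size_map; apply: eq_bigr => i _.
  by rewrite rmorphM (nth_map 0).
have [eu hu] := lift_phi uB u.
have [ec hc] := choice (fun i => lift_phi uB (c i)).
have [dg hdg] : exists dg, forall k, (k < size gens)%N -> gens`_k \is (dg k).-homog.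
  have [|dg hdg] := @choice nat nat (fun k d => (k < size gens)%N -> gens`_k \is d.-homog); last by exists dg.
  by move=> k; have [/hg[e he]|_] := ltnP k (size gens); [exists e|exists 0%N].
pose E := (eu + \sum_(i < size gens) (ec i + dg i))%N.
have leE (i : 'I_(size gens)) : (ec i + dg i <= E)%N.
  by rewrite /E (bigD1 i) //= addnCA leq_addr.
have [U hU UE] := hu E (leq_addr _ _).
have [C hC] : exists C : nat -> S, forall i, (i < size gens)%N ->
    C i \is (E + d - dg i).-homog /\ phi (C i) = c i.
  have [|C hC] := @choice nat S (fun i C => (i < size gens)%N -> C \is (E + d - dg i).-homog /\ phi C = c i); last by exists C.
  move=> i; have [lt|_] := ltnP i (size gens); last by exists 0.
  have [|H hH HE] := hc i (E + d - dg i)%N; last by exists H.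
  have le : (ec i + dg i <= E)%N := leE (Ordinal lt).
  apply: (leq_trans _ (leq_sub2r _ (leq_trans le (leq_addr d _)))).
  by rewrite addnK.
exists U; first by rewrite /= -[mmap _ _ _]/(gev idfun v U) -meval_gev -ev_phi UE.
exists C; apply/eqP; rewrite -subr_eq0; apply/eqP.
apply: (@phi_inj _ B uB (E + d)).
  apply: rpredB; first exact: dhomogM.
  apply: rpred_sum => i _; have [h1 _] := hC i (ltn_ord i).
  have le : (dg i <= E + d)%N by exact: leq_trans (leq_trans (leq_addl _ _) (leE i)) (leq_addr _ _).
  rewrite -[(E + d)%N](subnK le).
  by apply: dhomogM => //; apply: hdg.
rewrite rmorphB rmorphM UE uE rmorph_sum size_map.
apply/eqP; rewrite subr_eq0; apply/eqP; apply: eq_bigr => i _.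
by rewrite rmorphM (hC i (ltn_ord i)).2 (nth_map 0).
Qed.

Lemma comb_phi n (c : nat -> F) (hs : 'I_n -> S) :
  comb (pkm F) n c (phi \o fam hs) = phi (\sum_(k < n) c k *: hs k).
Proof.
rewrite rmorph_sum; apply: eq_bigr => k _.
by rewrite phiZ /= famE.
Qed.

(** Forms of one degree stand for arbitrary polynomials: every polynomial lifts to a form of large
    degree, and multiplying by powers of L0 raises a degree without changing the image. *)
Lemma sdim_codim gens n : homogs gens -> sdim gens v n <-> codimP (locP (map phi gens)) n.
Proof.
move=> hg; have sP := locP_submod (map phi gens).
have homc m (c : 'I_m -> F) e (hs : 'I_m -> S) : (forall k, hs k \is e.-homog) ->
    \sum_(k < m) c k *: hs k \is e.-homog.
  by move=> hh; apply: rpred_sum => k _; apply: rpredZ.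
have combI m (c : 'I_m -> F) e (hs : 'I_m -> S) : (forall k, hs k \is e.-homog) ->
    sloc v gens (\sum_(k < m) c k *: hs k) <->
    locP (map phi gens) (comb (pkm F) m (fun i => if insub i is Some k then c k else 0) (phi \o fam hs)).
  move=> hh; rewrite comb_phi.
  under [X in phi X]eq_bigr do rewrite valK.
  by apply: (@sloc_phi _ _ e) => //; apply: homc.
split=> [[[e [hs [hh ind]]] dep]|[h [ih sh]]].
  exists (phi \o fam hs).
  have ih : indep (pkm F) (locP (map phi gens)) n (phi \o fam hs).
    move=> c; rewrite comb_phi => h i lt.
    apply: (ind (fun k => c k) _ (Ordinal lt)).
    by apply/(@sloc_phi _ _ e) => //; apply: homc.
  split=> // r; have [er hr] := lift_phi uB r.
  pose E := (e + er)%N; have [H hH HE] := hr E (leq_addl _ _).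
  pose ks (k : 'I_n.+1) : S := if insub (k : nat) is Some j then Lf B o0 ^+ er * hs j else H.
  have hks k : ks k \is E.-homog.
    rewrite /ks; case: insubP => // j _ _; rewrite /E addnC.
    by apply: dhomogM => //; apply: Lf_exp_homog.
  have [c [[k0 ck0]]] := dep E ks hks.
  rewrite (combI _ _ _ _ hks); set c' := fun i => _.
  have -> : comb (pkm F) n.+1 c' (phi \o fam ks) =
    comb (pkm F) n c' (phi \o fam hs) + pkm F (c' n) * r.
    rewrite -comb_rcons; apply: eq_bigr => j _; congr (_ * _).
    rewrite /= famE /ks; case: insubP => [j' _ jE|].
      by rewrite rmorphM rmorphXn phi_L0 // expr1n mul1r -jE ltn_eqF ?ltn_ord // -[RHS]/(phi (fam hs j')) famE.
    rewrite -leqNgt => le; have -> : (j : nat) = n by apply/eqP; rewrite eqn_leq le -ltnS ltn_ord.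
    by rewrite eqxx.
  move=> hc; have [cn0|cn0] := eqVneq (c' n) 0; last exact: comb_solve sP hc cn0.
  move: hc; rewrite cn0 rmorph0 mul0r addr0 => /ih c0.
  case/eqP: ck0; have -> : c k0 = c' k0 by rewrite /c' valK.
  have [lt|] := ltnP k0 n; first exact: c0.
  move=> le; have -> : (k0 : nat) = n by apply/eqP; rewrite eqn_leq le -ltnS ltn_ord.
  exact: cn0.
split.
  have [e0 he0] := choice (fun i => lift_phi uB (h i)).
  pose E := (\sum_(i < n) e0 i)%N.
  have [hs hhs] : exists hs : 'I_n -> S, forall k, hs k \is E.-homog /\ phi (hs k) = h k.
    have [|hs hhs] := @choice 'I_n S (fun k H => H \is E.-homog /\ phi H = h k); last by exists hs.
    move=> k; have [|H hH HE] := he0 k E; last by exists H.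
    by rewrite /E (bigD1 k) //= leq_addr.
  exists E, hs; split=> [k|c]; first by have [] := hhs k.
  rewrite (combI _ _ E) => [hc k|k]; last by have [] := hhs k.
  have := ih (fun i => if insub i is Some k then c k else 0).
  move=> /(_ _ k (ltn_ord k)); rewrite valK; apply.
  rewrite /comb in hc *; under eq_bigr => i _ do rewrite -(hhs i).2 -famE.
  exact: hc.
move=> e hs hh.
have nind : ~ indep (pkm F) (locP (map phi gens)) n.+1 (phi \o fam hs).
  by move=> ind; have := indep_le sP ind sh; rewrite ltnn.
apply: contrapT => hno; apply: nind => c hc i lt.
apply: contrapT => /eqP ci; apply: hno; exists (fun k => c k); split.
  by exists (Ordinal lt).
move: hc; rewrite comb_phi => hc; apply/(@sloc_phi _ _ e) => //; exact: homc.
Qed.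
End LocalDimension.

(** * Milnor and Tjurina numbers in different charts *)

Section CanonicalChart.
Variable F : closedFieldType.
Hypothesis char0 : forall n, n.+1%:R != 0 :> F.
Local Notation S := {mpoly F[3]}.
Local Notation Pl := {poly {poly F}}.
Implicit Types (u v w : 'I_3 -> F) (f : S).

Definition dir u f : S := \sum_(j < 3) u j *: mderiv j f.

Lemma dir_homog d u f : f \is d.+1.-homog -> dir u f \is d.-homog.
Proof. by move=> hf; apply: rpred_sum => j _; apply: rpredZ; apply: mderiv_homog. Qed.

Lemma mderivXU j i : mderiv j 'X_i = (i == j)%:R :> S.
Proof.
rewrite mderivX mnm1E; case: eqP => [->|_]; last by rewrite scale0r.
by rewrite scale1r (_ : (_ - _)%MM = 0%MM) ?mpolyX0 //; apply/mnmP => k; rewrite mnmBE subnn mnm0E.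
Qed.

Lemma dirD u f g : dir u (f + g) = dir u f + dir u g.
Proof. by rewrite /dir -big_split; apply: eq_bigr => j _; rewrite /= mderivD scalerDr. Qed.
Lemma dirM u f g : dir u (f * g) = dir u f * g + f * dir u g.
Proof.
rewrite /dir big_distrl big_distrr -big_split; apply: eq_bigr => j _ /=.
by rewrite mderivM scalerDr -scalerAl -scalerAr.
Qed.
Lemma dirC u c : dir u c%:MP = 0.
Proof. by rewrite /dir big1 // => j _; rewrite mderivC scaler0. Qed.
Lemma dirX u i : dir u 'X_i = (u i)%:MP.
Proof.
rewrite /dir (bigD1 i) //= mderivXU eqxx big1 ?addr0 => [|j ne].
  by rewrite -mul_mpolyC mulr1.
by rewrite mderivXU eq_sym (negPf ne) scaler0.
Qed.

Lemma dir_lin (a b c : F) u v w t f : (forall j, t j = a * u j + b * v j + c * w j) ->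
  dir t f = a *: dir u f + b *: dir v f + c *: dir w f.
Proof.
move=> h; rewrite /dir !scaler_sumr -!big_split; apply: eq_bigr => j _ /=.
by rewrite !scalerA -!scalerDl h.
Qed.

Definition basis_mx u v w : 'M[F]_3 := \matrix_(k, j) y3 (u j) (v j) (w j) k.
Lemma basis_mx0 u v w : row_pt (basis_mx u v w) o0 = u.
Proof. by apply/funext => j; rewrite /row_pt mxE. Qed.
Lemma basis_mx1 u v w : row_pt (basis_mx u v w) o1 = v.
Proof. by apply/funext => j; rewrite /row_pt mxE. Qed.
Lemma basis_mx2 u v w : row_pt (basis_mx u v w) o2 = w.
Proof. by apply/funext => j; rewrite /row_pt mxE. Qed.

Lemma basis_mx_unit u v w :
  (forall a b c, (forall j, a * u j + b * v j + c * w j = 0) -> [/\ a = 0, b = 0 & c = 0]) ->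
  basis_mx u v w \in unitmx.
Proof.
move=> h; rewrite -row_free_unit -kermx_eq0; apply/eqP/row_matrixP => i; rewrite row0.
set x := row i _; have /sub_kermxP/rowP xB : (x <= kermx (basis_mx u v w))%MS by apply: row_sub.
have [|x0 x1 x2] := h (x 0 o0) (x 0 o1) (x 0 o2).
  by move=> j; have := xB j; rewrite !mxE sum3 !mxE.
by apply/rowP; apply: ord3P; rewrite ?x0 ?x1 ?x2 mxE.
Qed.

Section Basis.
Variable B : 'M[F]_3.
Hypothesis uB : B \in unitmx.
Local Notation phi := (phi B).
Local Notation b k := (row_pt B k).

Lemma phi_X j : phi 'X_j = pkm F (B o0 j) + pkm F (B o1 j) * 'X + pkm F (B o2 j) * 'X%:P.
Proof. by rewrite /phi /chg gevX sum3 y30 y31 y32 mulr1. Qed.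

Lemma phi_dir1 f : phi (dir (b o1) f) = dX (phi f).
Proof.
elim/mpoly_gen_ind: f => [c|i|p q hp hq|p q hp hq].
- by rewrite dirC rmorph0 phiC dXC.
- by rewrite dirX phiC phi_X !dXD !dXM !dXC dXX !mul0r mulr0 mulr1 !addr0 !add0r.
- by rewrite dirD !rmorphD dXD hp hq.
- by rewrite dirM rmorphD !rmorphM dXM hp hq.
Qed.
Lemma phi_dir2 f : phi (dir (b o2) f) = dY (phi f).
Proof.
have dYk c : dY (pkm F c) = 0 by rewrite dYC derivC polyC0.
elim/mpoly_gen_ind: f => [c|i|p q hp hq|p q hp hq].
- by rewrite dirC rmorph0 phiC dYk.
- rewrite dirX phiC phi_X !dYD !dYM !dYk dYX dYC derivX polyC1.
  by rewrite !mul0r !mulr0 mulr1 !addr0 !add0r.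
- by rewrite dirD !rmorphD dYD hp hq.
- by rewrite dirM rmorphD !rmorphM dYM hp hq.
Qed.

Lemma euler_basis d f : f \is d.-homog ->
  Lf B o0 * dir (b o0) f + Lf B o1 * dir (b o1) f + Lf B o2 * dir (b o2) f = d%:R * f.
Proof.
move=> /euler <-; rewrite -(sum3 (fun k => Lf B k * dir (b k) f)).
under [RHS]eq_bigr => j _ do rewrite (X_L uB) big_distrl.
rewrite [RHS]exchange_big; apply: eq_bigr => k _ /=.
by rewrite /dir big_distrr; apply: eq_bigr => j _ /=; rewrite -scalerAl -scalerAr.
Qed.

Lemma basis_dual u : (forall j, u j = (\sum_i u i * invmx B i o0) * B o0 j
  + (\sum_i u i * invmx B i o1) * B o1 j + (\sum_i u i * invmx B i o2) * B o2 j).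
Proof.
move=> j; rewrite -(sum3 (fun k => (\sum_i u i * invmx B i k) * B k j)).
under eq_bigr => k _ do rewrite big_distrl /=.
rewrite exchange_big /= (bigD1 j) //= [X in _ = _ + X]big1 ?addr0 => [|l ne].
  under eq_bigr do rewrite -mulrA.
  rewrite -big_distrr /=; have /matrixP/(_ j j) := mulVmx uB.
  by rewrite !mxE eqxx => ->; rewrite mulr1.
under eq_bigr do rewrite -mulrA.
rewrite -big_distrr /=; have /matrixP/(_ l j) := mulVmx uB.
by rewrite !mxE (negPf ne) => ->; rewrite mulr0.
Qed.

Lemma dual_basis k l : \sum_i B l i * invmx B i k = (l == k)%:R.
Proof. by have /matrixP/(_ l k) := mulmxV uB; rewrite !mxE. Qed.

Lemma homogs2 d u w f : f \is d.+1.-homog -> homogs [:: dir u f; dir w f].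
Proof. by move=> hf [|[|k]] //= _; exists d; apply: dir_homog. Qed.

(** A chart enters only through its plane of directions, here turned about [b o1]. If t has a
    component al along the base point, Euler's formula eliminates the derivative in that direction;
    up to the factor al and modulo g_x this leaves the generator of [mu_chart] with d the degree of
    f and c = -ga/al. *)
Lemma mu_change d f (al be ga : F) t n : f \is d.+1.-homog -> f.@[b o0] = 0 ->
  (forall j, t j = al * b o0 j + be * b o1 j + ga * b o2 j) -> ga != 0 ->
  sdim [:: dir (b o1) f; dir (b o2) f] (b o0) n ->
  sdim [:: dir (b o1) f; dir t f] (b o0) n.
Proof.
move=> hf f0 tE ga0; rewrite !(sdim_codim uB) /=; try exact: homogs2 hf.
set g := phi f; rewrite phi_dir1 phi_dir2 => cn.
have g0 : ev0m F g = 0 by rewrite ev_phi f0.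
pose eul : Pl := phi (dir (b o0) f).
have eulE : eul = pkm F d.+1%:R * g - 'X * dX g - 'X%:P * dY g.
  have := congr1 phi (euler_basis hf); rewrite !rmorphD !rmorphM phi_L0 // phi_L1 // phi_L2 //.
  by rewrite phi_dir1 phi_dir2 mul1r !rmorph_nat -/eul -/g => <-; ring.
have phit : phi (dir t f) = pkm F al * eul + pkm F be * dX g + pkm F ga * dY g.
  by rewrite (dir_lin _ tE) !rmorphD !phiZ phi_dir1 phi_dir2.
have [al0|al0] := eqVneq al 0.
  apply: codim_eq cn; apply: loc_ext => -[|[|k]] //= _; try exact: loc_gen0.
    apply: (@loc_unit _ _ _ _ (pkm F ga)); first by rewrite ev0k.
    have -> : pkm F ga * dY g = phi (dir t f) - pkm F be * dX g.
      by rewrite phit al0 rmorph0; ring.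
    by apply: locB; [apply: loc_gen1|apply: locM; apply: loc_gen0].
  rewrite phit al0 rmorph0 mul0r add0r.
  by apply: locD; apply: locM; [apply: loc_gen0|apply: loc_gen1].
pose c := - ga / al.
have c0 : c != 0 by rewrite mulf_neq0 ?invr_eq0 // oppr_eq0.
have := mu_chart char0 d.+1%:R g0 c0 cn; apply: codim_eq.
set s2 := _ - _ * dY g.
have phit' : phi (dir t f) = pkm F al * s2 + (pkm F be - pkm F al * 'X) * dX g.
  have gaE : pkm F ga = - (pkm F al * pkm F c).
    by rewrite -rmorphM -rmorphN /c mulrCA divff // mulr1 opprK.
  by rewrite phit eulE /s2 gaE; ring.
apply: loc_ext => -[|[|k]] //= _; try exact: loc_gen0.
  apply: (@loc_unit _ _ _ _ (pkm F al)); first by rewrite ev0k.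
  have -> : pkm F al * s2 = phi (dir t f) - (pkm F be - pkm F al * 'X) * dX g.
    by rewrite phit' addrK.
  by apply: locB; [apply: loc_gen1|apply: locM; apply: loc_gen0].
by rewrite phit'; apply: locD; apply: locM; [apply: loc_gen1|apply: loc_gen0].
Qed.
End Basis.

Lemma sloc_span2 v f (u1 u2 w1 w2 : 'I_3 -> F) :
  (exists a b, forall j, u1 j = a * w1 j + b * w2 j) ->
  (exists a b, forall j, u2 j = a * w1 j + b * w2 j) ->
  forall k, (k < 2)%N -> sloc v [:: dir w1 f; dir w2 f] [:: dir u1 f; dir u2 f]`_k.
Proof.
have sub u : (exists a b, forall j, u j = a * w1 j + b * w2 j) ->
    sloc v [:: dir w1 f; dir w2 f] (dir u f).
  move=> [a [b uE]].
  rewrite (@dir_lin a b 0 w1 w2 w1 u) => [|j]; last by rewrite mul0r addr0.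
  rewrite scale0r addr0 -!mul_mpolyC.
  by apply: locD; apply: locM; [apply: loc_gen0|apply: loc_gen1].
by move=> h1 h2 [|[|k]] //= _; apply: sub.
Qed.

Lemma sdim_span2 v f n (u1 u2 w1 w2 : 'I_3 -> F) :
  (exists a b, forall j, u1 j = a * w1 j + b * w2 j) ->
  (exists a b, forall j, u2 j = a * w1 j + b * w2 j) ->
  (exists a b, forall j, w1 j = a * u1 j + b * u2 j) ->
  (exists a b, forall j, w2 j = a * u1 j + b * u2 j) ->
  sdim [:: dir u1 f; dir u2 f] v n -> sdim [:: dir w1 f; dir w2 f] v n.
Proof.
by move=> *; apply: sdim_eq; last eassumption; apply: loc_ext; apply: sloc_span2.
Qed.

Definition e_vec (i : 'I_3) : 'I_3 -> F := fun j => (j == i)%:R.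
Lemma dir_e i f : dir (e_vec i) f = mderiv i f.
Proof.
rewrite /dir (bigD1 i) //= /e_vec eqxx scale1r big1 ?addr0 // => j ne.
by rewrite (negPf ne) scale0r.
Qed.

End CanonicalChart.

Section Canonical.
Variable F : closedFieldType.
Hypothesis char0 : forall n, n.+1%:R != 0 :> F.
Local Notation S := {mpoly F[3]}.
Variables (v w1 w2 : 'I_3 -> F).
Local Notation B := (basis_mx v w1 w2).
Hypothesis uB : B \in unitmx.

Lemma ord3_uniqP (i j k : 'I_3) : uniq [:: i; j; k] ->
  forall P : 'I_3 -> Prop, P i -> P j -> P k -> forall m, P m.
Proof.
move=> u P hi hj hk m.
have : m \in [:: i; j; k].
  have := uniq_min_size u (s2 := enum 'I_3) (fun x _ => mem_enum _ x).
  by rewrite size_enum_ord => /(_ isT)[_ ->]; rewrite mem_enum.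
by rewrite !inE => /or3P[] /eqP ->.
Qed.

Lemma sum3_uniq (i j k : 'I_3) (g : 'I_3 -> F) : uniq [:: i; j; k] ->
  \sum_m g m = g i + g j + g k.
Proof.
move=> u; rewrite (bigD1 i) // (bigD1 j) /=; last by move: u; rewrite /= !inE eq_sym; case: (j == i).
rewrite (bigD1 k) /=; last by move: u; rewrite /= !inE negb_or (eq_sym k i) (eq_sym k j) => /and3P[/andP[_ ->] ->].
rewrite big1 ?addr0 ?addrA // => m.
by move: m; apply: (ord3_uniqP u); rewrite eqxx ?andbF.
Qed.

(** The coefficients of the linear form that is 1 at v and whose kernel is the plane spanned by w1
    and w2. *)
Definition lam m := invmx B m o0.
Lemma lam_v : \sum_m v m * lam m = 1.
Proof. by rewrite -[RHS](dual_basis uB o0 o0); apply: eq_bigr => m _; rewrite mxE. Qed.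
Lemma lam_w1 : \sum_m w1 m * lam m = 0.
Proof.
transitivity (\sum_m B o1 m * invmx B m o0); last exact: (dual_basis uB o0 o1).
by apply: eq_bigr => m _; rewrite [B o1 m]mxE.
Qed.
Lemma lam_w2 : \sum_m w2 m * lam m = 0.
Proof.
transitivity (\sum_m B o2 m * invmx B m o0); last exact: (dual_basis uB o0 o2).
by apply: eq_bigr => m _; rewrite [B o2 m]mxE.
Qed.

Lemma ker_lam (u : 'I_3 -> F) : \sum_m u m * lam m = 0 ->
  exists a b, forall m, u m = a * w1 m + b * w2 m.
Proof.
move=> u0; exists (\sum_i u i * invmx B i o1), (\sum_i u i * invmx B i o2) => m.
by rewrite (basis_dual uB u m) u0 mul0r add0r !mxE.
Qed.

Lemma e_vecE i j : e_vec F i j = if j == i then 1 else 0.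
Proof. by rewrite /e_vec; case: eqP. Qed.

(** The planes spanned by e_j, e_k and by w1, w2 share the direction q, and q, r span the kernel of
    [lam] because lam k is nonzero. So e_j is replaced by q, then e_k by r through [mu_change], and
    finally q, r by w1, w2. *)
Lemma mu_canonical_aux d f (i j k : 'I_3) n : uniq [:: i; j; k] -> lam k != 0 ->
  f \is d.+1.-homog -> f.@[v] = 0 -> v i != 0 ->
  sdim [:: dir (e_vec F j) f; dir (e_vec F k) f] v n -> sdim [:: dir w1 f; dir w2 f] v n.
Proof.
move=> u lk hf f0 vi hs.
have ijk := ord3_uniqP u.
have [ij [ik jk]] : i != j /\ i != k /\ j != k.
  by move: u; rewrite /= !inE negb_or => /and3P[/andP[-> ->] ->].
pose q m := lam k * e_vec F j m - lam j * e_vec F k m.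
pose r m := lam k * e_vec F i m - lam i * e_vec F k m.
have eE := (e_vecE, eqxx, negPf ij, negPf ik, negPf jk, eq_sym j i, eq_sym k i, eq_sym k j).
have lv : v i * lam i + v j * lam j + v k * lam k = 1 by rewrite -(sum3_uniq (fun m => v m * lam m) u) lam_v.
have [qi qj qk] : [/\ q i = 0, q j = lam k & q k = - lam j].
  by rewrite /q !eE /=; split; ring.
have [ri rj rk] : [/\ r i = lam k, r j = 0 & r k = - lam i].
  by rewrite /r !eE /=; split; ring.
have {}hs : sdim [:: dir q f; dir (e_vec F k) f] v n.
  apply: sdim_span2 hs.
  - by exists (lam k)^-1, (lam j / lam k) => m; rewrite /q; field.
  - by exists 0, 1 => m; ring.
  - by exists (lam k), (- lam j) => m; rewrite /q; ring.
  - by exists 0, 1 => m; ring.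
have uB1 : basis_mx v q (e_vec F k) \in unitmx.
  apply: basis_mx_unit => a b c h.
  have hi := h i; have hj := h j; have hk := h k.
  rewrite qi qj qk !eE /= in hi hj hk.
  have a0 : a = 0.
    by move/eqP: hi; rewrite !mulr0 !addr0 mulf_eq0 (negPf vi) orbF => /eqP.
  have b0 : b = 0.
    by move/eqP: hj; rewrite a0 mul0r add0r mulr0 addr0 mulf_eq0 (negPf lk) orbF => /eqP.
  by split=> //; rewrite -hk a0 b0; ring.
(* The coordinates of r in the basis v, q, e_k, found by comparing the entries at i, j and k; the
   last one uses lam(v) = 1. *)
have := @mu_change F char0 _ uB1 d f (lam k / v i) (- v j / v i) (- (v i)^-1) r n hf.
rewrite basis_mx0 basis_mx1 basis_mx2 => /(_ f0).
have rE m : r m = lam k / v i * v m + - v j / v i * q m + - (v i)^-1 * e_vec F k m.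
  move: m; apply: ijk; rewrite ?qi ?qj ?qk ?ri ?rj ?rk !eE /=.
  - by field.
  - by field.
  - have -> : lam i = (1 - v j * lam j - v k * lam k) / v i by rewrite -lv; field.
    by field.
rewrite oppr_eq0 invr_eq0 vi => /(_ rE isT hs) {}hs.
apply: sdim_span2 hs.
- apply: ker_lam; rewrite (sum3_uniq _ u) qi qj qk; ring.
- apply: ker_lam; rewrite (sum3_uniq _ u) ri rj rk; ring.
- exists (w1 j / lam k), (w1 i / lam k) => m.
  have := lam_w1; rewrite (sum3_uniq _ u) => E.
  move: m; apply: ijk; rewrite ?qi ?qj ?qk ?ri ?rj ?rk; try by field.
  apply: (mulIf lk); have -> : w1 k * lam k = - (w1 i * lam i + w1 j * lam j).
    by apply/eqP; rewrite -addr_eq0 addrC E.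
  by field.
- exists (w2 j / lam k), (w2 i / lam k) => m.
  have := lam_w2; rewrite (sum3_uniq _ u) => E.
  move: m; apply: ijk; rewrite ?qi ?qj ?qk ?ri ?rj ?rk; try by field.
  apply: (mulIf lk); have -> : w2 k * lam k = - (w2 i * lam i + w2 j * lam j).
    by apply/eqP; rewrite -addr_eq0 addrC E.
  by field.
Qed.

Lemma sdim_swap f (x y : 'I_3 -> F) n : sdim [:: dir x f; dir y f] v n -> sdim [:: dir y f; dir x f] v n.
Proof.
apply: sdim_span2.
- by exists 0, 1 => m; ring.
- by exists 1, 0 => m; ring.
- by exists 0, 1 => m; ring.
- by exists 1, 0 => m; ring.
Qed.

(** If [lam] vanishes on both e_j and e_k the two planes of directions coincide; otherwise the
    auxiliary lemma applies, possibly with j and k exchanged. *)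
Lemma mu_canonical d f (i j k : 'I_3) n : uniq [:: i; j; k] ->
  f \is d.+1.-homog -> f.@[v] = 0 -> v i != 0 ->
  sdim [:: mderiv j f; mderiv k f] v n -> sdim [:: dir w1 f; dir w2 f] v n.
Proof.
rewrite -!dir_e => u hf f0 vi hs.
have [lk|lk] := eqVneq (lam k) 0; last exact: mu_canonical_aux u lk hf f0 vi hs.
have [lj|lj] := eqVneq (lam j) 0; last first.
  apply: (mu_canonical_aux (i := i) (j := k) (k := j)) hf f0 vi (sdim_swap hs) => //.
  by move: u; rewrite /= !inE !negb_or (eq_sym k j) !andbT => /andP[/andP[-> ->] ->].
have ijk := ord3_uniqP u.
have [ij [ik jk]] : i != j /\ i != k /\ j != k.
  by move: u; rewrite /= !inE negb_or => /and3P[/andP[-> ->] ->].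
have eE := (e_vecE, eqxx, negPf ij, negPf ik, negPf jk, eq_sym j i, eq_sym k i, eq_sym k j).
have li : lam i != 0.
  apply/eqP => li; have := lam_v; rewrite (sum3_uniq _ u) li lj lk !mulr0 !addr0 => /esym/eqP.
  by rewrite oner_eq0.
have wi (w : 'I_3 -> F) : \sum_m w m * lam m = 0 -> exists a b, forall m, w m = a * e_vec F j m + b * e_vec F k m.
  rewrite (sum3_uniq _ u) lj lk !mulr0 !addr0 => /eqP; rewrite mulf_eq0 (negPf li) orbF => /eqP w0.
  by exists (w j), (w k); apply: ijk; rewrite !eE ?w0 /=; ring.
apply: sdim_span2 hs.
- by apply: ker_lam; rewrite (sum3_uniq _ u) lj lk !eE /=; ring.
- by apply: ker_lam; rewrite (sum3_uniq _ u) lj lk !eE /=; ring.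
- exact/wi/lam_w1.
- exact/wi/lam_w2.
Qed.

(** Once f itself is in the ideal, Euler's formula puts the derivative along the base point there
    too, after division by a coordinate that is nonzero at the point. Either ideal thus contains f
    and all its derivatives. *)
Lemma tau_canonical d f (i j k : 'I_3) n : uniq [:: i; j; k] -> f \is d.-homog -> v i != 0 ->
  sdim [:: f; mderiv j f; mderiv k f] v n -> sdim [:: f; dir w1 f; dir w2 f] v n.
Proof.
move=> u hf vi; apply: sdim_eq; apply: loc_ext.
  have sub a : sloc v [:: f; dir w1 f; dir w2 f] (dir a f).
    have sv : sloc v [:: f; dir w1 f; dir w2 f] (dir v f).
      have := euler_basis uB hf; rewrite basis_mx0 basis_mx1 basis_mx2 => E.
      apply: (@loc_unit _ _ _ _ (Lf B o0)).
        by rewrite /evS -meval_gev -[X in _.@[X]](basis_mx0 v w1 w2) -ev_phi // phi_L0 // rmorph1 oner_neq0.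
      have -> : Lf B o0 * dir v f = d%:R * f - Lf B o1 * dir w1 f - Lf B o2 * dir w2 f.
        by rewrite -E; ring.
      by apply: locB; [apply: locB|]; apply: locM; [apply: loc_gen0|apply: loc_gen1|apply: loc_gen2].
    have aE m : a m = (\sum_i a i * invmx B i o0) * v m + (\sum_i a i * invmx B i o1) * w1 m
        + (\sum_i a i * invmx B i o2) * w2 m by rewrite {1}(basis_dual uB a m) !mxE.
    rewrite (dir_lin _ aE) -!mul_mpolyC.
    apply: locD; last by apply: locM; apply: loc_gen2.
    by apply: locD; apply: locM; [exact: sv|apply: loc_gen1].
  by rewrite -!dir_e => -[|[|[|m]]] //= _; [apply: loc_gen0|apply: sub|apply: sub].
have part m : sloc v [:: f; mderiv j f; mderiv k f] (mderiv m f).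
  move: m; apply: (ord3_uniqP u); [|exact: loc_gen1|exact: loc_gen2].
  apply: (@loc_unit _ _ _ _ 'X_i); first by rewrite /evS gevX.
  have := euler hf; rewrite (bigD1 i) // (bigD1 j) /=; last by move: u; rewrite /= !inE eq_sym; case: (j == i).
  rewrite (bigD1 k) /=; last by move: u; rewrite /= !inE negb_or (eq_sym k i) (eq_sym k j) => /and3P[/andP[_ ->] ->].
  rewrite big1 ?addr0 => [|m].
    move=> E; have -> : 'X_i * mderiv i f = d%:R * f - 'X_j * mderiv j f - 'X_k * mderiv k f.
      by rewrite -E; ring.
    by apply: locB; [apply: locB|]; apply: locM; [apply: loc_gen0|apply: loc_gen1|apply: loc_gen2].
  by move: m; apply: (ord3_uniqP u); rewrite eqxx ?andbF.
have sub a : sloc v [:: f; mderiv j f; mderiv k f] (dir a f).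
  by apply: loc_sum => m; rewrite -mul_mpolyC; apply: locM; apply: part.
by move=> [|[|[|m]]] //= _; [apply: loc_gen0|apply: sub|apply: sub].
Qed.
End Canonical.

(** * Restriction of forms to the line *)

Section Line.
Variable F : fieldType.
Local Notation S := {mpoly F[3]}.
Local Notation Pl := {poly {poly F}}.

Lemma pihomog_mul d e (a p : S) : a \is d.-homog ->
  pihomog mdeg (d + e) (a * p) = a * pihomog mdeg e p.
Proof.
move=> ha; elim/mpolyind: p => [|c m p _ _ IH]; first by rewrite mulr0 !raddf0 mulr0.
rewrite mulrDr !pihomogD IH mulrDr; congr (_ + _).
have hX : a * (c *: 'X_[m]) \is (d + mdeg m).-homog.
  by apply: dhomogM => //; apply: rpredZ; rewrite dhomogX.
have hX' : (c *: 'X_[m] : S) \is (mdeg m).-homog by apply: rpredZ; rewrite dhomogX.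
have [<-|ne] := eqVneq (mdeg m) e; first by rewrite !pihomog_dE.
by rewrite (pihomog_ne0 _ hX) ?eqn_add2l // (pihomog_ne0 ne hX') mulr0.
Qed.

Lemma homog0_const (p : S) : p \is 0.-homog -> p = (p@_0%MM)%:MP.
Proof.
move=> /dhomogP hp; apply/mpolyP => m; rewrite mcoeffC.
case: eqP => [->|/eqP ne]; first by rewrite mulr1.
rewrite mulr0; apply/eqP; rewrite mcoeff_eq0; apply/negP => /hp dm.
by have := mdeg_eq0 m; rewrite [mdeg m]dm eqxx (negPf ne).
Qed.

Lemma dhomog_div e (a p G : S) : a \is 1.-homog -> p = a * G -> p \is e.+1.-homog ->
  exists2 H, H \is e.-homog & p = a * H.
Proof.
move=> ha pE hp; exists (pihomog mdeg e G); first exact: pihomogP.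
by rewrite -(pihomog_mul e G ha) -pE add1n pihomog_dE.
Qed.

Variable B : 'M[F]_3.
Hypothesis uB : B \in unitmx.
Local Notation a := (Lf B o2).
Local Notation p0 := (row_pt B o0).
Local Notation pinf := (row_pt B o1).

(* The parametrization p0 + Z pinf of the line a = 0. *)
Definition rho : {rmorphism S -> {poly F}} := chg B (@polyC F) (y3 1 'X 0).

Lemma rho_L0 : rho (Lf B o0) = 1. Proof. exact: chg_L. Qed.
Lemma rho_L1 : rho (Lf B o1) = 'X. Proof. exact: chg_L. Qed.
Lemma rho_a : rho a = 0. Proof. exact: chg_L. Qed.
Lemma rhoC c : rho c%:MP = c%:P. Proof. exact: gevC. Qed.
Lemma rhoZ c p : rho (c *: p) = c *: rho p.
Proof. by rewrite -mul_mpolyC rmorphM rhoC mul_polyC. Qed.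

(** Composition with the projection onto the line along the third basis vector. Its kernel is the
    ideal of [a], which reduces divisibility by [a] to vanishing in a domain. *)
Definition sig : {rmorphism S -> S} := gev (@mC F) (fun j => 'X_j - a * (B o2 j)%:MP).

Lemma sig_a : sig a = 0.
Proof.
rewrite {1}/Lf rmorph_sum.
have sigZ c p : sig (c *: p) = c *: sig p by rewrite -!mul_mpolyC rmorphM [sig _%:MP]gevC.
under eq_bigr => j _ do rewrite sigZ [sig 'X_j]gevX scalerBr.
rewrite sumrB -/(Lf B o2).
have -> : \sum_(i < 3) invmx B i o2 *: (a * (B o2 i)%:MP) = (\sum_i B o2 i * invmx B i o2) *: a.
  rewrite scaler_suml; apply: eq_bigr => i _.
  by rewrite [a * _]mulrC mul_mpolyC scalerA mulrC.
have /matrixP/(_ o2 o2) := mulmxV uB; rewrite !mxE eqxx => ->.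
by rewrite scale1r subrr.
Qed.

Lemma sig_eq0 p : sig p = 0 <-> exists r, p = a * r.
Proof.
split=> [s0|[r ->]]; last by rewrite rmorphM sig_a mul0r.
have [j|r rE] := @gev_cong F S (@mC F) a (fun i => 'X_i) (fun j => 'X_j - a * (B o2 j)%:MP) _ p.
  by exists (B o2 j)%:MP; rewrite subrK.
by exists r; rewrite -[LHS](gev_id p) rE -/sig [X in X + _]s0 add0r.
Qed.

Lemma a_prime p q : (exists r, p * q = a * r) -> (exists r, p = a * r) \/ (exists r, q = a * r).
Proof.
move=> /sig_eq0; rewrite rmorphM => /eqP; rewrite mulf_eq0 => /orP[] /eqP /sig_eq0; by [left|right].
Qed.

(** For a form p of degree e, sig(p) is L0^e times the value of rho(p) at L1/L0 in the fraction
    field; so the affine parametrization loses nothing. *)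
Lemma rho_ker e p : p \is e.-homog -> rho p = 0 -> exists r, p = a * r.
Proof.
move=> hp r0; apply/sig_eq0.
have L0 : FracField.tofrac (Lf B o0) != 0 by rewrite tofrac_eq0 Lf_neq0.
pose tf : {rmorphism S -> {fraction S}} := @FracField.tofrac S.
pose Z := tf (Lf B o1) / tf (Lf B o0).
pose Psi : {rmorphism {poly F} -> {fraction S}} := horner_eval Z \o map_poly (kfrac F).
have PsiC c : Psi c%:P = kfrac F c by rewrite /= map_polyC /horner_eval hornerC.
have : Psi (rho p) = 0 by rewrite r0 rmorph0.
rewrite (@gev_comp F _ _ (@polyC F) (kfrac F) Psi) //.
rewrite (@eq_gev _ _ _ _ (fun j => (tf (Lf B o0))^-1 * tf ('X_j - a * (B o2 j)%:MP))) => [|j]; last first.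
  rewrite /comp sum3 y30 y31 y32 mulr0 addr0 mulr1 rmorphD rmorphM !PsiC.
  have -> : Psi 'X = Z by rewrite /= map_polyX /horner_eval hornerX.
  rewrite rmorphB [tf 'X_j](Xfrac uB) rmorphM /Z.
  have -> : tf (B o2 j)%:MP = kfrac F (B o2 j) by [].
  have E (K : fieldType) (b0 b1 b2 x0 x1 x2 : K) : x0 != 0 ->
    b0 + b1 * (x1 / x0) = x0^-1 * (b0 * x0 + b1 * x1 + b2 * x2 - x2 * b2) by move=> ?; field.
  exact: E.
rewrite (gev_homog _ _ _ hp) => /eqP; rewrite mulf_eq0 expf_eq0 invr_eq0 (negPf L0) andbF /=.
rewrite -(@gev_comp F S _ (@mC F) (kfrac F) tf) // tofrac_eq0 => /eqP; exact.
Qed.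

Lemma dvd_homog e p : p \is e.+1.-homog -> rho p = 0 -> exists2 H, H \is e.-homog & p = a * H.
Proof. by move=> hp /(rho_ker hp)[r rE]; apply: dhomog_div rE hp; apply: Lf_homog. Qed.

Lemma rho_homog0 p : p \is 0.-homog -> rho p = 0 -> p = 0.
Proof.
move=> /homog0_const ->; rewrite rhoC => /eqP; rewrite polyC_eq0 => /eqP ->.
by rewrite mpolyC0.
Qed.

Definition top_coef n (p : {poly F}) c := (size p <= n.+1)%N /\ p`_n = c.

Lemma top_coefM n m p q c c' : top_coef n p c -> top_coef m q c' -> top_coef (n + m) (p * q) (c * c').
Proof.
move=> [sp pc] [sq qc]; split.
  by apply: leq_trans (size_polyMleq _ _) _; move: sp sq; lia.
rewrite coefM (bigD1 (inord n)) //= inordK ?ltnS ?leq_addr // addKn pc qc big1 ?addr0 // => i.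
rewrite -val_eqE /= inordK ?ltnS ?leq_addr // => ne.
have [lt|gt|eq] := ltngtP i n; last by rewrite eq eqxx in ne.
  by rewrite [q`__]nth_default ?mulr0 // (leq_trans sq) //; move: lt; have := ltn_ord i; lia.
by rewrite nth_default ?mul0r // (leq_trans sp).
Qed.

(** [pinf] is the point at infinity of the parametrization, so the restriction of a form keeps its
    full degree when the form is nonzero there. *)
Lemma rho_top e H : H \is e.-homog -> top_coef e (rho H) (H.@[pinf]).
Proof.
move=> /dhomogP hH; rewrite mevalE /= /mmap !big_seq.
apply: (big_ind2 (fun p c => top_coef e p c)) => [|p c q c' [sp pc] [sq qc]|m hm].
- by split; rewrite ?size_poly0 ?coef0.
- split; last by rewrite coefD pc qc.
  by apply: leq_trans (size_polyD _ _) _; rewrite geq_max sp sq.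
have hC : top_coef 0 (H@_m)%:P H@_m by split; rewrite ?size_polyC_leq1 ?coefC.
rewrite -[e]add0n; apply: top_coefM => //.
have <- : mdeg m = e := hH _ hm.
rewrite mdegE /mmap1; elim/big_rec3: _ => [|i n p c _ IH].
  by split; rewrite ?size_poly1 ?coef1.
apply: top_coefM => //; elim: (m i) => [|k IHk].
  by rewrite !expr0; split; rewrite ?size_poly1 ?coef1.
rewrite !exprS -[k.+1]add1n; apply: top_coefM => //.
rewrite sum3 y30 y31 y32 mulr0 addr0 mulr1; split.
  apply: leq_trans (size_polyD _ _) _; rewrite geq_max (leq_trans (size_polyC_leq1 _)) //=.
  by apply: leq_trans (size_polyMleq _ _) _; rewrite size_polyX addn2 /= ltnS size_polyC_leq1.
by rewrite coefD coefC add0r coefCM coefX mulr1.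
Qed.

Lemma rho_lift e (h : {poly F}) : (size h <= e.+1)%N -> exists2 H, H \is e.-homog & rho H = h.
Proof.
move=> sh.
have hL k n : Lf B k ^+ n \is n.-homog.
  by rewrite -[X in X.-homog]mul1n; apply: dhomogMn; apply: Lf_homog.
exists (\sum_(j < e.+1) h`_j *: (Lf B o0 ^+ (e - j) * Lf B o1 ^+ j)).
  apply: rpred_sum => j _; apply: rpredZ.
  have le : (j <= e)%N by rewrite -ltnS.
  have := dhomogM (hL o0 (e - j)%N) (hL o1 j); rewrite subnK //.
have hE : h = \poly_(j < e.+1) h`_j.
  by apply/polyP => i; rewrite coef_poly; case: ltnP => // le; rewrite nth_default // (leq_trans sh).
rewrite rmorph_sum [RHS]hE poly_def; apply: eq_bigr => j _.
by rewrite rhoZ rmorphM !rmorphXn rho_L0 rho_L1 expr1n mul1r.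
Qed.
End Line.

(** * Derivations along the line *)

Section Derivations.
Variable F : closedFieldType.
Local Notation S := {mpoly F[3]}.
Implicit Types (th : 'I_3 -> S).

Definition der th (f : S) : S := \sum_(i < 3) th i * mderiv i f.

Lemma derM th p q : der th (p * q) = der th p * q + p * der th q.
Proof.
rewrite /der big_distrl big_distrr -big_split; apply: eq_bigr => j _ /=.
by rewrite mderivM; ring.
Qed.
Lemma der_homog d e th p : (forall j, th j \is e.-homog) -> p \is d.+1.-homog ->
  der th p \is (e + d).-homog.
Proof.
by move=> ht hp; apply: rpred_sum => j _; apply: dhomogM => //; apply: mderiv_homog.
Qed.
Lemma der_lin (c1 c2 : S) th1 th2 th p : (forall j, th j = c1 * th1 j + c2 * th2 j) ->
  der th p = c1 * der th1 p + c2 * der th2 p.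
Proof.
move=> h; rewrite /der !big_distrr -big_split; apply: eq_bigr => j _ /=.
by rewrite h; ring.
Qed.
Lemma der_euler d p : p \is d.-homog -> der (fun j => 'X_j) p = d%:R * p.
Proof. exact: euler. Qed.

Section Basis.
Variable B : 'M[F]_3.
Hypothesis uB : B \in unitmx.

(** The component of th along the basis vector k, which is also th(L_k) by [der_L]. *)
Definition cf k th : S := \sum_(j < 3) invmx B j k *: th j.
Definition wedge th : S := Lf B o0 * cf o1 th - Lf B o1 * cf o0 th.

Lemma cf_homog e k th : (forall j, th j \is e.-homog) -> cf k th \is e.-homog.
Proof. by move=> h; apply: rpred_sum => j _; apply: rpredZ. Qed.
Lemma wedge_homog e th : (forall j, th j \is e.-homog) -> wedge th \is e.+1.-homog.
Proof.
by move=> h; rewrite -[e.+1]add1n; apply: rpredB; apply: dhomogM; rewrite ?Lf_homog ?cf_homog.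
Qed.
Lemma cf_lin (c1 c2 : S) th1 th2 th k : (forall j, th j = c1 * th1 j + c2 * th2 j) ->
  cf k th = c1 * cf k th1 + c2 * cf k th2.
Proof.
move=> h; rewrite /cf !big_distrr -big_split; apply: eq_bigr => j _ /=.
by rewrite h scalerDr !scalerAr.
Qed.
Lemma wedge_lin (c1 c2 : S) th1 th2 th : (forall j, th j = c1 * th1 j + c2 * th2 j) ->
  wedge th = c1 * wedge th1 + c2 * wedge th2.
Proof. by move=> h; rewrite /wedge !(cf_lin _ h); ring. Qed.
Lemma cf_euler k : cf k (fun j => 'X_j) = Lf B k. Proof. by []. Qed.
Lemma wedge_euler : wedge (fun j => 'X_j) = 0.
Proof. by rewrite /wedge !cf_euler; ring. Qed.

Lemma cf_vec k l (c : S) : cf k (fun j => B l j *: c) = (l == k)%:R *: c.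
Proof.
rewrite -(dual_basis uB k l) scaler_suml; apply: eq_bigr => j _.
by rewrite scalerA mulrC.
Qed.

Lemma der_L th k : der th (Lf B k) = cf k th.
Proof.
rewrite /der /cf; apply: eq_bigr => j _.
rewrite /Lf linear_sum /= (bigD1 j) //= mderivZ mderivXU eqxx big1 ?addr0 => [|l ne].
  by rewrite -scalerAr mulr1.
by rewrite mderivZ mderivXU (negPf ne) scaler0.
Qed.

Lemma th_cf th j : th j = \sum_(k < 3) B k j *: cf k th.
Proof.
rewrite /cf; under eq_bigr do rewrite scaler_sumr.
rewrite exchange_big /= (bigD1 j) //= [X in _ + X]big1 ?addr0 => [|l ne].
  under eq_bigr do rewrite scalerA mulrC.
  rewrite -scaler_suml; have /matrixP/(_ j j) := mulVmx uB.
  by rewrite !mxE eqxx => ->; rewrite scale1r.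
under eq_bigr do rewrite scalerA mulrC.
rewrite -scaler_suml; have /matrixP/(_ l j) := mulVmx uB.
by rewrite !mxE (negPf ne) => ->; rewrite scale0r.
Qed.

Lemma der_basis th p : der th p = \sum_(k < 3) cf k th * dir (row_pt B k) p.
Proof.
rewrite /der; under eq_bigr => j _ do rewrite (th_cf th j) big_distrl.
rewrite exchange_big; apply: eq_bigr => k _; rewrite /dir big_distrr.
by apply: eq_bigr => j _ /=; rewrite -scalerAl scalerAr.
Qed.

Lemma invmx_col k (c : 'I_3 -> F) : (forall l, \sum_j B l j * c j = (l == k)%:R) ->
  forall j, invmx B j k = c j.
Proof.
move=> h j; pose C : 'cV[F]_3 := \col_j c j.
have E : B *m C = \col_l (l == k)%:R.
  by apply/matrixP => l x; rewrite !mxE -h; apply: eq_bigr => i _; rewrite mxE.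
have := congr1 (mulmx (invmx B)) E; rewrite mulKmx // => /matrixP/(_ j 0).
rewrite !mxE => ->; rewrite (bigD1 k) //= mxE eqxx mulr1 big1 ?addr0 // => l ne.
by rewrite mxE (negPf ne) mulr0.
Qed.

(* Multiplying by the first coordinate clears the derivative along the base point by Euler's
   formula. *)
Lemma der_wedge d th p : p \is d.-homog ->
  Lf B o0 * der th p = cf o0 th * d%:R * p + wedge th * dir (row_pt B o1) p
    + (Lf B o0 * cf o2 th - Lf B o2 * cf o0 th) * dir (row_pt B o2) p.
Proof. by move=> /(euler_basis uB) E; rewrite der_basis sum3 /wedge -mulrA -E; ring. Qed.
End Basis.
End Derivations.

(** * Charts centred at points of the line *)

Section LineCharts.
Variable F : closedFieldType.
Hypothesis char0 : forall n, n.+1%:R != 0 :> F.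
Local Notation S := {mpoly F[3]}.
Local Notation Pl := {poly {poly F}}.
Local Notation Y := ('X%:P : Pl).
Variables p0 pinf r : 'I_3 -> F.
Local Notation B0 := (basis_mx p0 pinf r).
Hypothesis uB0 : B0 \in unitmx.
Variables (al ze : F).
Hypothesis al0 : al != 0.
Let v : 'I_3 -> F := fun j => al * (p0 j + ze * pinf j).
Local Notation B := (basis_mx v pinf r).
Local Notation a := (Lf B0 o2).

(** The inverse of B: passing from p0 to v = al p0 + al ze pinf modifies only the first two forms of
    the dual basis. *)
Let C : 'M[F]_3 := \matrix_(j, k) y3 (al^-1 * invmx B0 j o0)
  (invmx B0 j o1 - ze * invmx B0 j o0) (invmx B0 j o2) k.

Let du k l : \sum_j row_pt B0 l j * invmx B0 j k = (l == k)%:R := dual_basis uB0 k l.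
Let du0 k : \sum_j p0 j * invmx B0 j k = (o0 == k)%:R.
Proof. by rewrite -(du k o0) basis_mx0. Qed.
Let du1 k : \sum_j pinf j * invmx B0 j k = (o1 == k)%:R.
Proof. by rewrite -(du k o1) basis_mx1. Qed.
Let du2 k : \sum_j r j * invmx B0 j k = (o2 == k)%:R.
Proof. by rewrite -(du k o2) basis_mx2. Qed.

Let BC : B *m C = 1%:M.
Proof.
have sumv k : \sum_j v j * invmx B0 j k = al * ((o0 == k)%:R + ze * (o1 == k)%:R).
  rewrite -du0 -du1 mulr_sumr -big_split mulr_sumr; apply: eq_bigr => j _ /=.
  by rewrite /v; ring.
have sumC (f : 'I_3 -> F) : \sum_j f j * (al^-1 * invmx B0 j o0) = al^-1 * \sum_j f j * invmx B0 j o0.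
  by rewrite mulr_sumr; apply: eq_bigr => j _; rewrite mulrCA.
have sumC1 (f : 'I_3 -> F) : \sum_j f j * (invmx B0 j o1 - ze * invmx B0 j o0) =
  \sum_j f j * invmx B0 j o1 - ze * \sum_j f j * invmx B0 j o0.
  by rewrite mulr_sumr -sumrB; apply: eq_bigr => j _; rewrite mulrBr mulrCA.
apply/matrixP => l k; rewrite !mxE.
under eq_bigr do rewrite !mxE.
move: l k; apply: ord3P; apply: ord3P;
  under eq_bigr do rewrite ?y30 ?y31 ?y32; rewrite ?sumC ?sumC1 ?sumv ?du0 ?du1 ?du2 //=;
  rewrite ?(mulr0, mulr1, addr0, add0r, subr0, mulVf) // ?subrr //.
- by rewrite mulrC subrr.
- by rewrite oppr0.
Qed.

Lemma chart_unit : B \in unitmx. Proof. by have [] := mulmx1_unit BC. Qed.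
Let invB : invmx B = C.
Proof. by rewrite -[C]mul1mx -(mulVmx chart_unit) -mulmxA BC mulmx1. Qed.

Lemma chart_cf0 (th : 'I_3 -> S) : cf B o0 th = al^-1 *: cf B0 o0 th.
Proof.
rewrite /cf invB scaler_sumr; apply: eq_bigr => j _.
by rewrite mxE y30 scalerA.
Qed.
Lemma chart_cf1 (th : 'I_3 -> S) : cf B o1 th = cf B0 o1 th - ze *: cf B0 o0 th.
Proof.
rewrite /cf invB scaler_sumr -sumrB; apply: eq_bigr => j _.
by rewrite mxE y31 scalerBl scalerA.
Qed.
Lemma chart_cf2 (th : 'I_3 -> S) : cf B o2 th = cf B0 o2 th.
Proof. by rewrite /cf invB; apply: eq_bigr => j _; rewrite mxE y32. Qed.
Lemma chart_a : Lf B o2 = a.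
Proof. exact: chart_cf2. Qed.
Lemma chart_wedge (th : 'I_3 -> S) : wedge B th = al^-1 *: wedge B0 th.
Proof.
rewrite /wedge -!cf_euler chart_cf0 !chart_cf1 chart_cf0 -!mul_mpolyC.
ring.
Qed.

(** The change of parameter: v + x pinf = al (p0 + (ze + x/al) pinf). *)
Let lin : {poly F} := al^-1 *: 'X + ze%:P.
Lemma chart_rho e H : H \is e.-homog -> rY F (phi B H) = al ^+ e *: (rho B0 H \Po lin).
Proof.
move=> hH.
pose lcomp : {rmorphism {poly F} -> {poly F}} := comp_poly lin.
rewrite -mul_polyC rmorphXn.
rewrite -[_ \Po _]/(lcomp (rho B0 H)).
rewrite (@gev_comp F _ _ (@polyC F) (@polyC F) lcomp); last first.
  by move=> c; apply: comp_polyC.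
rewrite -(gev_homog _ _ _ hH).
rewrite (@gev_comp F _ _ (pkm F) (@polyC F) (rY F)); last first.
  by move=> c; rewrite -[LHS]/(rY F (pk c)) -[pk c](map_polyC polyC) rY_outer.
apply: eq_gev => j.
have rk c : rY F (pkm F c) = c%:P.
  by rewrite -[LHS]/(rY F (pk c)) -[pk c](map_polyC polyC) rY_outer.
have rX : rY F 'X = 'X by rewrite -(map_polyX polyC) rY_outer.
rewrite /comp !sum3 !rmorphD !rmorphM !rk !y30 !y31 !y32 !rmorph1 rX rY_Y !rmorph0 !mulr0 !addr0 !mulr1.
have cC c : lcomp c%:P = c%:P by apply: comp_polyC.
have cX : lcomp 'X = lin by apply: comp_polyX.
rewrite !cC cX /lin !mxE !y30 !y31 /v !rmorphM rmorphD rmorphM -mul_polyC.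
have alV : al%:P * al^-1%:P = 1 :> {poly F} by rewrite -polyCM divff.
rewrite -[LHS]addrC; apply/eqP; rewrite -subr_eq0; apply/eqP.
transitivity (((pinf j)%:P - (al%:P * al^-1%:P) * (pinf j)%:P) * 'X : {poly F}); first by ring.
by rewrite alV mul1r subrr mul0r.
Qed.
End LineCharts.

Section TangentDerivations.
Variable F : closedFieldType.
Hypothesis char0 : forall n, n.+1%:R != 0 :> F.
Local Notation S := {mpoly F[3]}.

(** The Euler field multiplies f by its degree, so c/deg(f) times this field carries the whole
    defect c f. *)
Lemma der_eulerB e (th : 'I_3 -> S) (c f : S) : f \is e.+1.-homog -> der th f = c * f ->
  der (fun j => th j - (e.+1%:R^-1 *: c) * 'X_j) f = 0.
Proof.
move=> hfe E; have := @der_lin F 1 (- (e.+1%:R^-1 *: c)) th (fun j => 'X_j)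
  (fun j => th j - (e.+1%:R^-1 *: c) * 'X_j) f.
rewrite (der_euler hfe) E; move=> H; rewrite H => [|j]; last by ring.
have -> : e.+1%:R * f = e.+1%:R *: f by rewrite scaler_nat mulr_natl.
by rewrite mul1r mulNr -scalerAl -scalerAr scalerA mulVf ?char0 // scale1r subrr.
Qed.

Lemma wedge_eulerB (B : 'M[F]_3) (th : 'I_3 -> S) (c : S) :
  wedge B (fun j => th j - c * 'X_j) = wedge B th.
Proof.
rewrite (@wedge_lin F B 1 (- c) th (fun j => 'X_j)) => [|j]; last by ring.
by rewrite wedge_euler mulr0 addr0 mul1r.
Qed.

Variable B : 'M[F]_3.
Hypothesis uB : B \in unitmx.
Local Notation a := (Lf B o2).
Variable f' : S.
Hypothesis ff0 : rho B f' != 0.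

(** From th(f') a + f' th(a) = 0 and the primality of a, which does not divide f', the derivation
    must preserve the line; then it preserves the curve too. *)
Lemma tangent_line th : der th (f' * a) = 0 ->
  exists2 t, cf B o2 th = a * t & der th f' = - t * f'.
Proof.
rewrite derM der_L // => E.
have [|[t tE]|[t tE]] := @a_prime F B uB f' (cf B o2 th).
- by exists (- der th f'); apply/eqP; rewrite -subr_eq0 -E; apply/eqP; ring.
- by case/eqP: ff0; rewrite tE rmorphM rho_a // mul0r.
exists t => //; apply: (mulIf (Lf_neq0 uB o2)); apply/eqP.
by rewrite -subr_eq0 -E tE; apply/eqP; ring.
Qed.

End TangentDerivations.

(** * The order of W at a point as a colength *)

Section LocalOrder.
Variable F : closedFieldType.
Hypothesis char0 : forall n, n.+1%:R != 0 :> F.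
Local Notation S := {mpoly F[3]}.
Local Notation Pl := {poly {poly F}}.
Local Notation Y := ('X%:P : Pl).
Variables p0 pinf r : 'I_3 -> F.
Local Notation B0 := (basis_mx p0 pinf r).
Hypothesis uB0 : B0 \in unitmx.
Local Notation a := (Lf B0 o2).
Variables (d : nat) (f' : S).
Hypotheses (hf : f' \is d.+1.-homog) (ff0 : rho B0 f' != 0).

Variables (al ze : F) (K : nat).
Hypothesis al0 : al != 0.
Let v : 'I_3 -> F := fun j => al * (p0 j + ze * pinf j).
Local Notation B := (basis_mx v pinf r).
Local Notation phi := (phi B).
Hypothesis lower : forall e th, (forall j, th j \is e.-homog) -> der th (f' * a) = 0 ->
  ('X - ze%:P) ^+ K %| rho B0 (wedge B0 th).
Hypothesis attained : exists e th, [/\ forall j, th j \is e.-homog, der th (f' * a) = 0 &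
  exists2 q, rho B0 (wedge B0 th) = ('X - ze%:P) ^+ K * q & q.[ze] != 0].

Let uB : B \in unitmx := chart_unit uB0 ze al0.
Let aE : Lf B o2 = a := chart_a uB0 ze al0.

Let lin : {poly F} := al^-1 *: 'X + ze%:P.
Let lin_root : ('X - ze%:P) \Po lin = al^-1 *: 'X.
Proof. by rewrite comp_polyB comp_polyX comp_polyC /lin addrK. Qed.
Let wedge_rY e th : (forall j, th j \is e.-homog) -> exists2 c, c != 0 &
  rY F (phi (wedge B th)) = c *: (rho B0 (wedge B0 th) \Po lin).
Proof.
move=> hth; exists (al ^+ e.+1 * al^-1); first by rewrite mulf_neq0 ?expf_neq0 ?invr_eq0.
rewrite (chart_rho p0 pinf r ze al0 (wedge_homog B hth)) (chart_wedge uB0 ze al0) rhoZ.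
by rewrite comp_polyZ scalerA.
Qed.
Let lin_exp q : (('X - ze%:P) ^+ K * q) \Po lin = al^-1 ^+ K *: ('X^K * (q \Po lin)).
Proof.
rewrite comp_polyM -[_ ^+ K \Po _]/(comp_poly lin (_ ^+ K)) rmorphXn /=.
by rewrite lin_root exprZn scalerAl.
Qed.
Let hfa : f' * a \is d.+2.-homog.
Proof. by have := dhomogM hf (Lf_homog B0 o2); rewrite addn1. Qed.

(** A local relation is homogenized into a global derivation tangent to the curve and to the line.
    The Euler correction does not affect its W, whose restriction in the chart is u x with u a unit;
    the bound [lower] applies to it. *)
Lemma local_order_lower x : tangent_coef (phi f') x -> 'X^K %| rY F x.
Proof.
case=> u u0 /idl3P[A0 [b0 [c0 uE]]].
pose A := u * x - b0 * Y.
have AE : A * dX (phi f') - c0 * (Y * dY (phi f')) = A0 * phi f'.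
  have : A * dX (phi f') = u * (dX (phi f') * x) - b0 * (Y * dX (phi f')) by rewrite /A; ring.
  by move=> ->; rewrite uE; ring.
have [e1 h1] := lift_phi uB A; have [e2 h2] := lift_phi uB c0.
have [e3 h3] := lift_phi uB A0; pose E := (e1 + e2 + e3)%N.
have [|A' hA A'E] := h1 E.+1; first by rewrite leqW // /E -addnA leq_addr.
have [|C2 hC2 C2E] := h2 E; first by rewrite /E addnAC leq_addl.
have [|C0 hC0 C0E] := h3 E; first by rewrite leq_addl.
(* The homogenization of the vector field A d/dx - c0 y d/dy of the chart. *)
pose th j : S := pinf j *: A' - r j *: (a * C2).
have hth j : th j \is E.+1.-homog.
  apply: rpredB; apply: rpredZ => //; rewrite -[E.+1]add1n; apply: dhomogM => //; exact: Lf_homog.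
have cfth k : cf B k th = (o1 == k)%:R *: A' - (o2 == k)%:R *: (a * C2).
  have H := @cf_lin F B 1 (-1) (fun j => B o1 j *: A') (fun j => B o2 j *: (a * C2)) th k.
  rewrite H => [|j]; last by rewrite /th !mxE y31 y32 mul1r mulN1r.
  by rewrite !(cf_vec uB) mul1r mulN1r.
have cf0 : cf B o0 th = 0 by rewrite cfth !scale0r subr0.
have cf1 : cf B o1 th = A' by rewrite cfth scale0r scale1r subr0.
have cf2 : cf B o2 th = - (a * C2) by rewrite cfth scale0r scale1r sub0r.
have derth : der th f' = C0 * f'.
  apply/eqP; rewrite -subr_eq0; apply/eqP; apply: (@phi_inj _ B uB (E.+1 + d)).
    apply: rpredB; first exact: der_homog.
    by rewrite addSnnS; apply: dhomogM.
  rewrite rmorphB rmorphM C0E -AE (der_basis uB) sum3 cf0 cf1 cf2 mul0r add0r.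
  rewrite rmorphD !rmorphM rmorphN rmorphM phi_dir1 phi_dir2 A'E C2E -aE phi_L2 //; ring.
have dera : der th a = - (a * C2).
  by rewrite -cf2 -aE der_L.
have derfa : der th (f' * a) = (C0 - C2) * (f' * a).
  by rewrite derM derth dera; ring.
have := der_eulerB char0 hfa derfa; set c := _ *: _ => der0.
have hth' j : th j - c * 'X_j \is E.+1.-homog.
  apply: rpredB => //; rewrite -[E.+1]addn1; apply: dhomogM; last by rewrite dhomogX; apply/eqP; exact: mdeg1.
  by apply: rpredZ; apply: rpredB.
have /dvdpP[q qE] := lower hth' der0.
have [c' c'0] := wedge_rY hth'; rewrite qE mulrC lin_exp wedge_eulerB.
rewrite /wedge cf0 cf1 mulr0 subr0 rmorphM phi_L0 // mul1r A'E.
rewrite /A rmorphB !rmorphM rY_Y mulr0 subr0 => uxE.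
apply: (@dvdXn_unit _ _ (rY F u)); first by rewrite -ev0_rY.
by rewrite uxE !scalerAr dvdp_mulr.
Qed.

(** For the attaining derivation, [der_wedge] puts W g_x in the ideal (g, y g_y). Up to a unit and
    modulo y, an x of order at least K on the line is a multiple of W. *)
Lemma local_order_upper x : 'X^K %| rY F x -> tangent_coef (phi f') x.
Proof.
case: attained => e [th [hth der0 [q qE q0]]] /dvdpP[y yE].
have [t tE tf] := tangent_line uB0 ff0 der0.
have [c c0] := wedge_rY hth; rewrite qE lin_exp scalerA scalerAr; set qq := _ *: (q \Po _).
have qq0 : qq`_0 != 0.
  rewrite /qq coefZ !mulf_neq0 ?expf_neq0 ?invr_eq0 //.
  rewrite -horner_coef0 horner_comp /lin hornerD hornerZ hornerX hornerC mulr0 add0r //.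
set A := phi (wedge B th) => rA.
have [u [w AE]] : exists u w, A * dX (phi f') = u * phi f' + w * (Y * dY (phi f')).
  have E : wedge B th * dir (row_pt B o1) f' =
      (- (Lf B o0 * t) - cf B o0 th * d.+1%:R) * f'
      + (cf B o0 th - Lf B o0 * t) * (Lf B o2 * dir (row_pt B o2) f').
    have := der_wedge uB th hf; rewrite tf (chart_cf2 uB0 ze al0) tE -aE.
    move: (wedge B th * _) => w E; rewrite -[w](addKr (cf B o0 th * d.+1%:R * f')).
    rewrite -[_ + w](addrK ((Lf B o0 * (Lf B o2 * t) - Lf B o2 * cf B o0 th) * dir (row_pt B o2) f')) -E.
    ring.
  move: E; set w1 := _ - _ * _%:R; set w2 := _ - Lf B o0 * t => /(congr1 phi).
  rewrite rmorphD !rmorphM phi_dir1 phi_dir2 phi_L2 // => E.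
  by exists (phi w1), (phi w2).
have [|s sE] := @rY_eq0 F (map_poly polyC qq * x - map_poly polyC y * A).
  by rewrite rmorphB !rmorphM !rY_outer yE rA; ring.
apply: (@loc_unit _ _ _ _ (map_poly polyC qq)); first by rewrite ev0_rY rY_outer.
have -> : map_poly polyC qq * (dX (phi f') * x) =
    map_poly polyC y * (A * dX (phi f')) + s * (Y * dX (phi f')).
  clear rA AE; move: sE; move: (map_poly polyC qq) (map_poly polyC y) (dX (phi f')) (A) => qq' y' D A' sE.
  transitivity (D * (qq' * x - y' * A') + y' * (A' * D)); first by ring.
  by rewrite sE; ring.
apply: locD; last by apply: locM; apply: loc_gen1.
apply: locM; rewrite AE; apply: locD; first by apply: locM; apply: loc_gen0.
by apply: locM; apply: loc_gen2.
Qed.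

Lemma codim_tangent : codimP (tangent_coef (phi f')) K.
Proof.
by apply: codim_eq (codim_rY F K) => x; split; [apply: local_order_upper|apply: local_order_lower].
Qed.
End LocalOrder.

(** * The degree of w *)

Section KeyDegree.
Variable F : closedFieldType.
Hypothesis char0 : forall n, n.+1%:R != 0 :> F.
Local Notation S := {mpoly F[3]}.
Local Notation Pl := {poly {poly F}}.
Local Notation Y := ('X%:P : Pl).
Implicit Types (f : S) (v : 'I_3 -> F).

Definition milnorS f v n := exists i j k : 'I_3,
  [/\ uniq [:: i; j; k], v i != 0 & sdim [:: mderiv j f; mderiv k f] v n].
Definition tjurinaS f v n := exists i j k : 'I_3,
  [/\ uniq [:: i; j; k], v i != 0 & sdim [:: f; mderiv j f; mderiv k f] v n].

Variables p0 pinf r : 'I_3 -> F.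
Local Notation B0 := (basis_mx p0 pinf r).
Hypothesis uB0 : B0 \in unitmx.
Local Notation a := (Lf B0 o2).
Variables (d : nat) (f' : S).
Hypotheses (hf : f' \is d.+1.-homog) (fpinf : f'.@[pinf] != 0).

Lemma rho_horner H z : (rho B0 H).[z] = H.@[fun j => p0 j + z * pinf j].
Proof.
rewrite meval_gev; pose hz : {rmorphism {poly F} -> F} := horner_eval z.
rewrite -[LHS]/(hz (rho B0 H)) (@gev_comp F _ _ (@polyC F) idfun hz) => [|c]; last exact: hornerC.
apply: eq_gev => j; rewrite -[LHS]/(horner_eval z _) /horner_eval sum3 y30 y31 y32 mulr1 mulr0 addr0.
by rewrite !mxE y30 y31 hornerD hornerM hornerX !hornerC mulrC.
Qed.

Lemma rho_f'_neq0 : rho B0 f' != 0.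
Proof.
have [_] := rho_top uB0 hf; rewrite basis_mx1 => E.
by apply: contraNneq fpinf => h; rewrite -E h coef0.
Qed.
Let ff0 := rho_f'_neq0.

(** Since [pinf] is off the curve, all the intersection points lie in the affine part of the
    line. *)
Lemma line_point v : (exists j, v j != 0) -> f'.@[v] = 0 -> a.@[v] = 0 ->
  exists al ze, [/\ al != 0, v = (fun j => al * (p0 j + ze * pinf j)) & root (rho B0 f') ze].
Proof.
move=> [j0 vj0] fv av.
have c2 : \sum_i v i * invmx B0 i o2 = 0.
  rewrite -[RHS]av /Lf raddf_sum; apply: eq_bigr => i _ /=.
  by rewrite mevalZ mevalXU mulrC.
have := basis_dual uB0 v; rewrite c2.
set c0 := \sum_i _; set c1 := \sum_i _ => vE.
have vE' j : v j = c0 * p0 j + c1 * pinf j by rewrite vE !mxE y30 y31 mul0r addr0.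
have c00 : c0 != 0.
  apply/eqP => c00; move: fv.
  rewrite meval_gev (@eq_gev _ _ _ _ (fun j => c1 * pinf j)) => [|j]; last first.
    by rewrite vE' c00 mul0r add0r.
  rewrite (gev_homog _ _ _ hf) -meval_gev => /eqP; rewrite mulf_eq0 (negPf fpinf) orbF.
  rewrite expf_eq0 /= => /eqP c10.
  by move: vj0; rewrite vE' c00 c10 !mul0r addr0 eqxx.
exists c0, (c1 / c0); have vE2 : v = (fun j => c0 * (p0 j + c1 / c0 * pinf j)).
  by apply/funext => j; rewrite vE' mulrDr mulrA (mulrC c0 (c1 / c0)) divfK.
split=> //; rewrite rootE rho_horner; move: fv.
rewrite vE2 meval_gev (gev_homog _ _ _ hf) -meval_gev => /eqP.
by rewrite mulf_eq0 expf_eq0 (negPf c00).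
Qed.

Lemma Lf_line k s t : (Lf B0 k).@[fun j => s * (p0 j + t * pinf j)]
  = s * ((o0 == k)%:R + t * (o1 == k)%:R).
Proof.
have E l : (l == k)%:R = \sum_i B0 l i * invmx B0 i k by rewrite dual_basis.
rewrite !E mulr_sumr -big_split mulr_sumr /Lf raddf_sum; apply: eq_bigr => i _ /=.
by rewrite mevalZ mevalXU !mxE y30 y31; ring.
Qed.

Section Local.
Variables (al ze : F) (K : nat).
Hypothesis al0 : al != 0.
Let v : 'I_3 -> F := fun j => al * (p0 j + ze * pinf j).
Local Notation B := (basis_mx v pinf r).
Local Notation phi := (phi B).
Hypothesis lower : forall e th, (forall j, th j \is e.-homog) -> der th (f' * a) = 0 ->
  ('X - ze%:P) ^+ K %| rho B0 (wedge B0 th).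
Hypothesis attained : exists e th, [/\ forall j, th j \is e.-homog, der th (f' * a) = 0 &
  exists2 q, rho B0 (wedge B0 th) = ('X - ze%:P) ^+ K * q & q.[ze] != 0].
Hypothesis fv : f'.@[v] = 0.

Let uB : B \in unitmx := chart_unit uB0 ze al0.
Let aE : Lf B o2 = a := chart_a uB0 ze al0.
Let g := phi f'.

Let g0 : ev0m F g = 0.
Proof. by rewrite (ev_phi B) basis_mx0. Qed.

Let rg0 : rY F g != 0.
Proof.
rewrite (chart_rho p0 pinf r ze al0 hf) scaler_eq0 expf_eq0 (negPf al0) andbF /=.
rewrite comp_poly2_eq0 ?ff0 //.
rewrite size_polyDl size_scale ?invr_eq0 ?size_polyX //.
by apply: leq_ltn_trans (size_polyC_leq1 _) _.
Qed.

Lemma sdim_mu f n : sdim [:: dir pinf f; dir r f] v n -> (exists e, f \is e.+1.-homog) ->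
  codimP (locP [:: dX (phi f); dY (phi f)]) n.
Proof.
move=> h [e hfe]; rewrite -!phi_dir1 -!phi_dir2.
have hg := homogs2 (u := row_pt B o1) (w := row_pt B o2) hfe.
by apply/(sdim_codim uB n hg); rewrite basis_mx0 basis_mx1 basis_mx2.
Qed.

Lemma sdim_tau f n : sdim [:: f; dir pinf f; dir r f] v n -> (exists e, f \is e.+1.-homog) ->
  codimP (locP [:: phi f; dX (phi f); dY (phi f)]) n.
Proof.
move=> h [e hfe]; rewrite -!phi_dir1 -!phi_dir2.
have hg : homogs [:: f; dir (row_pt B o1) f; dir (row_pt B o2) f].
  by move=> [|[|[|l]]] //= _; [exists e.+1|exists e; apply: dir_homog..].
by apply/(sdim_codim uB n hg); rewrite basis_mx0 basis_mx1 basis_mx2.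
Qed.

(** The intersection multiplicity i enters both line formulas as 2i and cancels; the 1 comes from
    the Milnor formula. *)
Lemma local_epsilon muC tauC muC' tauC' :
  milnorS (f' * a) v muC -> tjurinaS (f' * a) v tauC ->
  milnorS f' v muC' -> tjurinaS f' v tauC' ->
  (muC%:Z - tauC%:Z) - (muC'%:Z - tauC'%:Z) = K%:Z - 1.
Proof.
move=> [i1 [j1 [k1 [u1 vi1 h1]]]] [i2 [j2 [k2 [u2 vi2 h2]]]].
move=> [i3 [j3 [k3 [u3 vi3 h3]]]] [i4 [j4 [k4 [u4 vi4 h4]]]].
have hfa : f' * a \is d.+2.-homog by have := dhomogM hf (Lf_homog B0 o2); rewrite addn1.
have fav : (f' * a).@[v] = 0 by rewrite mevalM fv mul0r.
have phia : phi (f' * a) = Y * g by rewrite rmorphM -aE phi_L2 // mulrC.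
have m1 : codimP (locP [:: dX (Y * g); dY (Y * g)]) muC.
  have := sdim_mu (mu_canonical char0 uB u1 hfa fav vi1 h1); rewrite phia; apply.
  by exists d.+1.
have m3 : codimP (locP [:: dX g; dY g]) muC'.
  by apply: (sdim_mu (mu_canonical char0 uB u3 hf fv vi3 h3)); exists d.
have t2 : codimP (locP [:: Y * g; dX (Y * g); dY (Y * g)]) tauC.
  have := sdim_tau (tau_canonical uB u2 hfa vi2 h2); rewrite phia; apply.
  by exists d.+1.
have t4 : codimP (locP [:: g; dX g; dY g]) tauC'.
  by apply: (sdim_tau (tau_canonical uB u4 hf vi4 h4)); exists d.
have [i gi gi'] : exists2 i, 'X^i %| rY F g & (rY F g)`_i != 0.
  have [i [q qr E]] := multiplicity_XsubC (rY F g) 0.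
  rewrite rg0 /= in qr; exists i; first by rewrite E subr0 dvdp_mull.
  by rewrite E subr0 coefMXn ltnn subnn -horner_coef0.
have M := mu_line_formula char0 g0 gi gi' m1 m3.
have [k kk T] := tau_line_formula char0 g0 gi gi' t2 t4.
have cK : codimP (tangent_coef g) K := codim_tangent char0 uB0 hf ff0 al0 lower attained.
have kK : k = K.
  apply: codim_uniq; [|exact: (kk)|exact: (cK)]; split=> [|x y|c x]; rewrite /tangent_coef.
  - by rewrite mulr0; apply: loc0.
  - by rewrite mulrDr; apply: locD.
  - by rewrite mulrCA; apply: locM.
subst k; clear -M T; lia.
Qed.
End Local.

Lemma sum_mup (w : {poly F}) n (ze : 'I_n -> F) : w != 0 -> injective ze ->
  (forall z, root w z -> exists k, ze k = z) -> (\sum_(k < n) mup (ze k) w = (size w).-1)%N.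
Proof.
move=> w0 zi cov; have [rs wE] := closed_field_poly_normal w.
have lc0 : lead_coef w != 0 by rewrite lead_coef_eq0.
have mE z : mup z w = count_mem z rs.
  by rewrite wE -mul_polyC mupMr ?mu_prod_XsubC // rootC.
under eq_bigr do rewrite mE -sum1_count big_mkcond.
rewrite exchange_big /= (eq_big_seq (fun=> 1%N)) => [|z zrs].
  by rewrite sum1_size wE size_scale // size_prod_XsubC.
have [|k kE] := cov z; first by rewrite wE rootZ // root_prod_XsubC.
rewrite (bigD1 k) //= kE eqxx big1 // => l ne.
by rewrite -kE (inj_eq zi) eq_sym (negPf ne).
Qed.

(* The local contribution at a point of the line is one less than the order there of w, the
   greatest common divisor of the restrictions to the line of the forms wedge th. *)
Lemma key_degree n (pts : 'I_n -> 'I_3 -> F) (muC tauC muC' tauC' : 'I_n -> nat) (w : {poly F}) :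
  (forall k, [/\ exists j, pts k j != 0, f'.@[pts k] = 0 & a.@[pts k] = 0]) ->
  (forall k l, (exists c, forall i, pts l i = c * pts k i) -> k = l) ->
  (forall v, (exists j, v j != 0) -> f'.@[v] = 0 -> a.@[v] = 0 ->
     exists k c, forall i, v i = c * pts k i) ->
  (forall k, milnorS (f' * a) (pts k) (muC k)) -> (forall k, tjurinaS (f' * a) (pts k) (tauC k)) ->
  (forall k, milnorS f' (pts k) (muC' k)) -> (forall k, tjurinaS f' (pts k) (tauC' k)) ->
  w %| rho B0 f' ->
  (forall e th, (forall j, th j \is e.-homog) -> der th (f' * a) = 0 ->
     w %| rho B0 (wedge B0 th)) ->
  (forall ze, root (rho B0 f') ze -> exists e th, [/\ forall j, th j \is e.-homog,
     der th (f' * a) = 0 & exists2 q, rho B0 (wedge B0 th) = w * q & q.[ze] != 0]) ->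
  n%:Z + \sum_(k < n) (((muC k)%:Z - (tauC k)%:Z) - ((muC' k)%:Z - (tauC' k)%:Z))
    = (size w).-1%:Z.
Proof.
move=> hp inj cov mC tC mC' tC' wf low att.
have w0 : w != 0 by apply: contraNneq ff0 => w0; move: wf; rewrite w0 dvd0p.
have /choice[al /choice[ze aze]] k : exists al ze, [/\ al != 0,
    pts k = (fun j => al * (p0 j + ze * pinf j)) & root (rho B0 f') ze].
  by have [h1 h2 h3] := hp k; apply: line_point.
have zi : injective ze.
  move=> k l zE; apply: inj; exists (al l / al k) => i.
  have [k0 -> _] := aze k; have [_ -> _] := aze l.
  by rewrite zE mulrA divfK.
(* As w divides the restriction of f', each of its roots is an intersection point, so the orders of
   w at the listed points add up to its degree. *)
have zcov z : root w z -> exists k, ze k = z.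
  move=> wz; have fz : root (rho B0 f') z by rewrite -dvdp_XsubCl; apply: dvdp_trans wf; rewrite dvdp_XsubCl.
  pose pv j := 1 * (p0 j + z * pinf j).
  have pv0 : (Lf B0 o0).@[pv] = 1 by rewrite Lf_line /= mulr0 addr0 mulr1.
  have pv1 : (Lf B0 o1).@[pv] = z by rewrite Lf_line /= mulr1 add0r mul1r.
  have [||| k [c kE]] := cov pv.
  - apply: contrapT => h; move: pv0.
    rewrite meval_gev (@eq_gev _ _ _ _ (fun j => 0 * p0 j)) => [|j]; last first.
      by rewrite mul0r; apply: contrapT => /eqP hj; apply: h; exists j.
    by rewrite (gev_homog _ _ _ (Lf_homog _ _)) expr1 mul0r => /esym/eqP; rewrite oner_eq0.
  - rewrite -(eqP fz) rho_horner; apply: eq_gev => j; exact: mul1r.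
  - by rewrite Lf_line /= mulr0 addr0 mulr0.
  have [k0 pk _] := aze k; exists k.
  have pvE : pv = (fun j => c * al k * (p0 j + ze k * pinf j)).
    by apply/funext => j; rewrite kE pk mulrA.
  move: pv1; move: pv0; rewrite pvE !Lf_line /= mulr0 addr0 mulr1 => ->.
  by rewrite mulr1 add0r mul1r.
have epsE k : ((muC k)%:Z - (tauC k)%:Z) - ((muC' k)%:Z - (tauC' k)%:Z) = (mup (ze k) w)%:Z - 1.
  have [k0 pk fk] := aze k.
  have [m [w' w'0 wE]] := multiplicity_XsubC w (ze k); rewrite w0 /= in w'0.
  have -> : mup (ze k) w = m by rewrite wE mupMr // mup_XsubCX eqxx.
  have [_ fpk _] := hp k; rewrite pk in fpk.
  have := mC k; have := tC k; have := mC' k; have := tC' k; rewrite pk => h4 h3 h2 h1.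
  apply: (local_epsilon k0 _ _ fpk h1 h2 h3 h4).
    move=> e th hth d0; apply: dvdp_trans (low e th hth d0).
    by rewrite wE dvdp_mulIr.
  have [e [th [hth d0 [q qE q0]]]] := att _ fk.
  exists e, th; split=> //; exists (w' * q); last by rewrite hornerM mulf_neq0.
  by rewrite qE wE; ring.
under eq_bigr do rewrite epsE.
rewrite sumrB sumr_const card_ord natz -(sum_mup w0 zi zcov) (big_morph Posz PoszD (erefl _)).
by rewrite addrC subrK.
Qed.
End KeyDegree.

(** * Bases of the module of logarithmic derivations *)

Section Freeness.
Variable F : closedFieldType.
Hypothesis char0 : forall n, n.+1%:R != 0 :> F.
Local Notation S := {mpoly F[3]}.
Implicit Types (th de ps : 'I_3 -> S) (f : S).

Definition fbasis f th1 th2 e1 e2 :=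
  [/\ (forall j, th1 j \is e1.-homog) /\ (forall j, th2 j \is e2.-homog),
      der th1 f = 0, der th2 f = 0,
      forall th, der th f = 0 -> exists g1 g2, forall j, th j = g1 * th1 j + g2 * th2 j &
      forall g1 g2, (forall j, g1 * th1 j + g2 * th2 j = 0) -> g1 = 0 /\ g2 = 0].

Lemma fbasis_sym f th1 th2 e1 e2 : fbasis f th1 th2 e1 e2 -> fbasis f th2 th1 e2 e1.
Proof.
move=> [[h1 h2] d1 d2 gen ind]; split=> // [th /gen[g1 [g2 E]]|g1 g2 E].
  by exists g2, g1 => j; rewrite E addrC.
by have [|-> ->] := ind g2 g1 => // j; rewrite addrC.
Qed.

Lemma fbasis_shear f th1 th2 e1 e2 H k : H \is k.-homog -> (k + e1 = e2)%N ->
  fbasis f th1 th2 e1 e2 -> fbasis f th1 (fun j => th2 j - H * th1 j) e1 e2.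
Proof.
move=> hH ke [[h1 h2] d1 d2 gen ind]; split=> //.
- by split=> // j; apply: rpredB => //; rewrite -ke; apply: dhomogM.
- have -> := @der_lin F 1 (- H) th2 th1 (fun j => th2 j - H * th1 j) f; last first.
    by move=> j; ring.
  by rewrite d1 d2 !mulr0 addr0.
- move=> th /gen[g1 [g2 E]]; exists (g1 + g2 * H), g2 => j; rewrite E; ring.
move=> g1 g2 E; have [|g1E g2E] := ind (g1 - g2 * H) g2.
  by move=> j; rewrite -[RHS](E j); ring.
by move: g1E; rewrite g2E mul0r subr0.
Qed.

Lemma pihomog_mulr e e2 (p q : S) : q \is e2.-homog ->
  pihomog mdeg e (p * q) = (if (e2 <= e)%N then pihomog mdeg (e - e2) p else 0) * q.
Proof.
move=> hq; case: leqP => [le|lt].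
  by rewrite mulrC -{1}(subnKC le) pihomog_mul // mulrC.
rewrite mul0r; elim/mpolyind: p => [|c m p _ _ IH]; first by rewrite mul0r raddf0.
rewrite mulrDl pihomogD IH addr0; apply: (@pihomog_ne0 _ _ _ (mdeg m + e2)).
  by rewrite gtn_eqF // ltn_addl.
by apply: dhomogM => //; apply: rpredZ; rewrite dhomogX.
Qed.

(** Homogeneous of degree e - k; the alternative g = 0 covers a negative difference. *)
Definition gdeg (g : S) k e := g = 0 \/ exists2 l, g \is l.-homog & (l + k = e)%N.

Lemma fbasis_homog f th1 th2 e1 e2 th e : fbasis f th1 th2 e1 e2 -> der th f = 0 ->
  (forall j, th j \is e.-homog) ->
  exists g1 g2, [/\ gdeg g1 e1 e, gdeg g2 e2 e & forall j, th j = g1 * th1 j + g2 * th2 j].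
Proof.
move=> [[h1 h2] _ _ gen _] /gen[g1 [g2 E]] hth.
pose c k (g : S) := if (k <= e)%N then pihomog mdeg (e - k) g else 0.
have cd k g : gdeg (c k g) k e.
  rewrite /gdeg /c; case: leqP => [le|]; [right|by left].
  by exists (e - k)%N; [exact: pihomogP|rewrite subnK].
exists (c e1 g1), (c e2 g2); split=> // j.
by rewrite -(pihomog_dE (hth j)) E pihomogD !(pihomog_mulr _ _ (h1 j), pihomog_mulr _ _ (h2 j)).
Qed.

(** Turns identities modulo the Euler field into exact ones, once both sides are known to kill f. *)
Lemma euler_kill d f de q : f \is d.+1.-homog -> f != 0 -> (forall j, de j = q * 'X_j) ->
  der de f = 0 -> q = 0.
Proof.
move=> hf f0 E; rewrite (@der_lin F q 0 (fun j => 'X_j) (fun=> 0) de) => [|j]; last first.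
  by rewrite E mul0r addr0.
rewrite (der_euler hf) mul0r addr0 mulr_natl => /eqP; rewrite mulf_eq0 => /orP[/eqP //|].
by rewrite -scaler_nat scaler_eq0 (negPf (char0 _)) (negPf f0).
Qed.

(** The cofactor c may fail to be homogeneous, so its component of degree e - 1 is used. For e = 0,
    th(f) has degree below that of f and therefore vanishes. *)
Lemma euler_proj d e f th c : f \is d.+1.-homog -> f != 0 -> (forall j, th j \is e.-homog) ->
  der th f = c * f ->
  exists2 s, der (fun j => th j - s * 'X_j) f = 0 & forall j, th j - s * 'X_j \is e.-homog.
Proof.
move=> hf f0 hth E; case: e hth => [|e] hth.
  exists 0; last by move=> j; rewrite mul0r subr0.
  rewrite (_ : (fun _ => _) = th); last by apply/funext => j; rewrite mul0r subr0.
  have : der th f \is (0 + d).-homog by apply: der_homog.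
  rewrite add0n => /pihomog_dE <-.
  by rewrite E (pihomog_mulr _ _ hf) ltnn mul0r.
have : der th f \is (e + d.+1).-homog by rewrite addnS -addSn; apply: der_homog.
move/pihomog_dE; rewrite {1}E (pihomog_mulr _ _ hf) leq_addl addnK => /esym E'.
exists (d.+1%:R^-1 *: pihomog mdeg e c); first exact: der_eulerB.
move=> j; apply: rpredB => //; rewrite -[e.+1]addn1; apply: dhomogM.
  by apply: rpredZ; exact: pihomogP.
by rewrite dhomogX; apply/eqP; exact: mdeg1.
Qed.

Section Line.
Variable B : 'M[F]_3.
Hypothesis uB : B \in unitmx.
Local Notation a := (Lf B o2).
Variables (d : nat) (f' : S).
Hypotheses (hf : f' \is d.+1.-homog) (ff0 : rho B f' != 0).

Let f0 : f' != 0. Proof. by apply: contraNneq ff0 => ->; rewrite rmorph0. Qed.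
Let a0 : a != 0. Proof. exact: Lf_neq0. Qed.
Let hfa : f' * a \is d.+2.-homog.
Proof. by have := dhomogM hf (Lf_homog B o2); rewrite addn1. Qed.
Let fa0 : f' * a != 0. Proof. by rewrite mulf_neq0. Qed.
Let adiv p q : (exists s, p * q = a * s) -> ~ (exists s, p = a * s) -> exists s, q = a * s.
Proof. by move=> /(a_prime uB)[]. Qed.
Let f'div q : (exists s, f' * q = a * s) -> exists s, q = a * s.
Proof. by move=> /adiv; apply=> -[s sE]; move: ff0; rewrite sE rmorphM rho_a // mul0r eqxx. Qed.

(** th1 preserves the line and th2 does not, so g1 th1 + g2 th2 preserves it exactly when the prime
    a divides g2. The Euler corrections s1 and s2 move both generators into the kernel of f' a. *)
Lemma build1 th1 th2 e1 e2 t1 : fbasis f' th1 th2 e1 e2 ->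
  cf B o2 th1 = a * t1 -> ~ (exists t, cf B o2 th2 = a * t) ->
  exists ps1 ps2, fbasis (f' * a) ps1 ps2 e1 e2.+1.
Proof.
move=> [[h1 h2] d1 d2 gen ind] t1E nt2.
have [|s1 D1 H1] := @euler_proj _ _ (f' * a) th1 t1 hfa fa0 h1.
  by rewrite derM d1 der_L // t1E; ring.
have hat j : a * th2 j \is e2.+1.-homog.
  by rewrite -[e2.+1]add1n; apply: dhomogM => //; apply: Lf_homog.
have dat f : der (fun j => a * th2 j) f = a * der th2 f.
  by rewrite /der big_distrr; apply: eq_bigr => j _; rewrite /= mulrA.
have [|s2 D2 H2] := @euler_proj _ _ (f' * a) (fun j => a * th2 j) (cf B o2 th2) hfa fa0 hat.
  by rewrite dat derM d2 der_L //; ring.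
exists (fun j => th1 j - s1 * 'X_j), (fun j => a * th2 j - s2 * 'X_j); split=> //.
  move=> de dde; have [t tE df] := tangent_line uB ff0 dde.
  have := der_eulerB char0 hf df; set c := _ *: _ => /gen[g1 [g2 gE]].
  have [|g2' g2E] := adiv _ nt2 (q := g2).
    exists (t - c - g1 * t1); have := cf_lin B o2 gE.
    rewrite t1E (@cf_lin F B 1 (- c) de (fun j => 'X_j)) => [|j]; last by ring.
    rewrite tE cf_euler => E; rewrite -[LHS](addKr (g1 * (a * t1))) [_ * g2]mulrC -E; ring.
  exists g1, g2'; pose q := c + g1 * s1 + g2' * s2.
  have qE j : de j - (g1 * (th1 j - s1 * 'X_j) + g2' * (a * th2 j - s2 * 'X_j)) = q * 'X_j.
    have -> : de j = g1 * th1 j + g2 * th2 j + c * 'X_j by rewrite -gE subrK.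
    by rewrite g2E /q; ring.
  have q0 : q = 0.
    apply: (euler_kill hfa fa0 qE).
    rewrite (@der_lin F 1 (-1) de (fun j => g1 * (th1 j - s1 * 'X_j) + g2' * (a * th2 j - s2 * 'X_j)))
      => [|j]; last by ring.
    rewrite dde (@der_lin F g1 g2' (fun j => th1 j - s1 * 'X_j) (fun j => a * th2 j - s2 * 'X_j)) //.
    by rewrite D1 D2 !mulr0 addr0 mulr0 addr0.
  by move=> j; apply/eqP; rewrite -subr_eq0 qE q0 mul0r.
move=> g1 g2 E; pose q := g1 * s1 + g2 * s2.
have qE j : g1 * th1 j + (g2 * a) * th2 j = q * 'X_j.
  by rewrite -[LHS]subr0 -[X in _ - X](E j) /q; ring.
have q0 : q = 0.
  by apply: (euler_kill hf f0 qE); rewrite (@der_lin F g1 (g2 * a) th1 th2) // d1 d2 !mulr0 addr0.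
have [|-> /eqP] := ind g1 (g2 * a); first by move=> j; rewrite qE q0 mul0r.
by rewrite mulf_eq0 (negPf a0) orbF => /eqP.
Qed.

(** On the line the components of th are (c, Z c, 0), the Euler field times c. Lifting c to a form h
    and subtracting h times the Euler field leaves components divisible by a. In degree 0 the bound
    on the degree of Z c forces c = 0, and then th = 0. *)
Lemma wedge0_div th e : (forall j, th j \is e.-homog) -> rho B (wedge B th) = 0 ->
  (exists t, cf B o2 th = a * t) ->
  (forall j, th j = 0) \/ exists e' h (et : 'I_3 -> S),
    [/\ e = e'.+1, forall j, et j \is e'.-homog & forall j, th j = h * 'X_j + a * et j].
Proof.
move=> hth; rewrite rmorphB !rmorphM rho_L0 // rho_L1 // mul1r => /eqP; rewrite subr_eq0 => /eqP E [t tE].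
have hc k : cf B k th \is e.-homog := cf_homog B k hth.
have c2 : rho B (cf B o2 th) = 0 by rewrite tE rmorphM rho_a // mul0r.
have [s1 _] := rho_top uB (hc o1); have [s0 _] := rho_top uB (hc o0).
case: e hth hc s1 s0 => [|e] hth hc s1 s0.
  have r0 : rho B (cf B o0 th) = 0.
    apply/eqP; apply: contraTT s1 => r0.
    by rewrite E mulrC size_mulX // ltnS -ltnNge lt0n size_poly_eq0.
  left=> j; rewrite (th_cf uB th j) sum3 (rho_homog0 (hc o0) r0) (rho_homog0 (hc o2) c2).
  have r1 : rho B (cf B o1 th) = 0 by rewrite E r0 mulr0.
  by rewrite (rho_homog0 (hc o1) r1) !scaler0 !addr0.
right; have [|h hh hE] := @rho_lift _ _ uB e (rho B (cf B o0 th)).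
  have [->|r0] := eqVneq (rho B (cf B o0 th)) 0; first by rewrite size_poly0.
  by move: s1; rewrite E mulrC size_mulX.
have dv k : rho B (cf B k th) = rho B (Lf B k * h) ->
    exists2 et, et \is e.-homog & cf B k th - Lf B k * h = a * et.
  move=> kE; apply: (dvd_homog uB); last by rewrite rmorphB kE subrr.
  apply: rpredB; first exact: hc.
  by rewrite -[e.+1]add1n; apply: dhomogM => //; apply: Lf_homog.
have [|et0 he0 E0] := dv o0; first by rewrite rmorphM rho_L0 // mul1r.
have [|et1 he1 E1] := dv o1; first by rewrite rmorphM rho_L1 // E hE.
have [|et2 he2 E2] := dv o2; first by rewrite rmorphM rho_a // c2 mul0r.
exists e, h, (fun j => \sum_(k < 3) B k j *: y3 et0 et1 et2 k); split=> // j.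
  by rewrite sum3 y30 y31 y32; apply: rpredD; [apply: rpredD|]; apply: rpredZ.
have cE k : cf B k th = Lf B k * h + a * y3 et0 et1 et2 k.
  by move: k; apply: ord3P; rewrite ?y30 ?y31 ?y32 -?E0 -?E1 -?E2 addrC subrK.
rewrite (th_cf uB th j) (X_L uB j) !big_distrr -big_split; apply: eq_bigr => k _ /=.
by rewrite cE scalerDr -!scalerAr [h * _]mulrC.
Qed.

(** Here th2 = h E + a et with E the Euler field, and et takes the place of th2. To generate, a
    derivation de killing f' is multiplied by a, which makes it tangent to the line, and expanded in
    th1, th2. *)
Lemma build2 th1 th2 e1 e2 : fbasis (f' * a) th1 th2 e1 e2 ->
  rho B (wedge B th1) != 0 -> rho B (wedge B th2) = 0 ->
  exists e ps1 ps2, e2 = e.+1 /\ fbasis f' ps1 ps2 e1 e.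
Proof.
move=> [[h1 h2] d1 d2 gen ind] w1 w2.
have [t1 t1E df1] := tangent_line uB ff0 d1; have [t2 t2E df2] := tangent_line uB ff0 d2.
have [|z2|] := wedge0_div h2 w2; first by exists t2.
  by have [|_ /eqP] := ind 0 1; [move=> j; rewrite z2 mul0r mulr0 addr0|rewrite oner_eq0].
move=> [e [h [et [eE het th2E]]]]; exists e.
have [s1 D1 H1] := euler_proj hf f0 h1 df1.
(* Euler's formula turns th2(f') = -t2 f' into a et(f') = -(t2 + (d+1) h) f'; as a does not divide
   f', it divides the other factor. *)
have det : exists c, der et f' = c * f'.
  have [|u uE] := @f'div (t2 + d.+1%:R * h).
    exists (- der et f'); have := df2.
    rewrite (@der_lin F h a (fun j => 'X_j) et) // (der_euler hf) => E.
    rewrite mulrN; apply/eqP; rewrite -subr_eq0 opprK; apply/eqP.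
    rewrite -[RHS](subrr (- t2 * f')) -{1}E; ring.
  exists (- u); apply: (mulfI a0); have := df2.
  rewrite (@der_lin F h a (fun j => 'X_j) et) // (der_euler hf) => E.
  have -> : a * (- u * f') = - (a * u) * f' by ring.
  rewrite -uE -[a * _](addKr (h * (d.+1%:R * f'))) E; ring.
have {det}[c cE] := det; have [s2 D2 H2] := euler_proj hf f0 het cE.
exists (fun j => th1 j - s1 * 'X_j), (fun j => et j - s2 * 'X_j); split=> //; split=> //.
  move=> de dde.
  pose c' := d.+2%:R^-1 *: cf B o2 de.
  have : der (fun j => a * de j - c' * 'X_j) (f' * a) = 0.
    apply: (der_eulerB char0 hfa); rewrite (@der_lin F a 0 de (fun=> 0)) => [|j]; last by ring.
    by rewrite mul0r addr0 derM dde der_L //; ring.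
  move=> /gen[g1 [g2 gE]].
  (* In a W(de) = g1 W(th1) + g2 W(th2) the prime a divides W(th2) but not W(th1). *)
  have [g1' g1E] : exists s, g1 = a * s.
    apply: (adiv (p := wedge B th1)) => [|[s sE]]; last by move: w1; rewrite sE rmorphM rho_a // mul0r eqxx.
    have [s sE] := (rho_ker uB (wedge_homog B h2) w2).
    exists (wedge B de - g2 * s).
    have := wedge_lin B gE; rewrite (@wedge_lin F B a (- c') de (fun j => 'X_j)) => [|j]; last by ring.
    rewrite wedge_euler sE mulr0 addr0 => E.
    transitivity (a * wedge B de - g2 * (a * s)); last by ring.
    by rewrite E; ring.
  exists g1', g2; pose q := c' + g1' * a * s1 + g2 * (h + a * s2).
  have qE j : a * (de j - (g1' * (th1 j - s1 * 'X_j) + g2 * (et j - s2 * 'X_j))) = q * 'X_j.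
    have -> : a * (de j - (g1' * (th1 j - s1 * 'X_j) + g2 * (et j - s2 * 'X_j))) =
      (a * de j - c' * 'X_j) + c' * 'X_j - a * (g1' * (th1 j - s1 * 'X_j) + g2 * (et j - s2 * 'X_j)).
      by ring.
    by rewrite gE g1E th2E /q; ring.
  have q0 : q = 0.
    apply: (euler_kill hf f0 qE); pose ps j := g1' * (th1 j - s1 * 'X_j) + g2 * (et j - s2 * 'X_j).
    have psd : der ps f' = 0.
      rewrite (@der_lin F g1' g2 (fun j => th1 j - s1 * 'X_j) (fun j => et j - s2 * 'X_j)) //.
      by rewrite D1 D2 !mulr0 addr0.
    rewrite (@der_lin F a (- a) de ps) => [|j]; last by rewrite /ps; ring.
    by rewrite dde psd !mulr0 addr0.
  move=> j; apply: (mulfI a0); apply/eqP; rewrite -subr_eq0 -mulrBr qE q0 mul0r //.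
move=> g1 g2 E; pose q := a * g1 * s1 + g2 * (h + a * s2).
have qE j : (a * g1) * th1 j + g2 * th2 j = q * 'X_j.
  rewrite th2E -[LHS]subr0 -[X in _ - X](mulr0 a) -(E j) /q; ring.
have q0 : q = 0.
  by apply: (euler_kill hfa fa0 qE); rewrite (@der_lin F (a * g1) g2 th1 th2) // d1 d2 !mulr0 addr0.
have [|/eqP + ->] := ind (a * g1) g2; first by move=> j; rewrite qE q0 mul0r.
by rewrite mulf_eq0 (negPf a0) => /eqP ->.
Qed.
End Line.
End Freeness.

(** * Freeness and the line, in fixed coordinates *)

Section AddLine.
Variable F : closedFieldType.
Hypothesis char0 : forall n, n.+1%:R != 0 :> F.
Local Notation S := {mpoly F[3]}.
Variable B : 'M[F]_3.
Hypothesis uB : B \in unitmx.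
Local Notation a := (Lf B o2).
Local Notation rho := (rho B).
Local Notation wedge := (wedge B).
Variables (d : nat) (f' : S).
Hypotheses (hf : f' \is d.+1.-homog) (fpinf : f'.@[row_pt B o1] != 0).

Lemma size_rho e H : H \is e.-homog -> H.@[row_pt B o1] != 0 -> size (rho H) = e.+1.
Proof.
move=> hH H0; have [s c] := rho_top uB hH; apply/eqP; rewrite eqn_leq s /= ltnNge.
by apply: contra H0 => le; rewrite -c nth_default.
Qed.

Let ff0 : rho f' != 0.
Proof. by rewrite -size_poly_eq0 (size_rho hf fpinf). Qed.
Let f0 : f' != 0. Proof. by apply: contraNneq ff0 => ->; rewrite rmorph0. Qed.
Let a0 : a != 0. Proof. exact: Lf_neq0. Qed.
Let hfa : f' * a \is d.+2.-homog.
Proof. by have := dhomogM hf (Lf_homog B o2); rewrite addn1. Qed.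
Let fa0 : f' * a != 0. Proof. by rewrite mulf_neq0. Qed.

Let der_vec l f : der (fun j => B l j *: f') f = dir (row_pt B l) f * f'.
Proof. by rewrite /der /dir big_distrl; apply: eq_bigr => j _ /=; rewrite -!scalerAl [f' * _]mulrC. Qed.
Let vec_homog l j : B l j *: f' \is d.+1.-homog. Proof. exact: rpredZ. Qed.

(** An explicit supply of elements for the degree counts: on the line, the third one has th(a) = f',
    and the first two have W = -Z f' and W = f'. *)
Lemma vec_der l : exists th s, [/\ forall j, th j \is d.+1.-homog, der th f' = 0 &
  forall j, th j = B l j *: f' - s * 'X_j].
Proof.
have [s D H] := euler_proj char0 hf f0 (vec_homog l) (der_vec l f').
exists (fun j => B l j *: f' - s * 'X_j), s; split; [exact: H|exact: D|by []].
Qed.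
Lemma vec_der_line l : l != o2 -> exists th s, [/\ forall j, th j \is d.+1.-homog,
  der th (f' * a) = 0 & forall j, th j = B l j *: f' - s * 'X_j].
Proof.
move=> l2; have E : der (fun j => B l j *: f') (f' * a) = dir (row_pt B l) f' * (f' * a).
  by rewrite derM der_vec der_L // cf_vec // (negPf l2) scale0r; ring.
have [s D H] := euler_proj char0 hfa fa0 (vec_homog l) E.
exists (fun j => B l j *: f' - s * 'X_j), s; split; [exact: H|exact: D|by []].
Qed.

Lemma cf_vec_euler l th s k : (forall j, th j = B l j *: f' - s * 'X_j) ->
  cf B k th = (l == k)%:R *: f' - s * Lf B k.
Proof.
move=> E; rewrite (@cf_lin F B 1 (- s) (fun j => B l j *: f') (fun j => 'X_j)) => [|j].
  by rewrite cf_vec // cf_euler; ring.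
by rewrite E; ring.
Qed.

Lemma wedge_vec0 th s : (forall j, th j = B o0 j *: f' - s * 'X_j) -> rho (wedge th) = - 'X * rho f'.
Proof.
move=> E; rewrite /wedge !(cf_vec_euler _ E) scale0r scale1r !rmorphB !rmorphM rmorphB rmorphM.
by rewrite rmorphB rmorphM rmorph0 rho_L0 // rho_L1 //; ring.
Qed.
Lemma wedge_vec1 th s : (forall j, th j = B o1 j *: f' - s * 'X_j) -> rho (wedge th) = rho f'.
Proof.
move=> E; rewrite /wedge !(cf_vec_euler _ E) scale0r scale1r !rmorphB !rmorphM rmorphB rmorphM.
by rewrite rmorphB rmorphM rmorph0 rho_L0 // rho_L1 //; ring.
Qed.

Variable N : nat.
Hypothesis key : forall w, w %| rho f' ->
  (forall e th, (forall j, th j \is e.-homog) -> der th (f' * a) = 0 -> w %| rho (wedge th)) ->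
  (forall ze, root (rho f') ze -> exists e th, [/\ forall j, th j \is e.-homog,
     der th (f' * a) = 0 & exists2 q, rho (wedge th) = w * q & q.[ze] != 0]) ->
  (size w).-1 = N.+1.

Let lower_f' (w : {poly F}) :
  (forall e th, (forall j, th j \is e.-homog) -> der th (f' * a) = 0 -> w %| rho (wedge th)) ->
  w %| rho f'.
Proof.
by move=> low; have [|th [s [hth D E]]] := @vec_der_line o1; rewrite // -(wedge_vec1 E); apply: low hth D.
Qed.

Lemma gdeg_size g k e : gdeg g k e -> (size (rho g) + k <= e.+1)%N \/ g = 0.
Proof.
case=> [|[l hl <-]]; [by right|left].
by have [s _] := rho_top uB hl; rewrite -addSn leq_add2r.
Qed.

(** W1 has degree at most e1 + 1, the degree of w, and is a multiple of w; so it is zero or w up to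
    a constant. In the second case W1 divides W2 and a shear makes W2 vanish. In the first W2 is w
    up to a constant, the generators exchange roles, and e1 = e2 has to be shown. *)
Lemma free_down e1 e2 th1 th2 : N = e1 -> fbasis (f' * a) th1 th2 e1 e2 ->
  exists e ps1 ps2, e2 = e.+1 /\ fbasis f' ps1 ps2 e1 e.
Proof.
move=> Ne1 bas; have [[h1 h2] d1 d2 gen ind] := bas.
set W1 := rho (wedge th1); set W2 := rho (wedge th2); pose w := gcdp W1 W2.
have low e th : (forall j, th j \is e.-homog) -> der th (f' * a) = 0 -> w %| rho (wedge th).
  move=> _ /gen[g1 [g2 gE]]; rewrite (wedge_lin B gE) rmorphD !rmorphM.
  by apply: dvdp_add; apply: dvdp_mull; rewrite ?dvdp_gcdl ?dvdp_gcdr.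
have wf := lower_f' low.
have w0 : w != 0 by apply: contraNneq ff0 => w0; move: wf; rewrite w0 dvd0p.
have sw : size w = e1.+2.
  suff <- : (size w).-1 = e1.+1 by rewrite prednK // lt0n size_poly_eq0.
  rewrite -Ne1; apply: key => // ze _.
  have [q1 q1E] : exists q, W1 = w * q by have /dvdpP[q ->] := dvdp_gcdl W1 W2; exists q; rewrite mulrC.
  have [q2 q2E] : exists q, W2 = w * q by have /dvdpP[q ->] := dvdp_gcdr W1 W2; exists q; rewrite mulrC.
  have [z1|z1] := eqVneq q1.[ze] 0; last by exists e1, th1; split=> //; exists q1.
  have [z2|z2] := eqVneq q2.[ze] 0; last by exists e2, th2; split=> //; exists q2.
  have : w * ('X - ze%:P) %| w.
    by rewrite dvdp_gcd q1E q2E !dvdp_mul2l // !dvdp_XsubCl !rootE z1 z2 eqxx.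
  move/(dvdp_leq w0); rewrite size_mul ?polyXsubC_eq0 // size_XsubC addn2 /= => /leq_trans.
  by move/(_ _ (leqnn _)); rewrite ltnn.
have [s1 _] : top_coef e1.+1 W1 _ := rho_top uB (wedge_homog B h1).
have [s2 _] : top_coef e2.+1 W2 _ := rho_top uB (wedge_homog B h2).
have [W10|W10] := eqVneq W1 0.
  have W20 : W2 != 0 by apply: contraNneq w0 => W20; rewrite /w W10 W20 gcd0p.
  have [e [ps1 [ps2 [eE bas']]]] := build2 char0 uB hf ff0 (fbasis_sym bas) W20 W10.
  suff e12 : e1 = e2.
    by exists e, ps1, ps2; split; [rewrite -e12|rewrite e12].
  have sW2 : size W2 = e1.+2.
    by rewrite -sw /w W10 gcd0p.
  (* From -Z f' = g2 W2 on the line, with deg f' = d+1, deg W2 = e1+1 and deg g2 <= d+1-e2, follows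
     e2 <= e1. The converse is the bound deg W2 <= e2+1. *)
  have [|th [s [hth D E]]] := @vec_der_line o0; first by [].
  have [g1 [g2 [_ gd2 gE]]] := fbasis_homog bas D hth.
  have := wedge_lin B gE => /(congr1 rho).
  rewrite (wedge_vec0 E) rmorphD !rmorphM -/W1 -/W2 W10 mulr0 add0r => fE.
  have g20 : rho g2 != 0.
    apply: contraNneq ff0 => g20; move/eqP: fE; rewrite g20 mul0r mulf_eq0.
    by rewrite oppr_eq0 polyX_eq0.
  have [gs|g2z] := gdeg_size gd2; last by rewrite g2z rmorph0 eqxx in g20.
  have szE : (size (rho f')).+1 = (size (rho g2 * W2)) by rewrite -fE mulNr size_polyN mulrC size_mulX.
  rewrite size_mul // sW2 (size_rho hf fpinf) in szE.
  by apply/eqP; rewrite eqn_leq; apply/andP; move: szE gs s2; rewrite sW2; clear; move: (size _) => s; lia.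
have W1w : W1 %= w.
  rewrite eqp_sym -dvdp_size_eqp ?dvdp_gcdl // sw eqn_leq s1 andbT -sw.
  by apply: dvdp_leq (dvdp_gcdl _ _).
have [H hH HE] : exists2 H, rho H * W1 = W2 & H = 0 \/ exists2 k, H \is k.-homog & (k + e1 = e2)%N.
  have [->|W20] := eqVneq W2 0; first by exists 0; [rewrite rmorph0 mul0r|left].
  have /dvdpP[q qE] : W1 %| W2 by rewrite (eqp_dvdl _ W1w) dvdp_gcdr.
  have q0 : q != 0 by apply: contraNneq W20 => q0; rewrite qE q0 mul0r.
  have sq : (size q + e1 <= e2.+1)%N.
    by move: s2; rewrite qE size_mul // (eqp_size W1w) sw; clear; move: (size _) => n; lia.
  have le : (e1 <= e2)%N by move: sq; rewrite -size_poly_gt0 in q0; move: q0; clear; move: (size _) => n; lia.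
  have [|H hH HE] := @rho_lift _ _ uB (e2 - e1) q; first by rewrite -(leq_add2r e1) addSn subnK.
  by exists H; [rewrite HE qE|right; exists (e2 - e1)%N; rewrite ?subnK].
have bas' : fbasis (f' * a) th1 (fun j => th2 j - H * th1 j) e1 e2.
  case: HE => [->|[k hk ke]]; last exact: fbasis_shear hk ke bas.
  by rewrite (_ : (fun _ => _) = th2) //; apply/funext => j; rewrite mul0r subr0.
apply: (build2 char0 uB hf ff0 bas') => //.
rewrite (@wedge_lin F B 1 (- H) th2 th1) => [|j]; last by ring.
by rewrite mul1r rmorphD rmorphM rmorphN mulNr hH subrr.
Qed.

(** Let m be the degree of gcd(c1, c2). The syzygy lifts to th0 of degree E = e1+e2-m, and on the
    line W of every derivation killing f' a is a multiple of W(th0). So W(th0) has degree e1 + 1;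
    this degree is also E + 1, whence m = e2. As [pinf] makes the nonzero c_i of exact degree e_i, a
    nonzero c2 is the gcd itself. *)
Lemma free_up e1 e2 th1 th2 : N = e1 -> fbasis f' th1 th2 e1 e2 ->
  (rho (cf B o2 th1) != 0 -> (cf B o2 th1).@[row_pt B o1] != 0) ->
  (rho (cf B o2 th2) != 0 -> (cf B o2 th2).@[row_pt B o1] != 0) ->
  exists ps1 ps2, fbasis (f' * a) ps1 ps2 e1 e2.+1.
Proof.
move=> Ne1 bas; have [[h1 h2] d1 d2 gen ind] := bas.
have hc1 : cf B o2 th1 \is e1.-homog := cf_homog B o2 h1.
have hc2 : cf B o2 th2 \is e2.-homog := cf_homog B o2 h2.
set c1 := rho (cf B o2 th1); set c2 := rho (cf B o2 th2) => p1 p2.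
have s1 : c1 != 0 -> size c1 = e1.+1 by move/p1/(size_rho hc1).
have s2 : c2 != 0 -> size c2 = e2.+1 by move/p2/(size_rho hc2).
have rho_aM t : rho (a * t) = 0 by rewrite rmorphM rho_a // mul0r.
have c0 : (c1 != 0) || (c2 != 0).
  have [th [s [_ /gen[g1 [g2 gE]] E]]] := vec_der o2.
  have := congr1 rho (cf_lin B o2 gE).
  rewrite (cf_vec_euler _ E) scale1r rmorphB [s * _]mulrC rho_aM subr0 rmorphD !rmorphM -/c1 -/c2 => fE.
  rewrite -negb_and; apply: contra ff0 => /andP[/eqP z1 /eqP z2].
  by rewrite fE z1 z2 !mulr0 addr0.
pose g := gcdp c1 c2; pose m := (size g).-1.
have g0 : g != 0 by rewrite gcdp_eq0 negb_and.
pose q1 := c1 %/ g; pose q2 := c2 %/ g.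
have c1E : c1 = q1 * g by rewrite divpK // dvdp_gcdl.
have c2E : c2 = q2 * g by rewrite divpK // dvdp_gcdr.
have [[u v] /= uv] : exists u, u.1 * q1 + u.2 * q2 = 1.
  by apply/Bezout_eq1_coprimepP; apply: coprimep_div_gcd.
have syz (x y : {poly F}) : x * c1 + y * c2 = 0 -> exists k, x = k * q2 /\ y = - k * q1.
  rewrite c1E c2E => E; have {}E : x * q1 + y * q2 = 0.
    by apply: (mulIf g0); rewrite mul0r -E; ring.
  exists (v * x - u * y); split.
    transitivity ((u * q1 + v * q2) * x - u * (x * q1 + y * q2)); last by ring.
    by rewrite uv E mul1r mulr0 subr0.
  transitivity ((u * q1 + v * q2) * y - v * (x * q1 + y * q2)); last by ring.
  by rewrite uv E mul1r mulr0 subr0.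
have sg : size g = m.+1 by rewrite prednK // size_poly_gt0.
have szq (c : {poly F}) e (q : {poly F}) : (c != 0 -> size c = e.+1) -> c = q * g -> q != 0 ->
    (size q + m = e.+1)%N.
  move=> sc cE q0; rewrite -sc; last by rewrite cE mulf_neq0.
  by rewrite cE size_mul // sg addnS.
have mle : (m <= e1 + e2)%N.
  have [q10|q10] := eqVneq q1 0; last first.
    by move: (szq _ _ _ s1 c1E q10) (q10); rewrite -size_poly_gt0; clear; move: (size _) m => x m; lia.
  have q20 : q2 != 0.
    apply: contraTneq c0 => q20; by rewrite c1E c2E q10 q20 mul0r eqxx.
  move: (szq _ _ _ s2 c2E q20) (q20); rewrite -size_poly_gt0; clear; move: (size _) m => x m; lia.
have lift (c : {poly F}) e (q : {poly F}) : (c != 0 -> size c = e.+1) -> c = q * g ->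
    exists2 R, rho R = q & forall e' p, p \is e'.-homog -> R * p \is (e + e' - m).-homog.
  move=> sc cE; have [->|q0] := eqVneq q 0.
    by exists 0; [rewrite rmorph0|move=> *; rewrite mul0r rpred0].
  have sq := szq c e q sc cE q0.
  have le : (m <= e)%N by move: sq; rewrite -size_poly_gt0 in q0; move: q0; clear; move: (size _) m => n m; lia.
  have [|R hR RE] := @rho_lift _ _ uB (e - m) q.
    by move: sq le; clear; move: (size _) m => n m; lia.
  exists R => // e' p hp; rewrite addnC -addnBA // addnC; exact: dhomogM.
have [R1 R1E hR1] := lift _ _ _ s1 c1E; have [R2 R2E hR2] := lift _ _ _ s2 c2E.
pose E := (e1 + e2 - m)%N.
pose th0 j := R2 * th1 j - R1 * th2 j.
have h0 j : th0 j \is E.-homog.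
  by apply: rpredB; [rewrite /E addnC; apply: hR2|apply: hR1].
have th0E j : th0 j = R2 * th1 j + (- R1) * th2 j by rewrite mulNr.
have d0 : der th0 f' = 0 by rewrite (der_lin _ th0E) d1 d2 !mulr0 addr0.
have [t tE] : exists t, cf B o2 th0 = a * t.
  apply: (rho_ker uB (cf_homog B o2 h0)); rewrite (cf_lin B o2 th0E).
  rewrite rmorphD !rmorphM rmorphN R1E R2E -/c1 -/c2 c1E c2E; ring.
have [|s0 D0 H0] := euler_proj char0 hfa fa0 h0 (c := t).
  by rewrite derM d0 der_L // tE; ring.
pose V1 := rho (wedge th1); pose V2 := rho (wedge th2).
pose W := rho (wedge th0).
have WE : W = q2 * V1 - q1 * V2.
  by rewrite /W (wedge_lin B th0E) rmorphD !rmorphM rmorphN R1E R2E mulNr.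
have gW th g1 g2 s : (forall j, th j = g1 * th1 j + g2 * th2 j) -> cf B o2 th = a * s ->
    exists k, [/\ rho g1 = k * q2, rho g2 = - k * q1 & rho (wedge th) = k * W].
  move=> gE sE; have := congr1 rho (cf_lin B o2 gE).
  rewrite sE rho_aM rmorphD !rmorphM => /esym/syz[k [k1 k2]]; exists k; split=> //.
  rewrite (wedge_lin B gE) rmorphD !rmorphM k1 k2 WE -/V1 -/V2; ring.
have low e th : (forall j, th j \is e.-homog) -> der th (f' * a) = 0 -> W %| rho (wedge th).
  move=> _ D; have [s sE dfs] := tangent_line uB ff0 D.
  have := der_eulerB char0 hf dfs; set c := _ *: _ => /gen[g1 [g2 gE]].
  have [|k [_ _ kE]] := gW _ _ _ (s - c) gE.
    rewrite (@cf_lin F B 1 (- c) th (fun j => 'X_j)) => [|j]; last by ring.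
    by rewrite sE cf_euler; ring.
  by rewrite -(wedge_eulerB B th c) kE dvdp_mull.
have sW : (size W).-1 = e1.+1.
  rewrite -Ne1; apply: key => //; first exact: lower_f' low.
  move=> ze _; exists E, (fun j => th0 j - s0 * 'X_j); split=> //.
  by exists 1; rewrite ?hornerC ?oner_eq0 // wedge_eulerB mulr1.
have W0 : W != 0 by rewrite -size_poly_eq0; apply: contraPneq sW => ->.
have [upper _] := rho_top uB (wedge_homog B h0).
(* W might lose degree by vanishing at infinity. This is excluded by -Z f' = k W, where k has degree
   at most d+1-E because k q2 and -k q1 are restrictions of coefficients of known degree. *)
have lowerE : (E.+2 <= size W)%N.
  have [th [s [hth D thE]]] := vec_der o0.
  have [g1 [g2 [gd1 gd2 gE]]] := fbasis_homog bas D hth.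
  have [|k [k1 k2 kE]] := gW _ _ _ (- s) gE.
    by rewrite (cf_vec_euler _ thE) scale0r; ring.
  have {}kE : - 'X * rho f' = k * W by rewrite -kE (wedge_vec0 thE).
  have k0 : k != 0.
    apply: contraNneq ff0 => k0; move/eqP: kE; rewrite k0 mul0r mulf_eq0.
    by rewrite oppr_eq0 polyX_eq0.
  have szE : (size (rho f')).+1 = (size (k * W)) by rewrite -kE mulNr size_polyN mulrC size_mulX.
  rewrite size_mul // (size_rho hf fpinf) in szE.
  suff bd : (size k + e1 + e2 <= d.+2 + m)%N.
    rewrite /E; move: szE bd mle; clear; move: (size k) (size W) m => x y m; lia.
  have [z1|z1] := eqVneq c1 0.
    have q20 : q2 != 0.
      by rewrite z1 eqxx /= in c0; apply: contraNneq c0 => q20; rewrite c2E q20 mul0r.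
    have [gs|gz] := gdeg_size gd1; last first.
      by move/eqP: k1; rewrite gz rmorph0 eq_sym mulf_eq0 (negPf k0) (negPf q20).
    move: gs (szq _ _ _ s2 c2E q20); rewrite k1 size_mul //.
    move: q20; rewrite -size_poly_gt0; clear; move: (size k) (size q2) m => x y m; lia.
  have q10 : q1 != 0 by apply: contraNneq z1 => q10; rewrite c1E q10 mul0r.
  have [gs|gz] := gdeg_size gd2; last first.
    by move/eqP: k2; rewrite gz rmorph0 eq_sym mulf_eq0 oppr_eq0 (negPf k0) (negPf q10).
  move: gs (szq _ _ _ s1 c1E q10); rewrite k2 mulNr size_polyN size_mul //.
  move: q10; rewrite -size_poly_gt0; clear; move: (size k) (size q1) m => x y m; lia.
have sWE : size W = e1.+2 by rewrite -sW prednK // size_poly_gt0.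
have Ee1 : E.+2 = e1.+2 by apply/eqP; rewrite -sWE eqn_leq lowerE upper.
have e2m : e2 = m by move: Ee1 mle; rewrite /E; clear; move: m => m; lia.
have nondiv (c : S) : rho c != 0 -> ~ (exists t, c = a * t).
  by move=> c0' [x xE]; move: c0'; rewrite xE rho_aM eqxx.
(* If c2 = 0 the gcd is c1, so e1 = m = e2 and the two basis elements may be exchanged. *)
have [c20|c20] := eqVneq c2 0.
  have c10 : c1 != 0 by move: c0; rewrite c20 eqxx orbF.
  have e12 : e1 = e2.
    by apply/eqP; rewrite e2m -eqSS -(s1 c10) -sg /g c20 gcdp0.
  have [t2 t2E] := rho_ker uB hc2 c20.
  rewrite {1}e12 -{2}e12; exact: (build1 char0 uB hf ff0 (fbasis_sym bas) t2E (nondiv _ c10)).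
have gc2 : c2 %= g.
  by rewrite eqp_sym -dvdp_size_eqp ?dvdp_gcdr // sg s2 // e2m.
have [H hH HE] : exists2 H, rho H * c2 = c1 & H = 0 \/ exists2 k, H \is k.-homog & (k + e2 = e1)%N.
  have [->|c10] := eqVneq c1 0; first by exists 0; [rewrite rmorph0 mul0r|left].
  have /dvdpP[q qE] : c2 %| c1 by rewrite (eqp_dvdl _ gc2) dvdp_gcdl.
  have q0 : q != 0 by apply: contraNneq c10 => q0; rewrite qE q0 mul0r.
  have sq : (size q + e2 = e1.+1)%N.
    by move: (s1 c10); rewrite qE size_mul // s2 // addnS.
  have le : (e2 <= e1)%N by move: sq; rewrite -size_poly_gt0 in q0; move: q0; clear; move: (size _) => n; lia.
  have [|H hH HE] := @rho_lift _ _ uB (e1 - e2) q.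
    by rewrite -(leq_add2r e2) addSn subnK // sq.
  by exists H; [rewrite HE qE|right; exists (e1 - e2)%N; rewrite ?subnK].
have bas' : fbasis f' (fun j => th1 j - H * th2 j) th2 e1 e2.
  case: HE => [->|[k hk ke]]; last exact: fbasis_sym (fbasis_shear hk ke (fbasis_sym bas)).
  by rewrite (_ : (fun _ => _) = th1) //; apply/funext => j; rewrite mul0r subr0.
have [[h1' _] _ _ _ _] := bas'.
have [|t1 t1E] := rho_ker uB (cf_homog B o2 h1').
  rewrite (@cf_lin F B 1 (- H) th1 th2) => [|j]; last by ring.
  by rewrite mul1r rmorphD rmorphM rmorphN mulNr hH subrr.
exact: (build1 char0 uB hf ff0 bas' t1E (nondiv _ c20)).
Qed.
End AddLine.

(** * Coordinates adapted to an arbitrary line *)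

Section GeneralLine.
Variable F : closedFieldType.
Hypothesis char0 : forall n, n.+1%:R != 0 :> F.
Local Notation S := {mpoly F[3]}.

Lemma Lf_dual (B : 'M[F]_3) (w : 'I_3 -> F) k : B \in unitmx ->
  (forall l, \sum_j B l j * w j = (l == k)%:R) -> Lf B k = \sum_j w j *: 'X_j.
Proof. by move=> uB h; apply: eq_bigr => j _; rewrite (invmx_col uB h). Qed.

(** The finitely many given forms that are not divisible by a have finitely many zeros on the line.
    A parameter z outside the roots of the product of their nonzero restrictions gives the point at
    infinity p + z q. *)
Lemma line_basis (a : S) (s : seq S) : a != 0 -> a \is 1.-homog ->
  exists p0 pinf r, [/\ basis_mx p0 pinf r \in unitmx, a = Lf (basis_mx p0 pinf r) o2 &
    forall H e, H \in s -> H \is e.-homog -> ~ (exists t, H = a * t) -> H.@[pinf] != 0].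
Proof.
move=> a0 ha; pose w i := a@_(U_(i))%MM.
have aE : a = \sum_(i < 3) w i *: 'X_i by apply: homog_linear.
have [i wi] : exists i, w i != 0.
  apply: contrapT => h; case/eqP: a0; rewrite aE big1 // => i _.
  have [->|wi] := eqVneq (w i) 0; first by rewrite scale0r.
  by case: h; exists i.
have [j [k u]] : exists j k : 'I_3, uniq [:: i; j; k].
  by move: i {wi}; apply: ord3P; [exists o1, o2|exists o0, o2|exists o0, o1].
have ijk := ord3_uniqP u.
have [ij [ik jk]] : i != j /\ i != k /\ j != k.
  by move: u; rewrite /= !inE negb_or => /and3P[/andP[-> ->] ->].
have eE := (eqxx, negPf ij, negPf ik, negPf jk, eq_sym j i, eq_sym k i, eq_sym k j).
(* p and q span the kernel of the form with coefficients w, and w(r) = 1, so a is the third form of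
   the dual basis. *)
pose p l := w i * (l == j)%:R - w j * (l == i)%:R.
pose q l := w i * (l == k)%:R - w k * (l == i)%:R.
pose r l := (w i)^-1 * (l == i)%:R.
have wsum (f g : 'I_3 -> F) (x y : F) : \sum_l (x * f l - y * g l) * w l
    = x * (\sum_l f l * w l) - y * (\sum_l g l * w l).
  by rewrite !mulr_sumr -sumrB; apply: eq_bigr => l _; ring.
have wd m : \sum_(l < 3) (l == m)%:R * w l = w m.
  rewrite (bigD1 m) //= eqxx mul1r big1 ?addr0 // => l ne.
  by rewrite (negPf ne) mul0r.
have wp : \sum_l p l * w l = 0 by rewrite wsum !wd mulrC subrr.
have wq : \sum_l q l * w l = 0 by rewrite wsum !wd mulrC subrr.
have wr : \sum_l r l * w l = 1.
  by under eq_bigr do rewrite /r -mulrA; rewrite -mulr_sumr wd mulVf.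
have ind x y z : (forall l, x * p l + y * q l + z * r l = 0) -> [/\ x = 0, y = 0 & z = 0].
  move=> h; have x0 : x = 0.
    have := h j; rewrite /p /q /r !eE !(mulr0, mulr1, subr0, addr0) => /eqP.
    by rewrite mulf_eq0 (negPf wi) orbF => /eqP.
  have y0 : y = 0.
    have := h k; rewrite x0 /p /q /r !eE !(mulr0, mulr1, subr0, addr0, mul0r, add0r) => /eqP.
    by rewrite mulf_eq0 (negPf wi) orbF => /eqP.
  split=> //; have := h i; rewrite x0 y0 /r eqxx !mul0r !add0r mulr1 => /eqP.
  by rewrite mulf_eq0 invr_eq0 (negPf wi) orbF => /eqP.
clearbody p q r.
have uB1 : basis_mx p q r \in unitmx by apply: basis_mx_unit.
have aB1 : a = Lf (basis_mx p q r) o2.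
  rewrite aE; apply/esym/Lf_dual => //; apply: ord3P;
    by under eq_bigr do rewrite mxE ?y30 ?y31 ?y32; rewrite ?wp ?wq ?wr.
pose rB := rho (basis_mx p q r).
pose P := \prod_(H <- s) (if rB H == 0 then 1 else rB H).
have /closed_nonrootP[z zP] : P != 0.
  apply: (big_ind (fun p : {poly F} => p != 0)) => [|p' q'|H _]; first exact: oner_neq0.
    exact: mulf_neq0.
  by case: ifP => [_|/negbT//]; apply: oner_neq0.
exists q, (fun l => p l + z * q l), r; set B := basis_mx _ _ _.
have uB : B \in unitmx.
  apply: basis_mx_unit => x y t h.
  have [|y0 + ->] := ind y (x + y * z) t; last by rewrite y0 mul0r addr0.
  by move=> l; rewrite -[RHS](h l); ring.
split=> //.
  rewrite aE; apply/esym/Lf_dual => //; apply: ord3P;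
    under eq_bigr do rewrite mxE ?y30 ?y31 ?y32 ?mulrDl -?mulrA; rewrite ?wq ?wr //.
  by rewrite big_split /= -mulr_sumr wp wq mulr0 addr0.
move=> H e Hs hH nd; have rH : rB H != 0.
  by apply/eqP => r0; apply: nd; rewrite aB1; exact: (rho_ker uB1 hH r0).
rewrite -(rho_horner p q r H z) -/(root _ _); apply: contra zP => zH.
rewrite /P; move: Hs; clear P; elim: s => // H' s IH; rewrite inE big_cons rootM => /orP[/eqP <-|/IH ->].
  by rewrite (negPf rH) zH.
by rewrite orbT.
Qed.

Section Points.
Variables (a f' : S) (d : nat).
Hypotheses (a0 : a != 0) (ha : a \is 1.-homog) (hf : f' \is d.+1.-homog).
Hypothesis af : ~ exists t, f' = a * t.
Variables (n : nat) (pts : 'I_n -> 'I_3 -> F) (muC tauC muC' tauC' : 'I_n -> nat) (N : nat).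
Hypothesis pts_on : forall k, [/\ exists j, pts k j != 0, f'.@[pts k] = 0 & a.@[pts k] = 0].
Hypothesis pts_inj : forall k l, (exists c, forall i, pts l i = c * pts k i) -> k = l.
Hypothesis pts_all : forall v, (exists j, v j != 0) -> f'.@[v] = 0 -> a.@[v] = 0 ->
     exists k c, forall i, v i = c * pts k i.
Hypotheses (mC : forall k, milnorS (f' * a) (pts k) (muC k))
  (tC : forall k, tjurinaS (f' * a) (pts k) (tauC k))
  (mC' : forall k, milnorS f' (pts k) (muC' k)) (tC' : forall k, tjurinaS f' (pts k) (tauC' k)).
Hypothesis NE : n%:Z + \sum_(k < n) (((muC k)%:Z - (tauC k)%:Z) - ((muC' k)%:Z - (tauC' k)%:Z))
  = N%:Z + 1.

(** For adding the line, the point at infinity must also avoid the zeros of th1(a) and th2(a), so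
    the coordinates can be chosen only after the basis of derivations is given. *)
Lemma add_line e2 :
  ((exists th1 th2, fbasis f' th1 th2 N e2) -> exists th1 th2, fbasis (f' * a) th1 th2 N e2.+1) /\
  ((exists th1 th2, fbasis (f' * a) th1 th2 N e2) ->
     exists2 e, e2 = e.+1 & exists th1 th2, fbasis f' th1 th2 N e).
Proof.
have key p0 pinf r : basis_mx p0 pinf r \in unitmx -> a = Lf (basis_mx p0 pinf r) o2 ->
    f'.@[pinf] != 0 -> forall w, w %| rho (basis_mx p0 pinf r) f' ->
    (forall e th, (forall j, th j \is e.-homog) -> der th (f' * a) = 0 ->
       w %| rho (basis_mx p0 pinf r) (wedge (basis_mx p0 pinf r) th)) ->
    (forall ze, root (rho (basis_mx p0 pinf r) f') ze -> exists e th,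
       [/\ forall j, th j \is e.-homog, der th (f' * a) = 0 &
       exists2 q, rho (basis_mx p0 pinf r) (wedge (basis_mx p0 pinf r) th) = w * q & q.[ze] != 0]) ->
    (size w).-1 = N.+1.
  move=> uB aE fpinf w wf low att; have := NE.
  move: mC tC pts_on pts_all low att; rewrite aE => mC1 tC1 on1 all1 low att.
  rewrite (key_degree char0 uB hf fpinf on1 pts_inj all1 mC1 tC1 mC' tC' wf low att).
  by rewrite -PoszD addn1 => -[].
have fin s := line_basis (f' :: s) a0 ha.
split=> -[th1 [th2 bas]].
  have [[h1 h2] _ _ _ _] := bas.
  have [p0 [pinf [r [uB aE nz]]]] := fin [:: der th1 a; der th2 a].
  have fpinf : f'.@[pinf] != 0 by apply: nz hf af; rewrite mem_head.
  have top e th : (forall j, th j \is e.-homog) -> der th a \in [:: f'; der th1 a; der th2 a] ->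
      rho (basis_mx p0 pinf r) (cf (basis_mx p0 pinf r) o2 th) != 0 ->
      (cf (basis_mx p0 pinf r) o2 th).@[row_pt (basis_mx p0 pinf r) o1] != 0.
    move=> hth; rewrite basis_mx1 -der_L -aE => hin r0; apply: (nz _ e hin).
      by have := der_homog hth ha; rewrite addn0.
    by move=> [t tE]; move: r0; rewrite tE rmorphM {1}aE rho_a // mul0r eqxx.
  have fpinf' : f'.@[row_pt (basis_mx p0 pinf r) o1] != 0 by rewrite basis_mx1.
  have := key _ _ _ uB aE fpinf; rewrite {1 2}aE => key'.
  have := free_up char0 uB hf fpinf' key' (erefl N) bas; rewrite -aE; apply.
    by apply: top h1 _; rewrite !inE eqxx orbT.
  by apply: top h2 _; rewrite !inE eqxx !orbT.
have [p0 [pinf [r [uB aE nz]]]] := fin [::].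
have fpinf : f'.@[pinf] != 0 by apply: nz hf af; rewrite mem_head.
have fpinf' : f'.@[row_pt (basis_mx p0 pinf r) o1] != 0 by rewrite basis_mx1.
have := key _ _ _ uB aE fpinf; rewrite {1 2}aE => key'; move: bas; rewrite {1}aE => bas.
have [e [ps1 [ps2 [eE bas']]]] := free_down char0 uB hf fpinf' key' (erefl N) bas.
by exists e => //; exists ps1, ps2.
Qed.
End Points.
End GeneralLine.

(** * Complex curves *)

Lemma CC_char0 n : n.+1%:R != 0 :> CC.
Proof. by rewrite -[_ == _]/(n.+1%:R == 0 :> (Rdefinitions.R)[i]) pnatr_eq0. Qed.

Lemma in_local_idealE gens (v : vec3) h : in_local_ideal gens v h <-> sloc v gens h.
Proof.
split=> [[u [u0 [c cE]]]|[u u0 [c cE]]].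
  exists u; first exact: u0.
  exists (fun k => if insub k is Some i then c i else 0); rewrite cE.
  by apply: eq_bigr => i _; rewrite valK.
by exists u; split; [exact: u0|exists (fun i => c i)].
Qed.

Lemma local_dimE gens v n : local_dim gens v n -> sdim gens v n.
Proof.
move=> [[e [hs [hh ind]]] dep]; split.
  by exists e, hs; split=> // c /in_local_idealE; apply: ind.
move=> e' hs' /dep[c [c0 hc]]; exists c; split=> //; exact/in_local_idealE.
Qed.

Lemma chart_partialsE f i : exists j k : 'I_3,
  uniq [:: i; j; k] /\ chart_partials f i = [:: mderiv j f; mderiv k f].
Proof.
have en : enum 'I_3 = [:: o0; o1; o2].
  by apply: (inj_map val_inj); rewrite val_enum_ord.
rewrite /chart_partials en; move: i; apply: ord3P.
- by exists o1, o2.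
- by exists o0, o2.
- by exists o0, o1.
Qed.

Lemma milnorE f v n : milnor_number f v n -> milnorS f v n.
Proof.
move=> [i [vi /local_dimE]]; have [j [k [u ->]]] := chart_partialsE f i => h.
by exists i, j, k.
Qed.
Lemma tjurinaE f v n : tjurina_number f v n -> tjurinaS f v n.
Proof.
move=> [i [vi /local_dimE]]; have [j [k [u ->]]] := chart_partialsE f i => h.
by exists i, j, k.
Qed.

(** Used in both directions, it identifies the number of points with the number of terms in the sum
    defining epsilon. *)
Lemma enumerates_leq (P : vec3 -> Prop) n m (p : 'I_n -> vec3) (q : 'I_m -> vec3) :
  enumerates_points P p -> enumerates_points P q -> (n <= m)%N.
Proof.
move=> [onp injp _] [onq _ allq].
have /choice[s sE] k : exists l, proportional (q l) (p k).
  by have [nz Pk] := onp k; apply: allq.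
have si : injective s.
  move=> k l kl; apply: injp; have [c cE] := sE k; have [c' c'E] := sE l.
  have c0 : c != 0.
    have [[j pj] _] := onp k; apply: contraNneq pj => c0.
    by rewrite cE c0 mul0r.
  exists (c' / c) => j; rewrite c'E cE kl mulrA divfK //.
by have := leq_card s si; rewrite !card_ord.
Qed.

Lemma free_fbasis f (a b : nat) : free_with_exponents f a b <->
  exists th1 th2, fbasis f th1 th2 a b.
Proof.
split=> [[th1 [th2 [d1 d2 [n1 [[<-] h1]] [n2 [[<-] h2]] gen]]]|[th1 [th2 [[h1 h2] d1 d2 gen ind]]]].
  exists th1, th2; split=> //.
    by move=> th D; have [] := gen th D.
  move=> g1 g2 E; have [_ /(_ g1 g2 0 0)] := gen _ d1; apply.
  by move=> j; rewrite E !mul0r addr0.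
exists th1, th2; split=> //; [by exists a|by exists b|].
move=> th D; split; first exact: gen D.
move=> g1 g2 h1' h2' E; have [|e1 e2] := ind (g1 - h1') (g2 - h2').
  move=> j; transitivity ((g1 * th1 j + g2 * th2 j) - (h1' * th1 j + h2' * th2 j)); first by ring.
  by rewrite E subrr.
by split; apply/eqP; rewrite -subr_eq0 ?e1 ?e2.
Qed.

Lemma free_nat f a b : free_with_exponents f a b -> exists n m : nat, a = n%:Z /\ b = m%:Z.
Proof. by move=> [th1 [th2 [_ _ [n [-> _]] [m [-> _]] _]]]; exists n, m. Qed.

Theorem theorem3p4 (f' a : S) (d2 d3 : int) (nC'' : nat) (eps : int) :
  reduced_curve f' ->
  linear_form a ->
  ~ divides a f' ->
  num_intersection_points f' a nC'' ->
  dimca_epsilon f' a eps ->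
  nC''%:Z + eps = d2 + 1 ->
  (free_with_exponents f' d2 d3 <-> free_with_exponents (f' * a) d2 (d3 + 1)).
Proof.
move=> [[d [dpos hf]] f0 _] [a0 ha] naf [q qP] [n [pts [muC [tauC [muC' [tauC' [ptsP mtC mtC' ->]]]]]]] E.
have en : nC'' = n.
  by apply/eqP; rewrite eqn_leq (enumerates_leq qP ptsP) (enumerates_leq ptsP qP).
rewrite {}en in E; case: d dpos hf => // d _ hf.
have [pon pinj pall] := ptsP.
have pon' k : [/\ exists j, pts k j != 0, f'.@[pts k] = 0 & a.@[pts k] = 0].
  by have [nz [h1 h2]] := pon k.
have pall' v : (exists j, v j != 0) -> f'.@[v] = 0 -> a.@[v] = 0 ->
    exists k c, forall i, v i = c * pts k i by move=> nz h1 h2; apply: pall.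
have line (N : nat) : d2 = N%:Z -> forall e2, _ := fun dN => add_line CC_char0 a0 ha hf naf pon' pinj pall'
  (fun k => milnorE (mtC k).1) (fun k => tjurinaE (mtC k).2)
  (fun k => milnorE (mtC' k).1) (fun k => tjurinaE (mtC' k).2) (etrans E (congr1 (fun x => x + 1) dN)).
(* The exponents, a priori integers, are natural numbers as soon as one of the curves is free. *)
split=> fr; have [N [m [d2E d3E]]] := free_nat fr; move: fr; rewrite d2E d3E.
  by move/free_fbasis/(line N d2E m).1; rewrite -PoszD addn1 => fr; apply/free_fbasis.
move/free_fbasis/(line N d2E m).2 => [e mE fr].
have -> : d3 = e%:Z by apply: (addIr 1); rewrite d3E mE -PoszD addn1.
exact/free_fbasis.
Qed.
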